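(* Let $N,m>1$ be integers. Let $f:\mathbb{Z}/N\mathbb{Z}\to\mu_m\cup\{0\}$ have order $m$ and parity $a\in\{0,1\}$, with $f(1)=1$ and $f(n)=0$ if and only if $\gcd(n,N)>1$. Put $d=\gcd(m,N)$, and let $H\le(\mathbb{Z}/m\mathbb{Z})^\times$ be a subgroup such that the reduction map $\pi:H\to(\mathbb{Z}/d\mathbb{Z})^\times$ is surjective. Assume that, for each $c\in H$, the function $L(s,f^c)$ is holomorphic at $s=1$ and there exists $\varepsilon_c\in\mathbb{C}^\times$ such that $$\Lambda(s,f^c)=\varepsilon_c\,\Lambda(1-s,\overline{f^c}),\qquad s\in\mathbb{C}.$$ Then $L(s,f)$ admits the Euler product $$L(s,f)=\prod_{p}\Bigl(1-\frac{f(p)}{p^s}\Bigr)^{-1},\qquad \Re(s)>1,$$ where the product is over all primes $p$.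
   Context: $\mu_m\subset\mathbb{C}$ is the set of $m$-th roots of unity. A function $f$ on $\mathbb{Z}/N\mathbb{Z}$ is extended periodically to $\mathbb{Z}$. ''$f$ has order $m$'' means that $m$ is the minimal positive integer such that $f(x)\in\mu_m$ for all $x\in(\mathbb{Z}/N\mathbb{Z})^\times$. ''$f$ has parity $a\in\{0,1\}$'' means $f(-x)=(-1)^a f(x)$ for all $x\in\mathbb{Z}$. For $c\in(\mathbb{Z}/m\mathbb{Z})^\times$, $f^c(x):=f(x)^c$ when $\gcd(x,N)=1$ and $f^c(x):=0$ otherwise; $\overline{f^c}$ is its complex conjugate. For a function $g:\mathbb{Z}/N\mathbb{Z}\to\mathbb{C}$ (extended periodically), $L(s,g):=\sum_{n\ge1}g(n)n^{-s}$ for $\Re(s)>1$, and $L(s,g)$ also denotes its meromorphic continuation to $\mathbb{C}$ (holomorphic on $\mathbb{C}\setminus\{1\}$). With $a\in\{0,1\}$ the parity, the completed function is $$\Lambda(s,g):=\Bigl(\frac{N}{\pi}\Bigr)^{\frac{s+a}{2}}\Gamma\Bigl(\frac{s+a}{2}\Bigr)L(s,g),$$ regarded as a meromorphic function on $\mathbb{C}$. In the claim the same $a$ (the parity of $f$) is used for all $f^c$ and $\overline{f^c}$. *)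

(* Defs.v *)
From HB Require Import structures.
From mathcomp Require Import all_boot all_order all_algebra all_fingroup.
From mathcomp Require Import complex.
From mathcomp Require Import all_classical all_reals all_analysis.

Set Implicit Arguments.
Unset Strict Implicit.
Unset Printing Implicit Defensive.

Import Order.TTheory GRing.Theory Num.Theory.
Import numFieldNormedType.Exports.

Local Open Scope classical_set_scope.
Local Open Scope ring_scope.
Local Open Scope complex_scope.

(* R[i] is viewed as a normed module over itself, so that [derivable F z 1]
   is complex differentiability at z. *)
HB.instance Definition _ (R : realType) := NormedModule.copy R[i] R[i]^o.

Definition cexp (R : realType) (z : R[i]) : R[i] :=
  (expR (complex.Re z))%:C * (cos (complex.Im z) +i* sin (complex.Im z)).

(* x ^ s for x > 0 only (ln is 0 on nonpositive reals). *)
Definition rpowc (R : realType) (x : R) (s : R[i]) : R[i] :=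
  cexp ((ln x)%:C * s).

(* Euler's integral of t ^ (z - 1) e ^ (- t) over t > 0, for Re z > 0. *)
Definition Gamma_int (R : realType) (z : R[i]) : R[i] :=
  let h (t : R) := rpowc t (z - 1) * (expR (- t))%:C in
  (\int[lebesgue_measure]_(t in `]0, +oo[) complex.Re (h t)) +i*
  (\int[lebesgue_measure]_(t in `]0, +oo[) complex.Im (h t)).

(* Continuation by Gamma (z + n) = z (z + 1) ... (z + n - 1) Gamma z, with n
   such that Re (z + n) > 0. The value at the poles 0, -1, -2, ... is 0. *)
Definition Gamma (R : realType) (z : R[i]) : R[i] :=
  let n := if 0 < complex.Re z then 0%N
           else (Num.truncn (- complex.Re z)).+1 in
  Gamma_int (z + n%:R) / \prod_(k < n) (z + k%:R).

Definition holomorphic_at (R : realType) (F : R[i] -> R[i]) (z0 : R[i]) :=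
  \forall z \near z0, derivable F z 1.

(* A meromorphic function is represented by a total function whose values on
   a closed discrete set are irrelevant. Hence the next three notions only
   involve punctured neighbourhoods. *)
Definition mero_eq (R : realType) (F G : R[i] -> R[i]) :=
  forall z0 : R[i], \forall z \near z0^', F z = G z.

Definition mero_holomorphic_at (R : realType) (F : R[i] -> R[i]) (z0 : R[i]) :=
  exists2 G : R[i] -> R[i],
    holomorphic_at G z0 & \forall z \near z0^', F z = G z.

Definition meromorphic_at (R : realType) (F : R[i] -> R[i]) (z0 : R[i]) :=
  exists n : nat, mero_holomorphic_at (fun z => (z - z0) ^+ n * F z) z0.

(* The extension of g : Z/N -> C to integers n is n |-> g n%:R. *)
Definition Lseries (R : realType) (N : nat) (g : 'Z_N -> R[i]) (s : R[i]) :
    R[i] :=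
  \big[+%R/0]_(1 <= n <oo) (g n%:R * rpowc n%:R (- s)).

Definition is_Lcontinuation (R : realType) (N : nat) (g : 'Z_N -> R[i])
    (F : R[i] -> R[i]) :=
  [/\ forall z : R[i], meromorphic_at F z,
      forall z : R[i], z != 1 -> holomorphic_at F z
    & forall s : R[i], 1 < complex.Re s -> F s = Lseries g s].

(* The continuation exists and is unique away from 1. *)
Definition dirichlet_L (R : realType) (N : nat) (g : 'Z_N -> R[i]) :
    R[i] -> R[i] :=
  xget (fun=> 0) [set F | is_Lcontinuation g F].

Definition Lambda (R : realType) (N a : nat) (g : 'Z_N -> R[i]) (s : R[i]) :
    R[i] :=
  rpowc (N%:R / pi) ((s + a%:R) / 2) * Gamma ((s + a%:R) / 2) *
  dirichlet_L g s.

Definition has_order (R : realType) (N : nat) (f : 'Z_N -> R[i]) (m : nat) :=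
  let in_mu k := forall x : 'Z_N, x \is a GRing.unit -> k.-unity_root (f x) in
  [/\ (0 < m)%N, in_mu m & forall k, (0 < k)%N -> in_mu k -> (m <= k)%N].

Definition has_parity (R : realType) (N : nat) (f : 'Z_N -> R[i]) (a : nat) :=
  forall x : 'Z_N, f (- x) = (-1) ^+ a * f x.

(* For f with values in the m-th roots of unity, f x ^+ c only depends on c
   modulo m; the representative of c in [0, m) is used. *)
Definition twist (R : realType) (N m : nat) (f : 'Z_N -> R[i])
    (c : {unit 'Z_m}) (x : 'Z_N) : R[i] :=
  if coprime x N then f x ^+ (val c : 'Z_m) else 0.

(* Surjectivity of the reduction H -> (Z/d)^*, for d dividing m, in terms of
   congruences because 'Z_d is not Z/d when d = 1. *)
Definition reduction_surjective (m d : nat) (H : {set {unit 'Z_m}}) :=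
  forall b : nat, coprime b d ->
    exists2 c : {unit 'Z_m}, c \in H & (val c : 'Z_m) = b %[mod d].

(* Main.v *)
Require Import Defs.
From HB Require Import structures.
From mathcomp Require Import all_boot all_order all_algebra all_fingroup.
From mathcomp Require Import complex.
From mathcomp Require Import all_classical all_reals all_analysis.
From mathcomp Require Import measurable_realfun polydiv algC cyclotomic.
From mathcomp Require Import ring lra zify.

(** The functional equation is used at the integers k of the parity of f only.
    Dividing it at s by the same equation at s + 2 leaves, of the Gamma factors,
    just Gamma (z + 1) = z Gamma z, and letting s tend to k gives
      L(k, g) L(-1-k, g') = c_k L(k+2, g) L(1-k, g'),     g' = conj g,
    for every g = f^c with c in H and an explicit c_k. Up to explicit factors the
    values at the negative integers 1-k and -1-k are those of the Fourier
    transform h(n) = sum_x g'(x) e(nx/N) at k and k+2 (perE_negnat), so the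
    relation says that L(k, h) / L(k, g) is unchanged when k grows by 2. Hence
    L(k, h - tau_c g) = 0 for some tau_c and infinitely many k, and uniqueness of
    Dirichlet coefficients gives
      sum_x conj g(x) e(nx/N) = tau_c g(n)     for all n, with tau_c <> 0
    (fhat_conj_proportional).

    For c = 1, eliminating tau_1 leaves integer polynomial relations between
    powers of a primitive root of unity of order m N. By irreducibility of the
    cyclotomic polynomial they may be conjugated (int_relation_conj). For b
    prime to N pick c in H congruent to b modulo gcd(m, N), and then an exponent
    congruent to c modulo m and to b modulo N: the conjugate relation, compared
    with the one for f^c, reads f^c(bn) = f^c(b) f^c(n) (twist_shift). As c is
    invertible modulo m, f itself is completely multiplicative, and the Euler
    product follows by sieving out one prime after the other (euler_product).

    The rest is complex analysis from first principles: Goursat's and Cauchy's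
    theorems on rectangles give the identity theorem and Weierstrass' theorem;
    iterated summation by parts continues sum_n w^n n^-s for the roots of unity
    w <> 1, and with the zeta function this continues L(s, g) for every periodic
    g. *)

Set Implicit Arguments.
Unset Strict Implicit.
Unset Printing Implicit Defensive.

Import Order.TTheory GRing.Theory Num.Theory.
Import numFieldNormedType.Exports.
Import ComplexField.Normc.

Local Open Scope classical_set_scope.
Local Open Scope ring_scope.
Local Open Scope complex_scope.

Local Notation Re := complex.Re.
Local Notation Im := complex.Im.

(** * Complex numbers, their modulus, and complex derivatives *)
Section ComplexBasics.
Variable R : realType.
Implicit Types (z w l : R[i]) (x y e d : R).

Lemma normrcE z : `|z| = (normc z)%:C. Proof. by []. Qed.

Lemma normc_ge0 z : 0 <= normc z.
Proof. by rewrite -lecR -[X in _ <= X]normrcE normr_ge0. Qed.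

Lemma normc_eq0 z : (normc z == 0) = (z == 0).
Proof. by apply/eqP/eqP => [/eq0_normc//|->]; rewrite normc0. Qed.

Lemma normc_gt0 z : (0 < normc z) = (z != 0).
Proof. by rewrite lt_def normc_ge0 andbT normc_eq0. Qed.

Lemma normc_distC z w : normc (z - w) = normc (w - z).
Proof. by rewrite -normcN opprB. Qed.

Lemma le_normcB z w : normc (z - w) <= normc z + normc w.
Proof. by rewrite -(normcN w) le_normcD. Qed.

Lemma le_normc_distD t z w : normc (z - w) <= normc (z - t) + normc (t - w).
Proof. by have := le_normcD (z - t) (t - w); rewrite addrA subrK. Qed.

Lemma lerB_normc z w : normc z - normc w <= normc (z - w).
Proof. by rewrite lerBlDr; have := le_normcD (z - w) w; rewrite subrK. Qed.

Lemma normcR x : normc x%:C = `|x|.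
Proof. by rewrite /normc /= expr0n addr0 sqrtr_sqr. Qed.

Lemma normc_nat n : normc (n%:R : R[i]) = n%:R.
Proof. by rewrite -(rmorph_nat (real_complex R)) normcR normr_nat. Qed.

Lemma normcX z n : normc (z ^+ n) = normc z ^+ n.
Proof. by elim: n => [|n IH]; rewrite ?normc1 // !exprS normcM IH. Qed.

Lemma normc_sum I (r : seq I) (P : pred I) (u : I -> R[i]) :
  normc (\sum_(i <- r | P i) u i) <= \sum_(i <- r | P i) normc (u i).
Proof.
elim/big_rec2 : _ => [|i y x _ h]; first by rewrite normc0.
by rewrite (le_trans (le_normcD _ _))// lerD2l.
Qed.

Lemma normr_Re z : `|Re z| <= normc z.
Proof. by rewrite -lecR; exact: normc_ge_Re. Qed.

Lemma normr_Im z : `|Im z| <= normc z.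
Proof.
case: z => x y; rewrite /normc /= -(sqrtr_sqr y) ler_wsqrtr//.
by rewrite lerDr sqr_ge0.
Qed.

Lemma normc_le_ReIm z : normc z <= `|Re z| + `|Im z|.
Proof.
case: z => x y; have e : x +i* y = x%:C + 'i * y%:C by simpc.
rewrite {1}e.
rewrite (le_trans (le_normcD _ _))// normcM !normcR /= lerD2l.
by rewrite /normc /= !expr0n expr1n add0r sqrtr1 mul1r.
Qed.

Lemma normci : normc ('i : R[i]) = 1.
Proof. by rewrite /normc /= expr0n expr1n add0r sqrtr1. Qed.

Lemma ReB z w : Re (z - w) = Re z - Re w.
Proof. by case: z w => ? ? []. Qed.
Lemma ImB z w : Im (z - w) = Im z - Im w.
Proof. by case: z w => ? ? []. Qed.
Lemma ReD z w : Re (z + w) = Re z + Re w.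
Proof. by case: z w => ? ? []. Qed.
Lemma ImD z w : Im (z + w) = Im z + Im w.
Proof. by case: z w => ? ? []. Qed.
Lemma ReN z : Re (- z) = - Re z. Proof. by case: z. Qed.
Lemma ReRM x z : Re (x%:C * z) = x * Re z.
Proof. by case: z => ? ? /=; rewrite mul0r subr0. Qed.
Lemma ImRM x z : Im (x%:C * z) = x * Im z.
Proof. by case: z => ? ? /=; rewrite mul0r addr0. Qed.
Lemma Re_nat n : Re (n%:R : R[i]) = n%:R.
Proof. by rewrite -(rmorph_nat (real_complex R)). Qed.

Lemma Re_sum I (r : seq I) (P : pred I) (u : I -> R[i]) :
  Re (\sum_(i <- r | P i) u i) = \sum_(i <- r | P i) Re (u i).
Proof. by elim/big_rec2 : _ => [//|i y x _ <-]; rewrite ReD. Qed.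
Lemma Im_sum I (r : seq I) (P : pred I) (u : I -> R[i]) :
  Im (\sum_(i <- r | P i) u i) = \sum_(i <- r | P i) Im (u i).
Proof. by elim/big_rec2 : _ => [//|i y x _ <-]; rewrite ImD. Qed.

Lemma gt0cP (z : R[i]) : 0 < z -> exists2 e : R, 0 < e & z = e%:C.
Proof.
move=> z0; exists (Re z).
  by move: z0; rewrite ltcE => /andP[].
by rewrite RRe_real// gtr0_real.
Qed.

Lemma cvgcP {T : Type} {F : set_system T} {FF : Filter F} (f : T -> R[i]) l :
  f @ F --> l <-> forall e, 0 < e -> \forall t \near F, normc (f t - l) < e.
Proof.
split=> [/cvgrPdist_lt fl e e0|fl].
  have /fl : 0 < e%:C :> R[i] by rewrite ltcR.
  by apply: filterS => t; rewrite normrcE ltcR normc_distC.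
apply/cvgrPdist_lt => _ /gt0cP[e e0 ->]; apply: filterS (fl e e0) => t.
by rewrite normrcE ltcR normc_distC.
Qed.

Lemma nbhscP z (P : R[i] -> Prop) : (\forall w \near z, P w) <->
  exists2 d : R, 0 < d & forall w, normc (w - z) < d -> P w.
Proof.
split=> [/nbhs_normP[_ /gt0cP[d d0 ->] h]|[d d0 h]].
  exists d => // w wz; apply: h.
  by rewrite /ball_ /= normrcE ltcR normc_distC.
apply/nbhs_normP; exists d%:C => /=; first by rewrite ltcR.
by move=> w; rewrite /ball_ /= normrcE ltcR normc_distC; exact: h.
Qed.

Lemma dnbhscP z (P : R[i] -> Prop) : (\forall w \near z^', P w) <->
  exists2 d : R, 0 < d & forall w, w != z -> normc (w - z) < d -> P w.
Proof.
split=> [/nbhscP[d d0 h]|[d d0 h]]; first by exists d => // w wz /h; apply.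
by apply/nbhscP; exists d => // w wd wz; exact: h.
Qed.

(** Differentiability with an explicit real modulus; this form does not go
    through the normed module structure of the complex numbers. *)
Definition cder_at (F : R[i] -> R[i]) z l := forall e : R, 0 < e ->
  exists2 d : R, 0 < d & forall w, normc (w - z) < d ->
    normc (F w - F z - l * (w - z)) <= e * normc (w - z).

Lemma derivable_cderP (F : R[i] -> R[i]) z :
  derivable F z 1 <-> exists l, cder_at F z l.
Proof.
split.
  move=> /cvg_ex[l /cvgcP Fl]; exists l => e e0.
  have /dnbhscP[d d0 h] := Fl e e0; exists d => // w wz.
  have [->|wNz] := eqVneq w z; first by rewrite !subrr mulr0 subrr normc0 mulr0.
  have wz0 : w - z != 0 by rewrite subr_eq0.
  have := h (w - z) wz0; rewrite subr0 => /(_ wz)/ltW.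
  rewrite /= scaler1 subrK => hle.
  have -> : F w - F z - l * (w - z)
    = ((w - z)^-1 *: (F w - F z) - l) * (w - z).
    by rewrite mulrBl /GRing.scale /= mulrAC mulVf// mul1r.
  by rewrite normcM ler_wpM2r ?normc_ge0.
move=> [l Fl]; apply/cvg_ex; exists l; apply/cvgcP => e e0.
have e20 : 0 < e / 2 by rewrite divr_gt0.
have [d d0 h] := Fl _ e20.
apply/dnbhscP; exists d => // k k0; rewrite subr0 => kd /=.
have := h (k + z); rewrite addrK => /(_ kd) hk.
rewrite scaler1.
have -> : k^-1 *: (F (k + z) - F z) - l = (F (k + z) - F z - l * k) / k.
  by rewrite mulrBl mulfK// /GRing.scale /= mulrC.
rewrite normcM normcV ltr_pdivrMr ?normc_gt0// (le_lt_trans hk)//.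
by rewrite ltr_pM2r ?normc_gt0// ltr_pdivrMr// ltr_pMr// ltr1n.
Qed.

Lemma cvg_complexP {T : Type} {F : set_system T} {FF : Filter F}
    (f : T -> R[i]) l : f @ F --> l <->
  (fun t => Re (f t)) @ F --> Re l /\
  (fun t => Im (f t)) @ F --> Im l.
Proof.
split=> [/cvgcP fl|[/cvgrPdist_lt fr /cvgrPdist_lt fi]].
  split; apply/cvgrPdist_lt => e /fl; apply: filterS => t; rewrite normc_distC;
    apply: le_lt_trans => /=; rewrite -?ReB -?ImB.
    exact: normr_Re.
  exact: normr_Im.
apply/cvgcP => e e0; have e20 : 0 < e / 2 by rewrite divr_gt0.
near=> t; rewrite normc_distC (le_lt_trans (normc_le_ReIm _))//.
rewrite [e]splitr ReB ImB ltrD//; near: t; [exact: fr|exact: fi].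
Unshelve. all: by end_near. Qed.

End ComplexBasics.

(** * Limits and absolutely convergent series of complex numbers *)
Section AbsoluteSeries.
Variable R : realType.
Implicit Types (u : nat -> R[i]) (v : nat -> R).

(** Convergence in the real-valued modulus, so that the estimates stay in the
    ordered field of real numbers. *)
Definition clim {T : Type} (F : set_system T) (f : T -> R[i]) (l : R[i]) :=
  forall e : R, 0 < e -> \forall t \near F, normc (f t - l) < e.

Definition csum u : R[i] := limn (series u).

Definition csummable u : Prop := cvgn (series (fun n => normc (u n))).

Lemma csummable_le u v : (forall n, normc (u n) <= v n) -> cvgn (series v) ->
  csummable u.
Proof.
move=> uv; apply: series_le_cvg => // n; first exact: normc_ge0.
exact: le_trans (normc_ge0 _) (uv n).
Qed.

Lemma climP {T : Type} (F : set_system T) {FF : Filter F}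
    (f : T -> R[i]) a : f @ F --> a <-> clim F f a.
Proof. exact: cvgcP. Qed.

Lemma eq_clim {T : Type} (F : set_system T) (g f : T -> R[i]) a :
  g =1 f -> clim F f a -> clim F g a.
Proof. by move=> /funext ->. Qed.

Lemma near_clim {T : Type} (F : set_system T) {FF : Filter F}
    (g f : T -> R[i]) a :
  (\forall t \near F, f t = g t) -> clim F f a -> clim F g a.
Proof.
by move=> fg fa e e0; near=> t; rewrite -(near fg t)//; near: t; exact: fa.
Unshelve. all: by end_near. Qed.

Lemma clim_unique {T : Type} (F : set_system T) {FF : ProperFilter F}
    (f : T -> R[i]) a b : clim F f a -> clim F f b -> a = b.
Proof.
move=> fa fb; apply/eqP; rewrite -subr_eq0 -normc_eq0 eq_le normc_ge0 andbT.
apply/ler_addgt0Pr => e e0; rewrite add0r.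
have e20 : 0 < e / 2 by rewrite divr_gt0.
have [t [t1 t2]] := filter_ex (filterI (fa _ e20) (fb _ e20)).
rewrite (le_trans (le_normc_distD (f t) _ _))// [e]splitr lerD// ltW//.
by rewrite normc_distC.
Qed.

Lemma clim_cst {T : Type} (F : set_system T) {FF : Filter F} a :
  clim F (fun=> a) a.
Proof. by move=> e e0; near=> t; rewrite subrr normc0.
Unshelve. all: by end_near. Qed.

Lemma climD {T : Type} (F : set_system T) {FF : Filter F} (f g : T -> R[i]) a b :
  clim F f a -> clim F g b -> clim F (fun t => f t + g t) (a + b).
Proof.
move=> fa gb e e0; have e20 : 0 < e / 2 by rewrite divr_gt0.
near=> t; rewrite opprD addrACA (le_lt_trans (le_normcD _ _))// [e]splitr ltrD//.
  by near: t; exact: fa.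
by near: t; exact: gb.
Unshelve. all: by end_near. Qed.

Lemma clim_bounded {T : Type} (F : set_system T) {FF : Filter F}
    (f : T -> R[i]) a : clim F f a ->
  \forall t \near F, normc (f t) <= normc a + 1.
Proof.
move=> fa; near=> t; have : normc (f t - a) < 1 by near: t; exact: fa.
by move=> h; have := le_normcD (f t - a) a; rewrite subrK; lra.
Unshelve. all: by end_near. Qed.

Lemma climM {T : Type} (F : set_system T) {FF : Filter F} (f g : T -> R[i]) a b :
  clim F f a -> clim F g b -> clim F (fun t => f t * g t) (a * b).
Proof.
move=> fa gb e e0; set A := normc b + 1; set B := normc a + 1.
have A0 : 0 < A by rewrite ltr_wpDl ?normc_ge0.
have B0 : 0 < B by rewrite ltr_wpDl ?normc_ge0.
have eA : 0 < e / 2 / A by rewrite !divr_gt0.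
have eB : 0 < e / 2 / B by rewrite !divr_gt0.
have gA : \forall t \near F, normc (g t) <= A by exact: clim_bounded.
near=> t.
have -> : f t * g t - a * b = (f t - a) * g t + a * (g t - b) by ring.
rewrite (le_lt_trans (le_normcD _ _))// [e]splitr ltr_leD// normcM.
  rewrite (@le_lt_trans _ _ (normc (f t - a) * A))//.
    by rewrite ler_wpM2l ?normc_ge0//; near: t.
  by rewrite -ltr_pdivlMr//; near: t; exact: fa.
rewrite (@le_trans _ _ (B * normc (g t - b)))//.
  by rewrite ler_wpM2r ?normc_ge0// lerDl.
by rewrite mulrC -ler_pdivlMr// ltW//; near: t; exact: gb.
Unshelve. all: by end_near. Qed.

Lemma climZ {T : Type} (F : set_system T) {FF : Filter F} c (f : T -> R[i]) a :
  clim F f a -> clim F (fun t => c * f t) (c * a).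
Proof. by move=> fa; apply: climM => //; exact: clim_cst. Qed.

Lemma climB {T : Type} (F : set_system T) {FF : Filter F} (f g : T -> R[i]) a b :
  clim F f a -> clim F g b -> clim F (fun t => f t - g t) (a - b).
Proof.
move=> fa gb; rewrite -mulN1r; apply: (@eq_clim _ _ _ (fun t => f t + -1 * g t)).
  by move=> t; rewrite mulN1r.
by apply: climD => //; exact: climZ.
Qed.

Lemma climV {T : Type} (F : set_system T) {FF : Filter F} (f : T -> R[i]) a :
  a != 0 -> clim F f a -> clim F (fun t => (f t)^-1) a^-1.
Proof.
move=> a0 fa e e0; have na0 : 0 < normc a by rewrite normc_gt0.
have h20 : 0 < normc a / 2 by rewrite divr_gt0.
have h30 : 0 < e * (normc a / 2) * normc a by rewrite !mulr_gt0.
near=> t.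
have h1 : normc (f t - a) < normc a / 2 by near: t; exact: fa.
have h2 : normc a / 2 < normc (f t).
  have := lerB_normc a (a - f t); rewrite subKr normc_distC; lra.
have h2' : 0 < normc (f t) by exact: lt_trans h2.
have ft0 : f t != 0 by rewrite -normc_gt0.
have -> : (f t)^-1 - a^-1 = (a - f t) / (f t * a).
  by field; rewrite ft0 a0.
rewrite normcM normcV normcM ltr_pdivrMr; last by rewrite mulr_gt0.
rewrite normc_distC mulrA (@lt_le_trans _ _ (e * (normc a / 2) * normc a))//.
  by near: t; exact: fa.
by rewrite ler_pM2r// ler_pM2l// ltW.
Unshelve. all: by end_near. Qed.

Lemma clim_sum {T : Type} (F : set_system T) {FF : Filter F} (I : Type)
    (r : seq I) (f : I -> T -> R[i]) (l : I -> R[i]) :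
  (forall i, clim F (f i) (l i)) ->
  clim F (fun t => \sum_(i <- r) f i t) (\sum_(i <- r) l i).
Proof.
move=> fl; elim: r => [|i r IH].
  rewrite big_nil; apply: eq_clim (clim_cst _) => t; exact: big_nil.
rewrite big_cons; apply: (@eq_clim _ _ _ (fun t => f i t + \sum_(j <- r) f j t)).
  by move=> t; rewrite big_cons.
exact: climD.
Qed.

Lemma clim_le {T : Type} (F : set_system T) {FF : ProperFilter F}
    (f : T -> R[i]) l (B : R) :
  clim F f l -> (\forall t \near F, normc (f t) <= B) -> normc l <= B.
Proof.
move=> fl fB; apply/ler_addgt0Pr => e e0.
have [t [t1 t2]] := filter_ex (filterI (fl e e0) fB).
have := le_normcB (f t) (f t - l); rewrite subKr => /le_trans; apply.
by rewrite lerD// ltW.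
Qed.

Lemma csummable_cvg u : csummable u -> clim \oo (series u) (csum u).
Proof.
move=> su.
apply/climP; suff : cvgn (series u) by [].
have key (p : R[i] -> R) : (forall z, `|p z| <= normc z) ->
    cvgn (series (fun n => p (u n))).
  move=> pz; apply: normed_cvg; apply: series_le_cvg su => // n.
  - exact: normr_ge0.
  - exact: normc_ge0.
  - exact: pz.
have h : series u @ \oo --> (limn (series (fun n => Re (u n))) +i*
                      limn (series (fun n => Im (u n)))); last first.
  exact: cvgP h.
apply/cvg_complexP; split => /=.
  rewrite (_ : (fun _ => _) = series (fun n => Re (u n))).
    by apply: key => z; exact: normr_Re.
  by apply/funext => n; rewrite /series /= Re_sum.
rewrite (_ : (fun _ => _) = series (fun n => Im (u n))).
  by apply: key => z; exact: normr_Im.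
by apply/funext => n; rewrite /series /= Im_sum.
Qed.

Lemma csumP u l : clim \oo (series u) l -> csum u = l.
Proof. by move=> /climP ul; apply: cvg_lim ul; exact: norm_hausdorff. Qed.

Lemma eq_csum u1 u2 : u1 =1 u2 -> csum u1 = csum u2.
Proof. by move/funext => ->. Qed.

Lemma csummableD u1 u2 : csummable u1 -> csummable u2 ->
  csummable (fun n => u1 n + u2 n).
Proof.
move=> s1 s2.
apply: (@csummable_le _ (fun n => normc (u1 n) + normc (u2 n))) => [n|].
  exact: le_normcD.
have := is_cvg_seriesD s1 s2; congr (cvgn (series _)).
Qed.

Lemma csummableZ c u : csummable u -> csummable (fun n => c * u n).
Proof.
move=> su; have := @is_cvg_seriesZ _ _ (normc c) su; rewrite (_ : _ *: _ = (fun n => normc (c * u n)))//.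
by apply/funext => n /=; rewrite normcM.
Qed.

Lemma csumD u1 u2 : csummable u1 -> csummable u2 ->
  csum (fun n => u1 n + u2 n) = csum u1 + csum u2.
Proof.
move=> /csummable_cvg s1 /csummable_cvg s2; apply: csumP.
apply: eq_clim (climD s1 s2) => n; exact: big_split.
Qed.

Lemma csumZ c u : csummable u -> csum (fun n => c * u n) = c * csum u.
Proof.
move=> /csummable_cvg su; apply: csumP.
apply: eq_clim (climZ c su) => n.
by rewrite /series /= mulr_sumr.
Qed.

Lemma csumB u1 u2 : csummable u1 -> csummable u2 ->
  csum (fun n => u1 n - u2 n) = csum u1 - csum u2.
Proof.
move=> s1 s2; rewrite -[in RHS]mulN1r -csumZ// -csumD//; last exact: csummableZ.
by apply: eq_csum => n; rewrite mulN1r.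
Qed.

Lemma csummable_sum (I : Type) (r : seq I) (U : I -> nat -> R[i]) :
  (forall i, csummable (U i)) -> csummable (fun n => \sum_(i <- r) U i n).
Proof.
move=> sU; elim: r => [|i r IH].
  apply: (@csummable_le _ (fun=> 0)) => [n|]; first by rewrite big_nil normc0.
  rewrite (_ : series _ = fun=> 0); first exact: is_cvg_cst.
  by apply/funext => n; rewrite /series /= big1.
have := csummableD (sU i) IH; congr csummable.
by apply/funext => n; rewrite big_cons.
Qed.

Lemma csum_sum (I : Type) (r : seq I) (U : I -> nat -> R[i]) :
  (forall i, csummable (U i)) ->
  csum (fun n => \sum_(i <- r) U i n) = \sum_(i <- r) csum (U i).
Proof.
move=> sU; elim: r => [|i r IH].
  rewrite big_nil; apply: csumP; apply: eq_clim (clim_cst _) => n.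
  by rewrite /series /= big1// => k _; rewrite big_nil.
rewrite big_cons -IH -csumD//; last exact: csummable_sum.
by apply: eq_csum => n; rewrite big_cons.
Qed.

Lemma csummableS u : csummable u -> csummable (fun n => u n.+1).
Proof.
move=> su; rewrite /csummable.
rewrite (_ : series _ = (fun n => series (fun n => normc (u n)) n.+1
   - normc (u 0%N))); last first.
  by apply/funext => n; rewrite /series /= big_nat_recl// [X in X - _]addrC addrK.
apply: is_cvgB; last exact: is_cvg_cst.
move/cvg_ex: su => [l sl]; apply/cvg_ex; exists l.
by have := sl; rewrite -cvg_shiftS.
Qed.

Lemma csumS u : csummable u -> csum u = u 0%N + csum (fun n => u n.+1).
Proof.
move=> su; have /csummable_cvg s1 := csummableS su.
apply: (@clim_unique _ \oo _ (fun n => series u n.+1)).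
  by move=> e /(csummable_cvg su) [n _ hn]; exists n => // k /= nk;
    apply: hn; exact: leqW.
apply: eq_clim (climD (clim_cst (u 0%N)) s1) => n.
by rewrite /series /= big_nat_recl.
Qed.

Lemma csum_tail u v n : (forall k, normc (u k) <= v k) -> cvgn (series v) ->
  normc (csum u - series u n) <= limn (series v) - series v n.
Proof.
move=> uv sv; have /csummable_cvg su := csummable_le uv sv.
have v0 k : 0 <= v k by exact: le_trans (normc_ge0 _) (uv k).
apply: (@clim_le _ \oo _ (fun k => series u k - series u n)).
  by apply: climB => //; exact: clim_cst.
exists n => // k /= nk; rewrite sub_series_geq//.
rewrite (le_trans (normc_sum _ _ _))//.
apply: (@le_trans _ _ (series v k - series v n)).
  by rewrite sub_series_geq// ler_sum.
rewrite lerD2r; apply: nondecreasing_cvgn_le => //.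
by apply/nondecreasing_seqP => j; rewrite /series /= big_nat_recr//= lerDl.
Qed.

(** Tannery's theorem: dominated convergence for series. *)
Lemma csum_dominated {T : Type} (F : set_system T) {FF : ProperFilter F}
    (U : T -> nat -> R[i]) u v :
  (\forall t \near F, forall k, normc (U t k) <= v k) -> cvgn (series v) ->
  (forall k, clim F (U ^~ k) (u k)) ->
  clim F (fun t => csum (U t)) (csum u).
Proof.
move=> Uv sv Uu.
have uv k : normc (u k) <= v k.
  by apply: clim_le (Uu k) _; apply: filterS Uv => t; apply.
move=> e e0; have e30 : 0 < e / 3%:R by rewrite divr_gt0.
have [n hn] : exists n, limn (series v) - series v n < e / 3%:R.
  have /cvgrPdist_lt/(_ _ e30) : series v @ \oo --> limn (series v) by [].
  move=> [n _ /(_ n)] /(_ (leqnn n)) h; exists n.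
  exact: le_lt_trans (ler_norm _) h.
have /(_ _ e30) h1 : clim F (fun t => series (U t) n) (series u n).
  exact: clim_sum.
near=> t.
(* the two tails are bounded by that of v, uniformly in t *)
have -> : csum (U t) - csum u = (csum (U t) - series (U t) n)
  + (series (U t) n - series u n) - (csum u - series u n) by ring.
have -> : e = e / 3%:R + e / 3%:R + e / 3%:R by field.
rewrite (le_lt_trans (le_normcB _ _))// ltr_leD//; last first.
  exact: le_trans (csum_tail _ uv sv) (ltW hn).
rewrite (le_lt_trans (le_normcD _ _))// ler_ltD//; last by near: t.
apply: le_trans (ltW hn); apply: csum_tail => //.
by near: t.
Unshelve. all: by end_near. Qed.

End AbsoluteSeries.

#[global] Arguments normc : simpl never.

(** * Integrals along the sides of a rectangle *)
Section RealIntegral.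
Variable R : realType.
Implicit Types (a b x : R) (f g : R -> R).

Definition rint a b f : R := \int[lebesgue_measure]_(t in `[a, b]) f t.

Definition rcont a b f := {in `[a, b], continuous f}.

Lemma rcont_integrable a b f : rcont a b f ->
  lebesgue_measure.-integrable `[a, b] (EFin \o f).
Proof.
move=> cf; apply: continuous_compact_integrable; first exact: segment_compact.
by apply: continuous_in_subspaceT => x; rewrite inE; exact: cf.
Qed.

Lemma eq_rint a b f g : {in `[a, b], f =1 g} -> rint a b f = rint a b g.
Proof.
by move=> fg; apply: eq_Rintegral => x; rewrite inE => xab; exact: fg.
Qed.

Lemma rintD a b f g : rcont a b f -> rcont a b g ->
  rint a b (fun t => f t + g t) = rint a b f + rint a b g.
Proof. by move=> cf cg; apply: RintegralD => //; exact: rcont_integrable. Qed.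

Lemma rintB a b f g : rcont a b f -> rcont a b g ->
  rint a b (fun t => f t - g t) = rint a b f - rint a b g.
Proof. by move=> cf cg; apply: RintegralB => //; exact: rcont_integrable. Qed.

Lemma rintZ a b k f : rcont a b f -> rint a b (fun t => k * f t) = k * rint a b f.
Proof. by move=> cf; apply: RintegralZl => //; exact: rcont_integrable. Qed.

Lemma rint_cst a b k : a <= b -> rint a b (fun=> k) = k * (b - a).
Proof.
move=> ab; rewrite /rint Rintegral_cst//; congr (k * _).
have := @lebesgue_measure_itv R `[a, b]; rewrite /= => mE.
transitivity (fine (if (a%:E < b%:E)%E then (b%:E - a%:E)%E else 0%E)).
  by congr fine; exact: mE.
case: ifPn => //; rewrite lte_fin -leNgt => ba.
by rewrite (le_anti (introT andP (conj ab ba))) subrr.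
Qed.

Lemma rint_split a b x f : a <= x -> x <= b -> rcont a b f ->
  rint a b f = rint a x f + rint x b f.
Proof.
move=> ax xb cf; have iab := rcont_integrable cf.
have := @Rintegral_itvB R f (BLeft a) (BRight b) x iab.
rewrite !bnd_simp => /(_ ax xb) h.
rewrite /rint -(@Rintegral_itv_obnd_cbnd _ x).
  by rewrite -h addrC subrK.
apply: integrableS iab => //.
by move=> t /=; rewrite !in_itv /= => /andP[xt ->]; rewrite (le_trans ax (ltW xt)).
Qed.

Lemma rint_le a b f (M : R) : a <= b -> rcont a b f ->
  (forall t, t \in `[a, b] -> `|f t| <= M) -> `|rint a b f| <= M * (b - a).
Proof.
move=> ab cf fM; have iab := rcont_integrable cf.
rewrite (le_trans (le_normr_Rintegral _ iab))// -(rint_cst M ab).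
apply: le_Rintegral => //.
- by apply: rcont_integrable => x /cf fx; apply: continuous_comp (fx) _; exact: norm_continuous.
- by apply: rcont_integrable => x _; exact: cst_continuous.
Qed.

Lemma rint_gt0 a b f : a < b -> rcont a b f ->
  (forall t, t \in `[a, b] -> 0 < f t) -> 0 < rint a b f.
Proof.
move=> ab cf f0.
have [|c cab fc] := @EVT_min R f a b (ltW ab).
  by apply: continuous_in_subspaceT => x; rewrite inE; exact: cf.
apply: (@lt_le_trans _ _ (f c * (b - a))); first by rewrite mulr_gt0 ?f0 ?subr_gt0.
rewrite -(rint_cst _ (ltW ab)); apply: le_Rintegral => //.
- by apply: rcont_integrable => x _; exact: cst_continuous.
- exact: rcont_integrable.
Qed.

End RealIntegral.

Section ComplexIntegral.
Variable R : realType.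
Implicit Types (a b x c d : R) (p q : R -> R[i]) (h F G : R[i] -> R[i]) (z w k : R[i]).

Lemma complex_ext z w : Re z = Re w ->
  Im z = Im w -> z = w.
Proof. by case: z w => ? ? [? ?] /= -> ->. Qed.

Definition cint a b p : R[i] :=
  rint a b (fun t => Re (p t)) +i* rint a b (fun t => Im (p t)).

Definition ccont a b p := forall t, t \in `[a, b] -> clim (nbhs t) p (p t).

Lemma ccont_Re a b p : ccont a b p -> rcont a b (fun t => Re (p t)).
Proof. by move=> cp t /cp/climP/cvg_complexP[]. Qed.

Lemma ccont_Im a b p : ccont a b p -> rcont a b (fun t => Im (p t)).
Proof. by move=> cp t /cp/climP/cvg_complexP[]. Qed.

Lemma eq_cint a b p q : {in `[a, b], p =1 q} -> cint a b p = cint a b q.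
Proof. by move=> pq; congr Complex; apply: eq_rint => t /pq ->. Qed.

Lemma cintD a b p q : ccont a b p -> ccont a b q ->
  cint a b (fun t => p t + q t) = cint a b p + cint a b q.
Proof.
move=> cp cq; rewrite /cint; simpc; congr Complex.
  rewrite -rintD; [|exact: ccont_Re|exact: ccont_Re].
  by apply: eq_rint => t _; rewrite ReD.
rewrite -rintD; [|exact: ccont_Im|exact: ccont_Im].
by apply: eq_rint => t _; rewrite ImD.
Qed.

Lemma ccontZ a b k p : ccont a b p -> ccont a b (fun t => k * p t).
Proof. by move=> cp t /cp; exact: climZ. Qed.

Lemma rcontZ a b (k : R) (f : R -> R) : rcont a b f -> rcont a b (fun t => k * f t).
Proof. by move=> cf t /cf ft; apply: continuousM => //; exact: cst_continuous. Qed.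

Lemma cintZ a b k p : ccont a b p -> cint a b (fun t => k * p t) = k * cint a b p.
Proof.
move=> cp; have cr := ccont_Re cp; have ci := ccont_Im cp.
case: k => k1 k2; rewrite /cint; simpc; congr Complex.
  rewrite -!rintZ// -rintB; [|exact: rcontZ|exact: rcontZ].
  by apply: eq_rint => t _; case: (p t).
rewrite -!rintZ// -rintD; [|exact: rcontZ|exact: rcontZ].
by apply: eq_rint => t _; case: (p t).
Qed.

Lemma cint_cst a b k : a <= b -> cint a b (fun=> k) = k * (b - a)%:C.
Proof.
by move=> ab; rewrite /cint !rint_cst//; case: k => k1 k2; simpc.
Qed.

Lemma cint_split a b x p : a <= x -> x <= b -> ccont a b p ->
  cint a b p = cint a x p + cint x b p.
Proof.
move=> ax xb cp; rewrite /cint; simpc.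
by congr Complex; apply: rint_split => //; [exact: ccont_Re|exact: ccont_Im].
Qed.

(** The factor 2 comes from bounding the real and imaginary parts separately. *)
Lemma cint_le a b p (M : R) : a <= b -> ccont a b p ->
  (forall t, t \in `[a, b] -> normc (p t) <= M) ->
  normc (cint a b p) <= 2 * M * (b - a).
Proof.
move=> ab cp pM; rewrite (le_trans (normc_le_ReIm _))//= -mulrA mulr2n mulrDl mul1r.
rewrite lerD//; apply: rint_le => //; [exact: ccont_Re| |exact: ccont_Im|].
  by move=> t /pM; apply: le_trans; exact: normr_Re.
by move=> t /pM; apply: le_trans; exact: normr_Im.
Qed.

Definition cnear h z := clim (nbhs z) h (h z).

Lemma cder_cont F z l : cder_at F z l -> cnear F z.
Proof.
move=> Fl e e0; have [d d0 hd] := Fl 1 ltr01.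
set A := 1 + normc l; have A0 : 0 < A by rewrite ltr_pwDl ?normc_ge0.
apply/nbhscP; exists (Num.min d (e / A)) => [|w].
  by rewrite lt_min d0 divr_gt0.
rewrite lt_min => /andP[/hd wd we].
have := le_normcD (F w - F z - l * (w - z)) (l * (w - z)); rewrite subrK.
move/le_lt_trans; apply; rewrite normcM.
rewrite (@le_lt_trans _ _ (A * normc (w - z)))//.
  by rewrite mulrDl lerD2r.
by rewrite mulrC -ltr_pdivlMr.
Qed.

Lemma cnear_hline h t c : cnear h (t +i* c) ->
  clim (nbhs t) (fun x => h (x +i* c)) (h (t +i* c)).
Proof.
move=> ch e /ch/nbhscP[d d0 hd]; apply/nbhs_normP; exists d => // x.
rewrite /ball_ /= => xd; apply: hd.
rewrite (_ : _ - _ = (x - t)%:C) ?normcR 1?distrC//.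
by apply: complex_ext => /=; ring.
Qed.

Lemma cnear_vline h t c : cnear h (c +i* t) ->
  clim (nbhs t) (fun x => h (c +i* x)) (h (c +i* t)).
Proof.
move=> ch e /ch/nbhscP[d d0 hd]; apply/nbhs_normP; exists d => // x.
rewrite /ball_ /= => xd; apply: hd.
rewrite (_ : _ - _ = 'i * (x - t)%:C) ?normcM ?normci ?normcR ?mul1r 1?distrC//.
by apply: complex_ext => /=; ring.
Qed.

(** The integral of [h] along the boundary of the rectangle
    with corners a + i c and b + i d. *)
Definition bint h a b c d : R[i] :=
  cint a b (fun t => h (t +i* c)) - cint a b (fun t => h (t +i* d)) +
  'i * (cint c d (fun t => h (b +i* t)) - cint c d (fun t => h (a +i* t))).

Definition inrect a b c d z :=
  (Re z \in `[a, b]) && (Im z \in `[c, d]).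

Definition on_bd a b c d z :=
  inrect a b c d z &&
  [|| Re z == a, Re z == b, Im z == c | Im z == d].

Definition cbd h a b c d := forall z, on_bd a b c d z -> cnear h z.

Lemma on_bd_h a b c d t : a <= b -> c <= d -> t \in `[a, b] ->
  on_bd a b c d (t +i* c) && on_bd a b c d (t +i* d).
Proof.
by move=> ab cd tab; rewrite /on_bd /inrect /= tab !eqxx !in_itv /= !lexx cd !orbT.
Qed.

Lemma on_bd_v a b c d t : a <= b -> c <= d -> t \in `[c, d] ->
  on_bd a b c d (a +i* t) && on_bd a b c d (b +i* t).
Proof.
by move=> ab cd tab; rewrite /on_bd /inrect /= tab !eqxx !in_itv /= !lexx ab !orbT.
Qed.

Lemma cbd_edges h a b c d : a <= b -> c <= d -> cbd h a b c d ->
  [/\ ccont a b (fun t => h (t +i* c)), ccont a b (fun t => h (t +i* d)),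
      ccont c d (fun t => h (b +i* t)) & ccont c d (fun t => h (a +i* t))].
Proof.
move=> ab cd hc; split=> t tab.
- by apply: cnear_hline; apply: hc; have /andP[] := on_bd_h ab cd tab.
- by apply: cnear_hline; apply: hc; have /andP[] := on_bd_h ab cd tab.
- by apply: cnear_vline; apply: hc; have /andP[] := on_bd_v ab cd tab.
- by apply: cnear_vline; apply: hc; have /andP[] := on_bd_v ab cd tab.
Qed.

Lemma eq_bint h F a b c d : a <= b -> c <= d ->
  (forall z, on_bd a b c d z -> h z = F z) -> bint h a b c d = bint F a b c d.
Proof.
move=> ab cd hF; rewrite /bint; congr (_ - _ + 'i * (_ - _)); apply: eq_cint => t tab;
  apply: hF; first [by have /andP[] := on_bd_h ab cd tab | by have /andP[] := on_bd_v ab cd tab].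
Qed.

Lemma bintD h F a b c d : a <= b -> c <= d -> cbd h a b c d -> cbd F a b c d ->
  bint (fun z => h z + F z) a b c d = bint h a b c d + bint F a b c d.
Proof.
move=> ab cd /(cbd_edges ab cd)[h1 h2 h3 h4] /(cbd_edges ab cd)[F1 F2 F3 F4].
by rewrite /bint !cintD//; ring.
Qed.

Lemma bintZ k h a b c d : a <= b -> c <= d -> cbd h a b c d ->
  bint (fun z => k * h z) a b c d = k * bint h a b c d.
Proof.
by move=> ab cd /(cbd_edges ab cd)[h1 h2 h3 h4]; rewrite /bint !cintZ//; ring.
Qed.

Lemma bint_le h a b c d (M : R) : a <= b -> c <= d -> cbd h a b c d ->
  (forall z, on_bd a b c d z -> normc (h z) <= M) ->
  normc (bint h a b c d) <= 4%:R * M * ((b - a) + (d - c)).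
Proof.
move=> ab cd /(cbd_edges ab cd)[h1 h2 h3 h4] hM.
have hb t : t \in `[a, b] -> normc (h (t +i* c)) <= M /\ normc (h (t +i* d)) <= M.
  by move=> tab; have /andP[] := on_bd_h ab cd tab => /hM ? /hM.
have vb t : t \in `[c, d] -> normc (h (a +i* t)) <= M /\ normc (h (b +i* t)) <= M.
  by move=> tab; have /andP[] := on_bd_v ab cd tab => /hM ? /hM.
have e1 := cint_le ab h1 (fun t tab => (hb t tab).1).
have e2 := cint_le ab h2 (fun t tab => (hb t tab).2).
have e3 := cint_le cd h3 (fun t tab => (vb t tab).2).
have e4 := cint_le cd h4 (fun t tab => (vb t tab).1).
rewrite /bint (le_trans (le_normcD _ _))// normcM normci mul1r.
have := le_normcB (cint a b (fun t => h (t +i* c))) (cint a b (fun t => h (t +i* d))).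
have := le_normcB (cint c d (fun t => h (b +i* t))) (cint c d (fun t => h (a +i* t))).
move: e1 e2 e3 e4; set A := normc _; set B := normc _; set C := normc _; set D := normc _.
lra.
Qed.

Lemma bint_splitv h a b x c d : a <= x -> x <= b -> c <= d ->
  cbd h a b c d ->
  bint h a b c d = bint h a x c d + bint h x b c d.
Proof.
move=> ax xb cd /(cbd_edges (le_trans ax xb) cd)[h1 h2 h3 h4].
by rewrite /bint (cint_split ax xb h1) (cint_split ax xb h2); ring.
Qed.

Lemma bint_splith h a b c d y : a <= b -> c <= y -> y <= d ->
  cbd h a b c d ->
  bint h a b c d = bint h a b c y + bint h a b y d.
Proof.
move=> ab cy yd /(cbd_edges ab (le_trans cy yd))[h1 h2 h3 h4].
by rewrite /bint (cint_split cy yd h3) (cint_split cy yd h4); ring.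
Qed.

Lemma bint_cst k a b c d : a <= b -> c <= d -> bint (fun=> k) a b c d = 0.
Proof. by move=> ab cd; rewrite /bint !subrr mulr0 addr0. Qed.

Lemma cnear_id z : cnear id z.
Proof. by move=> e e0; apply/nbhscP; exists e. Qed.

Lemma bint_id a b c d : a <= b -> c <= d -> bint id a b c d = 0.
Proof.
move=> ab cd; have cid : cbd id a b c d by move=> z _; exact: cnear_id.
have [h1 h2 h3 h4] := cbd_edges ab cd cid.
have -> : bint id a b c d = cint a b (fun t => (t +i* c) + -1 * (t +i* d))
    + 'i * cint c d (fun t => (b +i* t) + -1 * (a +i* t)).
  rewrite /bint !cintD ?cintZ//; [by ring|exact: ccontZ|exact: ccontZ].
rewrite (@eq_cint _ _ _ (fun=> 'i * (c - d)%:C)); last first.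
  by move=> t _; apply: complex_ext => /=; ring.
rewrite (@eq_cint c d _ (fun=> (b - a)%:C)); last first.
  by move=> t _; apply: complex_ext => /=; ring.
by rewrite !cint_cst// -[c - d]opprB (rmorphN (real_complex R)); ring.
Qed.

End ComplexIntegral.

#[global] Arguments cint : simpl never.
#[global] Arguments bint : simpl never.

(** * Goursat's theorem *)
Section Goursat.
Variable R : realType.
Implicit Types (a b x y c d : R) (h F G : R[i] -> R[i]) (z w k : R[i]).

Lemma nested_intervals (a b : nat -> R) : {homo a : n m / (n <= m)%N >-> n <= m} ->
  {homo b : n m / (n <= m)%N >-> m <= n} -> (forall n, a n <= b n) ->
  exists x, forall n, a n <= x <= b n.
Proof.
move=> ai bd ab; exists (sup (range a)) => n.
have anb (i j : nat) : a i <= b j.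
  apply: (@le_trans _ _ (a (maxn i j))); first by rewrite ai// leq_maxl.
  by rewrite (le_trans (ab _))// bd// leq_maxr.
apply/andP; split.
  apply: ub_le_sup; last by exists n.
  by exists (b n) => _ [i _ <-].
by apply: ge_sup; [exists (a 0%N); exists 0%N|move=> _ [i _ <-]].
Qed.

Definition rect := (R * R * R * R)%type.

Definition bintr h (q : rect) := let: (a, b, c, d) := q in bint h a b c d.

Definition wf_rect (q : rect) := let: (a, b, c, d) := q in (a <= b) && (c <= d).

Definition quarter (q q' : rect) :=
  let: (a, b, c, d) := q in let: (a', b', c', d') := q' in
  [/\ a <= a', a' <= b', b' <= b & b' - a' = (b - a) / 2] /\
  [/\ c <= c', c' <= d', d' <= d & d' - c' = (d - c) / 2].

Definition ctrect h (q : rect) :=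
  let: (a, b, c, d) := q in forall z, inrect a b c d z -> cnear h z.

Lemma ctrect_bd h a b c d : ctrect h (a, b, c, d) -> cbd h a b c d.
Proof. by move=> ch z /andP[/ch]. Qed.

Lemma ctrect_sub h a b c d a' b' c' d' :
  a <= a' -> b' <= b -> c <= c' -> d' <= d ->
  ctrect h (a, b, c, d) -> ctrect h (a', b', c', d').
Proof.
move=> aa bb cc dd ch z; rewrite /inrect !in_itv /= => /andP[/andP[h1 h2] /andP[h3 h4]].
by apply: ch; rewrite /inrect !in_itv /= (le_trans aa) ?(le_trans h2) ?(le_trans cc) ?(le_trans h4).
Qed.

Lemma midpoint a b : a <= b -> exists x,
  [/\ a <= x, x <= b, x - a = (b - a) / 2 & b - x = (b - a) / 2].
Proof. by move=> ab; exists ((a + b) / 2); split; lra. Qed.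

(** The four quarters of a rectangle add up to it, so one of them carries at
    least a quarter of the boundary integral. *)
Lemma exists_quarter h q : wf_rect q -> ctrect h q -> exists q',
  quarter q q' /\ normc (bintr h q) <= 4%:R * normc (bintr h q').
Proof.
case: q => [[[a b] c] d] /andP[ab cd] ch.
have [x [ax xb xa bx]] := midpoint ab; have [y [cy yd yc dy]] := midpoint cd.
have e1 : bint h a b c d = bint h a x c d + bint h x b c d.
  by apply: bint_splitv => //; exact: ctrect_bd.
have e2 : bint h a x c d = bint h a x c y + bint h a x y d.
  by apply: bint_splith => //; apply: ctrect_bd; exact: ctrect_sub ch.
have e3 : bint h x b c d = bint h x b c y + bint h x b y d.
  by apply: bint_splith => //; apply: ctrect_bd; exact: ctrect_sub ch.
rewrite /bintr; rewrite e1 e2 e3.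
have := le_normcD (bint h a x c y + bint h a x y d) (bint h x b c y + bint h x b y d).
have := le_normcD (bint h a x c y) (bint h a x y d).
have := le_normcD (bint h x b c y) (bint h x b y d).
set B1 := bint h a x c y; set B2 := bint h a x y d.
set B3 := bint h x b c y; set B4 := bint h x b y d.
set N := normc (B1 + B2 + (B3 + B4)) => n1 n2 n3.
have [h1|h1] := leP N (4%:R * normc B1).
  by exists (a, x, c, y); split.
have [h2|h2] := leP N (4%:R * normc B2).
  by exists (a, x, y, d); split.
have [h3|h3] := leP N (4%:R * normc B3).
  by exists (x, b, c, y); split.
exists (x, b, y, d); split=> //=.
move: n1 n2 n3 h1 h2 h3; clear; rewrite -/B4; lra.
Qed.

(** Goursat: bisection produces nested rectangles Q_n with |I(Q)| <= 4^n |I(Q_n)|,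
    whereas differentiability at the common point makes |I(Q_n)| = o(4^-n). *)
Lemma goursat h a b c d : a <= b -> c <= d ->
  (forall z, inrect a b c d z -> exists l, cder_at h z l) ->
  bint h a b c d = 0.
Proof.
move=> ab cd hd.
have ch : ctrect h (a, b, c, d) by move=> z /hd[l]; exact: cder_cont.
have /choice[st stP] : forall q, exists q', wf_rect q -> ctrect h q ->
    quarter q q' /\ normc (bintr h q) <= 4%:R * normc (bintr h q').
  move=> q.
  have [wq|wq] := boolP (wf_rect q); last by exists q.
  have [cq|cq] := pselect (ctrect h q); last by exists q.
  by have [q' ?] := exists_quarter wq cq; exists q'.
pose Q n := iter n st (a, b, c, d).
pose qa n := (Q n).1.1.1; pose qb n := (Q n).1.1.2.
pose qc n := (Q n).1.2; pose qd n := (Q n).2.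
have QE n : Q n = (qa n, qb n, qc n, qd n).
  by rewrite /qa /qb /qc /qd; case: (Q n) => [[[? ?] ?] ?].
have wc n : wf_rect (Q n) /\ ctrect h (Q n).
  elim: n => [|n [wn cn]]; first by rewrite /Q /= ab cd.
  have [hq _] := stP _ wn cn; rewrite (_ : st (Q n) = Q n.+1) // in hq.
  move: hq; rewrite !QE => -[[? ? ? ?] [? ? ? ?]]; split.
    by rewrite /wf_rect; apply/andP.
  by move: cn; rewrite QE; exact: ctrect_sub.
have step n : quarter (Q n) (Q n.+1) /\
    normc (bintr h (Q n)) <= 4%:R * normc (bintr h (Q n.+1)).
  by have [wn cn] := wc n; exact: stP.
have qstep n : [/\ qa n <= qa n.+1, qb n.+1 <= qb n & qb n.+1 - qa n.+1 = (qb n - qa n) / 2]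
    /\ [/\ qc n <= qc n.+1, qd n.+1 <= qd n & qd n.+1 - qc n.+1 = (qd n - qc n) / 2].
  by have [] := step n; rewrite !QE => -[[? ? ? ?] [? ? ? ?]].
have qle n : qa n <= qb n /\ qc n <= qd n.
  by have [] := wc n; rewrite QE => /andP[].
have [x xP] : exists x, forall n, qa n <= x <= qb n.
  apply: nested_intervals => [||n]; last by have [] := qle n.
    by apply/nondecreasing_seqP => n; have [[]] := qstep n.
  by apply/nonincreasing_seqP => n; have [[]] := qstep n.
have [y yP] : exists y, forall n, qc n <= y <= qd n.
  apply: nested_intervals => [||n]; last by have [] := qle n.
    by apply/nondecreasing_seqP => n; have [_ []] := qstep n.
  by apply/nonincreasing_seqP => n; have [_ []] := qstep n.
pose D := (b - a) + (d - c).
have D0 : 0 <= D by rewrite /D; lra.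
have DE n : (qb n - qa n) + (qd n - qc n) = D / 2 ^+ n.
  elim: n => [|n IH]; first by rewrite expr0 divr1.
  have [[_ _ ->] [_ _ ->]] := qstep n.
  by rewrite -mulrDl IH exprSr invfM mulrA.
have IE n : normc (bint h a b c d) <= 4%:R ^+ n * normc (bintr h (Q n)).
  elim: n => [|n IH]; first by rewrite expr0 mul1r.
  have [_ sn] := step n.
  by rewrite (le_trans IH)// exprSr -mulrA ler_wpM2l// exprn_ge0.
have zin : inrect a b c d (x +i* y).
  by rewrite /inrect !in_itv /=; have /andP[-> ->] := xP 0%N; have /andP[-> ->] := yP 0%N.
have [l hl] := hd _ zin.
apply/eqP; rewrite -normc_eq0 eq_le normc_ge0 andbT.
have main e : 0 < e -> normc (bint h a b c d) <= 4%:R * e * D * D.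
  move=> e0; have [r r0 hr] := hl e e0.
  have [n hn] : exists n, D / 2 ^+ n < r.
    have h2 : `|2^-1 : R| < 1 by rewrite gtr0_norm ?invr_gt0// invf_lt1// ltr1n.
    have /cvgrPdist_lt/(_ _ r0)[n _ /(_ n)] := @cvg_geometric R D _ h2.
    move=> /(_ (leqnn n)); rewrite sub0r normrN /= exprVn => hn.
    by exists n; apply: le_lt_trans hn; rewrite ler_norm.
  rewrite (le_trans (IE n))// QE /=.
  set z := x +i* y in hl hr zin *.
  have [abn cdn] := qle n.
  have [_ cn] := wc n; rewrite QE in cn.
  have cb := ctrect_bd cn.
  (* subtracting the affine part of h at z does not change the integral *)
  pose g w := h w + (- (h z - l * z) + (- l) * w).
  have cg : cbd (fun w : R[i] => - (h z - l * z) + - l * w) (qa n) (qb n) (qc n) (qd n).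
    move=> w _; apply: climD; first exact: clim_cst.
    by apply: climZ; exact: cnear_id.
  have -> : bint h (qa n) (qb n) (qc n) (qd n) = bint g (qa n) (qb n) (qc n) (qd n).
    rewrite /g bintD// (@bintD _ (fun=> - (h z - l * z)) (fun w => - l * w))//; last first.
    - by move=> w _; apply: climZ; exact: cnear_id.
    - by move=> w _; exact: clim_cst.
    rewrite bint_cst// (@bintZ _ _ id)//; last by move=> w _; exact: cnear_id.
    by rewrite bint_id// mulr0 !addr0.
  have gb w : on_bd (qa n) (qb n) (qc n) (qd n) w -> normc (g w) <= e * (D / 2 ^+ n).
    move=> /andP[/andP[]]; rewrite !in_itv /= => /andP[w1 w2] /andP[w3 w4] _.
    have /andP[x1 x2] := xP n; have /andP[y1 y2] := yP n.
    have wz : normc (w - z) <= D / 2 ^+ n.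
      rewrite (le_trans (normc_le_ReIm _))// -DE lerD// ?ReB ?ImB ler_norml /=.
        by apply/andP; split; lra.
      by apply/andP; split; lra.
    have -> : g w = h w - h z - l * (w - z) by rewrite /g; ring.
    by rewrite (le_trans (hr _ (le_lt_trans wz hn)))// ler_wpM2l// ltW.
  have cgg : cbd g (qa n) (qb n) (qc n) (qd n).
    by move=> w wb; apply: climD; [exact: cb|exact: cg].
  have := bint_le abn cdn cgg gb; rewrite DE => hb.
  have n4 : 0 <= 4%:R ^+ n :> R by rewrite exprn_ge0.
  rewrite (le_trans (ler_wpM2l n4 hb))// le_eqVlt; apply/orP; left; apply/eqP.
  rewrite (_ : 4%:R = 2 * 2 :> R) ?exprMn; last by rewrite -natrM.
  by field; rewrite expf_neq0.
apply/ler_addgt0Pr => e e0; rewrite add0r.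
pose K := 4%:R * (D * D + 1).
have K0 : 0 < K by rewrite mulr_gt0// ltr_wpDl// mulr_ge0.
rewrite (le_trans (main (e / K) _)) ?divr_gt0//.
have -> : 4%:R * (e / K) * D * D = e / K * (4%:R * (D * D)) by ring.
rewrite -[leRHS](divfK (lt0r_neq0 K0)) ler_wpM2l//.
  by rewrite ltW// divr_gt0.
by rewrite /K ler_pM2l// lerDl.
Qed.

End Goursat.

(** * Rules of complex differentiation *)
Section DerivativeRules.
Variable R : realType.
Implicit Types (e : R) (F G q : R[i] -> R[i]) (z w l k : R[i]).

Definition cdiff F z := exists l, cder_at F z l.

(** Caratheodory's form of differentiability, which turns the product,
    quotient and chain rules into algebra. *)
Lemma caraP F z l : cder_at F z l <-> exists q, clim (nbhs z) q l /\
  \forall w \near z, F w = F z + q w * (w - z).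
Proof.
split=> [Fl|[q [ql qF]] e e0]; last first.
  have [d d0 hd] := (nbhscP _ _).1 (filterI (ql e e0) qF).
  exists d => // w /hd[wl ->]; rewrite [F z + _]addrC addrK -mulrBl normcM.
  by rewrite ler_wpM2r ?normc_ge0// ltW.
exists (fun w => if w == z then l else (F w - F z) / (w - z)); split.
  move=> e e0; have e20 : 0 < e / 2 by rewrite divr_gt0.
  have [d d0 hd] := Fl _ e20; apply/nbhscP; exists d => // w /hd wz.
  case: eqVneq => [_|wNz]; first by rewrite subrr normc0.
  have wz0 : w - z != 0 by rewrite subr_eq0.
  have -> : (F w - F z) / (w - z) - l = (F w - F z - l * (w - z)) / (w - z).
    by rewrite [RHS]mulrBl mulfK.
  rewrite normcM normcV ltr_pdivrMr ?normc_gt0// (le_lt_trans wz)//.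
  by rewrite ltr_pM2r ?normc_gt0//; lra.
apply/nbhscP; exists 1 => // w _; case: eqVneq => [->|wNz].
  by rewrite subrr mulr0 addr0.
by rewrite divfK ?subr_eq0// addrC subrK.
Qed.

Lemma near_cder F G z l : (\forall w \near z, F w = G w) ->
  cder_at F z l -> cder_at G z l.
Proof.
move=> FG /caraP[q [ql qF]]; apply/caraP; exists q; split => //.
have Fz : F z = G z by exact: nbhs_singleton FG.
by near=> w; rewrite -(near FG w)// -Fz; near: w.
Unshelve. all: by end_near. Qed.

Lemma near_cdiff F G z : (\forall w \near z, F w = G w) -> cdiff F z -> cdiff G z.
Proof. by move=> FG [l Fl]; exists l; exact: near_cder Fl. Qed.

Lemma cder_cst k z : cder_at (fun=> k) z 0.
Proof.
apply/caraP; exists (fun=> 0); split; first exact: clim_cst.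
by near=> w; rewrite mul0r addr0.
Unshelve. all: by end_near. Qed.

Lemma cder_id z : cder_at id z 1.
Proof.
apply/caraP; exists (fun=> 1); split; first exact: clim_cst.
by near=> w; rewrite mul1r addrC subrK.
Unshelve. all: by end_near. Qed.

Lemma cderD F G z l k : cder_at F z l -> cder_at G z k ->
  cder_at (fun w => F w + G w) z (l + k).
Proof.
move=> /caraP[q [ql qF]] /caraP[p [pk pG]]; apply/caraP.
exists (fun w => q w + p w); split; first exact: climD.
by near=> w; rewrite (near qF w)// (near pG w)//; ring.
Unshelve. all: by end_near. Qed.

Lemma cderM F G z l k : cder_at F z l -> cder_at G z k ->
  cder_at (fun w => F w * G w) z (l * G z + F z * k).
Proof.
move=> Fl Gk; have cG := cder_cont Gk.
move: Fl Gk => /caraP[q [ql qF]] /caraP[p [pk pG]]; apply/caraP.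
exists (fun w => q w * G w + F z * p w); split.
  by apply: climD; [exact: climM|exact: climZ].
by near=> w; rewrite (near qF w)// (near pG w)//; ring.
Unshelve. all: by end_near. Qed.

Lemma cderZ k F z l : cder_at F z l -> cder_at (fun w => k * F w) z (k * l).
Proof.
move=> Fl; have := cderM (cder_cst k z) Fl; by rewrite mul0r add0r.
Qed.

Lemma cderB F G z l k : cder_at F z l -> cder_at G z k ->
  cder_at (fun w => F w - G w) z (l - k).
Proof.
move=> Fl Gk; have := cderD Fl (cderZ (-1) Gk); rewrite mulN1r.
by apply: near_cder; near=> w; rewrite mulN1r.
Unshelve. all: by end_near. Qed.

Lemma cnear_neq0 F z : cnear F z -> F z != 0 -> \forall w \near z, F w != 0.
Proof.
move=> cF F0; have n0 : 0 < normc (F z) by rewrite normc_gt0.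
near=> w; have : normc (F w - F z) < normc (F z) by near: w; exact: cF.
by apply: contraTneq => ->; rewrite sub0r normcN ltxx.
Unshelve. all: by end_near. Qed.

Lemma cderV F z l : F z != 0 -> cder_at F z l ->
  cder_at (fun w => (F w)^-1) z (- l / F z ^+ 2).
Proof.
move=> F0 Fl; have cF := cder_cont Fl; have Fn0 := cnear_neq0 cF F0.
move: Fl => /caraP[q [ql qF]]; apply/caraP.
exists (fun w => (-1 * q w) * ((F w)^-1 * (F z)^-1)); split.
  have -> : - l / F z ^+ 2 = (-1 * l) * ((F z)^-1 * (F z)^-1) by field.
  apply: climM; first exact: climZ.
  by apply: climM (clim_cst _); exact: climV.
near=> w; have Fw0 : F w != 0 by near: w.
have e : F w = F z + q w * (w - z) by near: w.
have -> : -1 * q w * ((F w)^-1 / F z) * (w - z) = - (q w * (w - z)) / (F w * F z).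
  by field; rewrite F0 Fw0.
have -> : q w * (w - z) = F w - F z by rewrite e [F z + _]addrC addrK.
by field; rewrite F0 Fw0.
Unshelve. all: by end_near. Qed.

Lemma cder_comp F G z l k : cder_at G z k -> cder_at F (G z) l ->
  cder_at (F \o G) z (l * k).
Proof.
move=> Gk; have cG := cder_cont Gk.
move: Gk => /caraP[p [pk pG]] /caraP[q [ql qF]]; apply/caraP.
exists (fun w => q (G w) * p w); split.
  apply: climM => //; apply: (@eq_clim _ _ _ _ (q \o G)) => //.
  move=> e /ql/nbhscP[d d0 hd]; near=> w; apply: hd; near: w; exact: cG.
have /nbhscP[d d0 hd] := qF.
near=> w.
have -> : (F \o G) w = F (G z) + q (G w) * (G w - G z).
  by apply: hd; near: w; exact: cG.
by rewrite /= (near pG w)//; ring.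
Unshelve. all: by end_near. Qed.

Lemma cdiff_cst k z : cdiff (fun=> k) z.
Proof. by exists 0; exact: cder_cst. Qed.
Lemma cdiff_id z : cdiff id z.
Proof. by exists 1; exact: cder_id. Qed.
Lemma cdiffD F G z : cdiff F z -> cdiff G z -> cdiff (fun w => F w + G w) z.
Proof. by move=> [l Fl] [k Gk]; exists (l + k); exact: cderD. Qed.
Lemma cdiffB F G z : cdiff F z -> cdiff G z -> cdiff (fun w => F w - G w) z.
Proof. by move=> [l Fl] [k Gk]; exists (l - k); exact: cderB. Qed.
Lemma cdiffM F G z : cdiff F z -> cdiff G z -> cdiff (fun w => F w * G w) z.
Proof. by move=> [l Fl] [k Gk]; eexists; exact: cderM Fl Gk. Qed.
Lemma cdiffZ k F z : cdiff F z -> cdiff (fun w => k * F w) z.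
Proof. by move=> [l Fl]; eexists; exact: cderZ Fl. Qed.
Lemma cdiffV F z : F z != 0 -> cdiff F z -> cdiff (fun w => (F w)^-1) z.
Proof. by move=> F0 [l Fl]; eexists; exact: cderV Fl. Qed.
Lemma cdiff_comp F G z : cdiff G z -> cdiff F (G z) -> cdiff (F \o G) z.
Proof. by move=> [k Gk] [l Fl]; exists (l * k); exact: cder_comp. Qed.
Lemma cdiffX F n z : cdiff F z -> cdiff (fun w => F w ^+ n) z.
Proof.
move=> dF; elim: n => [|n IH]; first exact: cdiff_cst.
rewrite (_ : (fun _ => _) = (fun w => F w * F w ^+ n)); first exact: cdiffM.
by apply/funext => w; rewrite exprS.
Qed.
Lemma cdiff_cont F z : cdiff F z -> cnear F z.
Proof. by move=> [l]; exact: cder_cont. Qed.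
Lemma cdiff_sum (I : Type) (r : seq I) (F : I -> R[i] -> R[i]) z :
  (forall i, cdiff (F i) z) -> cdiff (fun w => \sum_(i <- r) F i w) z.
Proof.
move=> dF; elim: r => [|i r IH].
  rewrite (_ : (fun _ => _) = fun=> 0); first exact: cdiff_cst.
  by apply/funext => w; rewrite big_nil.
rewrite (_ : (fun _ => _) = (fun w => F i w + \sum_(j <- r) F j w)).
  exact: cdiffD.
by apply/funext => w; rewrite big_cons.
Qed.

End DerivativeRules.

(** * Cauchy's integral formula *)
Section CauchyFormula.
Variable R : realType.
Implicit Types (a b x y c d : R) (h F G : R[i] -> R[i]) (z w k : R[i]).

Definition interior_rect a b c d z :=
  [/\ a < Re z, Re z < b, c < Im z & Im z < d].

Lemma inrectP a b c d z : inrect a b c d z <->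
  [/\ a <= Re z, Re z <= b, c <= Im z & Im z <= d].
Proof.
rewrite /inrect !in_itv /=; split; first by move=> /andP[/andP[? ?] /andP[? ?]].
by move=> [-> -> -> ->].
Qed.

Lemma interior_inrect a b c d z : interior_rect a b c d z -> inrect a b c d z.
Proof. by move=> [? ? ? ?]; apply/inrectP; split; exact: ltW. Qed.

Lemma on_bd_neq a b c d z w : interior_rect a b c d z -> on_bd a b c d w -> w != z.
Proof.
move=> [az zb cz zd] /andP[_]; apply: contraTneq => ->.
by rewrite !negb_or (gt_eqF az) (lt_eqF zb) (gt_eqF cz) (lt_eqF zd).
Qed.

(** A bounded isolated singularity does not contribute: all but a small
    rectangle around it is covered by Goursat's theorem. *)
Lemma goursat_punctured h a b c d z (r M : R) :
  interior_rect a b c d z ->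
  (forall w, inrect a b c d w -> w != z -> cdiff h w) ->
  0 < r -> (forall w, w != z -> normc (w - z) < r -> normc (h w) <= M) ->
  bint h a b c d = 0.
Proof.
case: z => x y [/= ax xb cy yd] hd r0 hM; set z := x +i* y in hd hM.
have M0 : 0 <= M.
  apply: le_trans (normc_ge0 (h (z + (r / 2)%:C))) (hM _ _ _).
    by rewrite -subr_eq0 addrC addKr -normc_eq0 normcR gt_eqF// normr_gt0 gt_eqF// divr_gt0.
  by rewrite addrC addKr normcR gtr0_norm ?divr_gt0//; lra.
(* for t < t0 the square of half-side t around z is interior and in the disc *)
pose t0 := Num.min (Num.min (x - a) (b - x)) (Num.min (Num.min (y - c) (d - y)) (r / 2)).
have t00 : 0 < t0 by rewrite !lt_min !subr_gt0 ax xb cy yd divr_gt0.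
have main t : 0 < t -> t < t0 -> normc (bint h a b c d) <= 16%:R * M * t.
  move=> tp; rewrite !lt_min => /andP[/andP[t1 t2] /andP[/andP[t3 t4] t5]].
  have sub0 a' b' c' d' : a <= a' -> b' <= b -> c <= c' -> d' <= d ->
      a' <= b' -> c' <= d' -> ~ inrect a' b' c' d' z -> bint h a' b' c' d' = 0.
    move=> ? ? ? ? ? ? nz; apply: goursat => // w wi; apply: hd.
      by move/inrectP: wi => [? ? ? ?]; apply/inrectP; split; lra.
    by apply: contra_notN nz => /eqP <-.
  have sub1 a' b' c' d' : a <= a' -> b' <= b -> c <= c' -> d' <= d ->
      a' < x -> x < b' -> c' < y -> y < d' -> cbd h a' b' c' d'.
    move=> ? ? ? ? ? ? ? ? w wb; apply: cdiff_cont; apply: hd.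
      by move: wb => /andP[/inrectP[? ? ? ?] _]; apply/inrectP; split; lra.
    by apply: on_bd_neq wb; split.
  rewrite (@bint_splitv _ h a b (x - t)) ?(sub0 a (x - t)) ?add0r; try lra; first last.
  - by apply: sub1 => //; lra.
  - by move/inrectP => /= -[]; lra.
  rewrite (@bint_splitv _ h (x - t) b (x + t)) ?(sub0 (x + t) b) ?addr0; try lra; first last.
  - by apply: sub1 => //; lra.
  - by move/inrectP => /= -[]; lra.
  rewrite (@bint_splith _ h (x - t) (x + t) c d (y - t)) ?(sub0 _ _ c (y - t)) ?add0r; try lra; first last.
  - by apply: sub1 => //; lra.
  - by move/inrectP => /= -[]; lra.
  rewrite (@bint_splith _ h (x - t) (x + t) (y - t) d (y + t)) ?(sub0 _ _ (y + t) d) ?addr0; try lra; first last.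
  - by apply: sub1 => //; lra.
  - by move/inrectP => /= -[]; lra.
  have hb w : on_bd (x - t) (x + t) (y - t) (y + t) w -> normc (h w) <= M.
    move=> wb; apply: hM.
      by apply: on_bd_neq wb; split => /=; lra.
    move: wb => /andP[/inrectP[? ? ? ?] _].
    rewrite (le_lt_trans (normc_le_ReIm _))// ReB ImB /=.
    apply: (@le_lt_trans _ _ (t + t)); last lra.
    by rewrite lerD// ler_norml; apply/andP; split; lra.
  have cb : cbd h (x - t) (x + t) (y - t) (y + t) by apply: sub1; lra.
  have := bint_le _ _ cb hb => /(_ _ _)/le_trans; apply; try lra.
apply/eqP; rewrite -normc_eq0 eq_le normc_ge0 andbT.
apply/ler_addgt0Pr => e e0; rewrite add0r.
pose t := Num.min (t0 / 2) (e / (16%:R * M + 1)).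
have K0 : 0 < 16%:R * M + 1 by rewrite ltr_wpDl// mulr_ge0.
have tp : 0 < t by rewrite lt_min !divr_gt0.
have tt0 : t < t0 by rewrite gt_min; apply/orP; left; lra.
rewrite (le_trans (main t tp tt0))//.
have : t <= e / (16%:R * M + 1) by rewrite ge_min lexx orbT.
by rewrite ler_pdivlMr// => /(le_trans _); apply; rewrite mulrC ler_wpM2l ?(ltW tp)// lerDl.
Qed.

(** Stands for 2 pi i in Cauchy's formula: h(z) is a quotient of two boundary
    integrals. *)
Definition ckernel a b c d z := bint (fun w => (w - z)^-1) a b c d.

Lemma cdiff_ckernel z w : w != z -> cdiff (fun w => (w - z)^-1) w.
Proof.
move=> wz; apply: cdiffV; first by rewrite subr_eq0.
by apply: cdiffB; [exact: cdiff_id|exact: cdiff_cst].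
Qed.

(** (h(w) - h(z)) / (w - z) is bounded near z, by differentiability. *)
Lemma cauchy_formula h a b c d z : interior_rect a b c d z ->
  (forall w, inrect a b c d w -> cdiff h w) ->
  bint (fun w => h w * (w - z)^-1) a b c d = h z * ckernel a b c d z.
Proof.
move=> iz hd; have zin := interior_inrect iz.
have ab : a <= b by case: iz => ? ? _ _; lra.
have cd : c <= d by case: iz => _ _ ? ?; lra.
have [l hl] := hd z zin.
pose p w := (h w - h z) * (w - z)^-1.
have pd w : inrect a b c d w -> w != z -> cdiff p w.
  move=> wi wz; apply: cdiffM; last exact: cdiff_ckernel.
  by apply: cdiffB; [exact: hd|exact: cdiff_cst].
have [r r0 hr] := hl 1 ltr01.
have p0 : bint p a b c d = 0.
  apply: (@goursat_punctured _ _ _ _ _ z r (1 + normc l) iz pd r0) => w wz wr.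
  have := hr w wr; rewrite mul1r => hw.
  rewrite /p normcM normcV ler_pdivrMr ?normc_gt0 ?subr_eq0//.
  have := le_normcD (h w - h z - l * (w - z)) (l * (w - z)); rewrite subrK normcM.
  by move=> /le_trans; apply; rewrite mulrDl mul1r lerD2r.
have cb1 : cbd (fun w => - h z * (w - z)^-1) a b c d.
  move=> w wb; apply: cdiff_cont; apply: cdiffZ; apply: cdiff_ckernel.
  exact: on_bd_neq wb.
have cb2 : cbd (fun w => h w * (w - z)^-1) a b c d.
  move=> w wb; apply: cdiff_cont; apply: cdiffM; last first.
    by apply: cdiff_ckernel; exact: on_bd_neq wb.
  by apply: hd; case/andP: wb.
have cb3 : cbd (fun w => (w - z)^-1) a b c d.
  by move=> w wb; apply: cdiff_cont; apply: cdiff_ckernel; exact: on_bd_neq wb.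
apply/eqP; rewrite -subr_eq0 -mulNr -(bintZ _ ab cd cb3) -bintD// -p0; apply/eqP.
by apply: eq_bint => // w _; rewrite /p mulrBl mulNr.
Qed.

Lemma rint_lt0 a b (f : R -> R) : a < b -> rcont a b f ->
  (forall t, t \in `[a, b] -> f t < 0) -> rint a b f < 0.
Proof.
move=> ab cf f0; rewrite -oppr_gt0 -mulN1r -rintZ//; apply: rint_gt0 => //.
  exact: rcontZ.
by move=> t /f0; rewrite mulN1r oppr_gt0.
Qed.

(** On each side the contribution to the imaginary part has a sign that can be
    read off from 1 / (w - z), and all four are positive. *)
Lemma ckernel_neq0 a b c d z : interior_rect a b c d z -> ckernel a b c d z != 0.
Proof.
move=> iz; have cb : cbd (fun w => (w - z)^-1) a b c d.
  by move=> w wb; apply: cdiff_cont; apply: cdiff_ckernel; exact: on_bd_neq wb.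
case: iz => az zb cz zd; have ab := lt_trans az zb; have cd := lt_trans cz zd.
have [h1 h2 h3 h4] := cbd_edges (ltW ab) (ltW cd) cb.
suff : 0 < Im (ckernel a b c d z).
  by apply: contraTneq => ->; rewrite ltxx.
rewrite /ckernel /bint /cint; simpc => /=.
have sq (u v : R) : v != 0 -> 0 < u ^+ 2 + v ^+ 2.
  by move=> v0; rewrite ltr_wpDl ?sqr_ge0// exprn_even_gt0.
have sq' (u v : R) : u != 0 -> 0 < u ^+ 2 + v ^+ 2.
  by move=> v0; rewrite addrC; exact: sq.
have H1 : 0 < rint a b (fun t => Im (t +i* c - z)^-1).
  apply: rint_gt0 => //; first exact: ccont_Im.
  move=> t _; case: z {cb h1 h2 h3 h4} az zb cz zd => zx zy /= az zb cz zd.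
  by rewrite oppr_gt0 pmulr_llt0 ?subr_lt0// invr_gt0 sq// subr_eq0 lt_eqF.
have H2 : rint a b (fun t => Im (t +i* d - z)^-1) < 0.
  apply: rint_lt0 => //; first exact: ccont_Im.
  move=> t _; case: z {cb h1 h2 h3 h4 H1} az zb cz zd => zx zy /= az zb cz zd.
  by rewrite oppr_lt0 pmulr_lgt0 ?subr_gt0// invr_gt0 sq// subr_eq0 gt_eqF.
have H3 : 0 < rint c d (fun t => Re (b +i* t - z)^-1).
  apply: rint_gt0 => //; first exact: ccont_Re.
  move=> t _; case: z {cb h1 h2 h3 h4 H1 H2} az zb cz zd => zx zy /= az zb cz zd.
  by rewrite pmulr_lgt0 ?subr_gt0// invr_gt0 sq'// subr_eq0 gt_eqF.
have H4 : rint c d (fun t => Re (a +i* t - z)^-1) < 0.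
  apply: rint_lt0 => //; first exact: ccont_Re.
  move=> t _; case: z {cb h1 h2 h3 h4 H1 H2 H3} az zb cz zd => zx zy /= az zb cz zd.
  by rewrite pmulr_llt0 ?subr_lt0// invr_gt0 sq'// subr_eq0 lt_eqF.
lra.
Qed.

End CauchyFormula.

(** * Identity theorem and Weierstrass' theorem *)
Section Weierstrass.
Variable R : realType.
Implicit Types (a b x y c d r : R) (h F G : R[i] -> R[i]) (z w k : R[i]).

Lemma bintB h F a b c d : a <= b -> c <= d -> cbd h a b c d -> cbd F a b c d ->
  bint (fun z => h z - F z) a b c d = bint h a b c d - bint F a b c d.
Proof.
move=> ab cd ch cF; have cF' : cbd (fun z => -1 * F z) a b c d.
  by move=> z zb; apply: climZ; exact: cF.
have -> : bint h a b c d - bint F a b c d = bint h a b c d + -1 * bint F a b c d.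
  by rewrite mulN1r.
rewrite -bintZ// -bintD//.
by apply: eq_bint => // z _; rewrite mulN1r.
Qed.

Lemma sqr_normcE z : normc z ^+ 2 = Re z ^+ 2 + Im z ^+ 2.
Proof. by case: z => x y; rewrite /normc sqr_sqrtr// addr_ge0// sqr_ge0. Qed.

Lemma normc_lt_sqr z r : 0 <= r -> Re z ^+ 2 + Im z ^+ 2 < r ^+ 2 ->
  normc z < r.
Proof.
by move=> r0; rewrite -sqr_normcE ltr_pXn2r// nnegrE// normc_ge0.
Qed.

Lemma rcont_bounded a b (f : R -> R) : a <= b -> rcont a b f ->
  exists M, forall t, t \in `[a, b] -> `|f t| <= M.
Proof.
move=> ab cf.
have [|m mab hm] := @EVT_max R (fun t => `|f t|) a b ab.
  apply: continuous_in_subspaceT => x; rewrite inE => /cf fx.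
  by apply: continuous_comp (fx) _; exact: norm_continuous.
by exists `|f m|.
Qed.

Lemma ccont_bounded a b (p : R -> R[i]) : a <= b -> ccont a b p ->
  exists M, forall t, t \in `[a, b] -> normc (p t) <= M.
Proof.
move=> ab cp; have [M1 h1] := rcont_bounded ab (ccont_Re cp).
have [M2 h2] := rcont_bounded ab (ccont_Im cp).
by exists (M1 + M2) => t tab; rewrite (le_trans (normc_le_ReIm _))// lerD ?h1 ?h2.
Qed.

Lemma cbd_bounded h a b c d : a <= b -> c <= d -> cbd h a b c d ->
  exists2 M, 0 <= M & forall z, on_bd a b c d z -> normc (h z) <= M.
Proof.
move=> ab cd /(cbd_edges ab cd)[h1 h2 h3 h4].
have [M1 k1] := ccont_bounded ab h1; have [M2 k2] := ccont_bounded ab h2.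
have [M3 k3] := ccont_bounded cd h3; have [M4 k4] := ccont_bounded cd h4.
have p1 : 0 <= M1 by rewrite (le_trans (normc_ge0 _) (k1 a _))// in_itv /= lexx.
have p2 : 0 <= M2 by rewrite (le_trans (normc_ge0 _) (k2 a _))// in_itv /= lexx.
have p3 : 0 <= M3 by rewrite (le_trans (normc_ge0 _) (k3 c _))// in_itv /= lexx.
have p4 : 0 <= M4 by rewrite (le_trans (normc_ge0 _) (k4 c _))// in_itv /= lexx.
exists (M1 + M2 + M3 + M4); first by rewrite !addr_ge0.
move=> [x y] /andP[/andP[/= xab ycd]] /or4P[] /eqP e; rewrite e.
- by rewrite (le_trans (k4 _ ycd))// lerDr !addr_ge0.
- by rewrite (le_trans (k3 _ ycd))// -addrA addrCA lerDl !addr_ge0.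
- by rewrite (le_trans (k1 _ xab))// -!addrA lerDl !addr_ge0.
- by rewrite (le_trans (k2 _ xab))// -!addrA addrCA lerDl !addr_ge0.
Qed.

Definition insq w r := inrect (Re w - r) (Re w + r)
  (Im w - r) (Im w + r).
Definition onsq w r := on_bd (Re w - r) (Re w + r)
  (Im w - r) (Im w + r).
Definition sqint w r h := bint h (Re w - r) (Re w + r)
  (Im w - r) (Im w + r).

Local Notation csq w r h :=
  (cbd h (Re w - r) (Re w + r) (Im w - r) (Im w + r)).

Lemma onsq_ge w r z : 0 <= r -> onsq w r z -> r <= normc (z - w).
Proof.
move=> r0 /andP[_ /or4P[]] /eqP e.
- by rewrite (le_trans _ (normr_Re _))// ReB e addrAC subrr sub0r normrN ger0_norm.
- by rewrite (le_trans _ (normr_Re _))// ReB e addrAC subrr add0r ger0_norm.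
- by rewrite (le_trans _ (normr_Im _))// ImB e addrAC subrr sub0r normrN ger0_norm.
- by rewrite (le_trans _ (normr_Im _))// ImB e addrAC subrr add0r ger0_norm.
Qed.

Lemma insq_le w r z : insq w r z -> normc (z - w) <= 2 * r.
Proof.
move=> /inrectP[h1 h2 h3 h4]; rewrite (le_trans (normc_le_ReIm _))// ReB ImB.
rewrite mulr2n mulrDl mul1r.
by rewrite lerD// ler_norml; apply/andP; split; lra.
Qed.

Lemma disc_interior w r z : normc (z - w) < r ->
  interior_rect (Re w - r) (Re w + r)
  (Im w - r) (Im w + r) z.
Proof.
move=> zw; have := le_lt_trans (normr_Re _) zw; have := le_lt_trans (normr_Im _) zw.
by rewrite ReB ImB !ltr_norml => /andP[? ?] /andP[? ?]; split; lra.
Qed.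

(** A function vanishing near the centre w of a square vanishes on the inscribed
    disc: Cauchy's formula for h(z)/(z - w)^n bounds |h(z)| by a constant times
    (|z - w|/r)^n, for every n. *)
Lemma square_vanish h w r d : 0 < r -> (forall v, insq w r v -> cdiff h v) ->
  0 < d -> (forall v, normc (v - w) < d -> h v = 0) ->
  forall z, normc (z - w) < r -> h z = 0.
Proof.
move=> r0 hd d0 hv z zr.
have [->|zw] := eqVneq z w; first by rewrite hv// subrr normc0.
have iz := disc_interior zr.
have ab : Re w - r <= Re w + r by lra.
have cd : Im w - r <= Im w + r by lra.
have cb : csq w r h.
  by move=> v /andP[vi _]; apply: cdiff_cont; exact: hd.
have [B B0 hB] := cbd_bounded ab cd cb.
set kap := ckernel (Re w - r) (Re w + r)
    (Im w - r) (Im w + r) z.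
have kap0 : kap != 0 by exact: ckernel_neq0.
have nk0 : 0 < normc kap by rewrite normc_gt0.
set m := r - normc (z - w); have m0 : 0 < m by rewrite subr_gt0.
(* differentiable at w too, where h vanishes identically *)
pose q n v := h v * (v - w)^-1 ^+ n.
have qd n v : insq w r v -> cdiff (q n) v.
  move=> vi; have [->|vw] := eqVneq v w.
    apply: (@near_cdiff _ (fun=> 0)); last exact: cdiff_cst.
    by apply/nbhscP; exists d => // u ud; rewrite /q hv// mul0r.
  by apply: cdiffM; [exact: hd|apply: cdiffX; exact: cdiff_ckernel].
pose C := 4%:R * B / m * (4%:R * r).
have main n : normc (h z) * normc kap <= C * (normc (z - w) / r) ^+ n.
  have cbq : csq w r (fun v => q n v * (v - z)^-1).
    move=> v vb; apply: cdiff_cont; apply: cdiffM.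
      by apply: qd; case/andP: vb.
    by apply: cdiff_ckernel; exact: on_bd_neq vb.
  have bq v : onsq w r v -> normc (q n v * (v - z)^-1) <= B / r ^+ n / m.
    move=> vb; have vr := onsq_ge (ltW r0) vb.
    rewrite normcM normcV ler_pM ?normc_ge0 ?invr_ge0 ?normc_ge0//.
      rewrite /q normcM normcX normcV exprVn ler_pM ?normc_ge0 ?invr_ge0 ?exprn_ge0 ?normc_ge0//.
        exact: hB.
      rewrite lef_pV2 ?posrE ?exprn_gt0//; last exact: lt_le_trans vr.
      by rewrite lerXn2r ?nnegrE ?normc_ge0// ltW.
    have hm : m <= normc (v - z).
      by have := lerB_normc (v - w) (z - w); rewrite opprB addrA subrK /m; lra.
    by rewrite lef_pV2 ?posrE//; exact: lt_le_trans hm.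
  have := bint_le ab cd cbq bq.
  rewrite (cauchy_formula iz (fun v => qd n v)) -/kap /q normcM normcM normcX normcV.
  have zw0 : 0 < normc (z - w) by rewrite normc_gt0 subr_eq0.
  rewrite exprVn mulrAC ler_pdivrMr ?exprn_gt0// => /le_trans; apply.
  rewrite exprMn exprVn /C le_eqVlt; apply/orP; left; apply/eqP.
  by field; rewrite expf_neq0 ?gt_eqF.
apply/eqP; rewrite -normc_eq0; apply/eqP.
have C0 : 0 <= C.
  by rewrite /C !mulr_ge0 ?invr_ge0 ?(ltW m0) ?(ltW r0).
have t1 : `|normc (z - w) / r| < 1.
  by rewrite ger0_norm ?divr_ge0 ?normc_ge0 ?(ltW r0)// ltr_pdivrMr// mul1r.
have lim0 := @cvg_geometric R C _ t1.
suff h0 : normc (h z) * normc kap <= 0.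
  apply/eqP; rewrite eq_le normc_ge0 andbT -(pmulr_lle0 _ nk0) //.
apply/ler_addgt0Pr => e e0; rewrite add0r.
have /cvgrPdist_lt/(_ _ e0)[n _ /(_ n (leqnn n))] := lim0.
rewrite sub0r normrN /= => hn.
by rewrite (le_trans (main n))// (le_trans (ler_norm _))// ltW.
Qed.

(** 1/(v-z) - 1/(v-w) - (z-w)/(v-w)^2 = (z-w)^2 / ((v-z)(v-w)^2), and the last
    fraction is bounded for v on the square and z near its centre w. *)
Lemma cdiff_cauchy_integral h w r : 0 < r -> csq w r h ->
  cdiff (fun z => sqint w r (fun v => h v * (v - z)^-1)) w.
Proof.
move=> r0 cb.
have ab : Re w - r <= Re w + r by lra.
have cd : Im w - r <= Im w + r by lra.
have [B B0 hB] := cbd_bounded ab cd cb.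
have nz z v : normc (z - w) < r / 2 -> onsq w r v -> r / 2 <= normc (v - z).
  move=> zw /(onsq_ge (ltW r0)) vr.
  by have := lerB_normc (v - w) (z - w); rewrite opprB addrA subrK; lra.
have nz' z v : normc (z - w) < r / 2 -> onsq w r v -> v != z.
  move=> zw vb; have := nz _ _ zw vb; apply: contraTneq => ->.
  by rewrite subrr normc0 -ltNge divr_gt0.
have cbz z : normc (z - w) < r / 2 -> csq w r (fun v => h v * (v - z)^-1).
  move=> zw v vb; apply: climM; first exact: cb.
  by apply: cdiff_cont; apply: cdiff_ckernel; exact: nz' vb.
have w0 : normc (w - w) < r / 2 by rewrite subrr normc0 divr_gt0.
have cbw : csq w r (fun v => h v * (v - w)^-1 ^+ 2).
  move=> v vb; apply: climM; first exact: cb.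
  by apply: cdiff_cont; apply: cdiffX; apply: cdiff_ckernel; exact: nz' vb.
pose K := 4%:R * (B * ((2 / r) * (1 / r) ^+ 2)) * (4%:R * r) + 1.
have K0 : 0 < K.
  by rewrite ltr_wpDl// !mulr_ge0 ?invr_ge0 ?exprn_ge0 ?invr_ge0 ?(ltW r0)// mulr_ge0 ?invr_ge0 ?(ltW r0).
exists (sqint w r (fun v => h v * (v - w)^-1 ^+ 2)) => e e0.
exists (Num.min (r / 2) (e / K)); first by rewrite lt_min !divr_gt0.
move=> z; rewrite lt_min => /andP[zr ze].
pose g v := (z - w) ^+ 2 * (h v * ((v - z)^-1 * (v - w)^-1 ^+ 2)).
have cg0 : cbd (fun v => h v * ((v - z)^-1 * (v - w)^-1 ^+ 2)) (Re w - r)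
    (Re w + r) (Im w - r) (Im w + r).
  move=> v vb; apply: climM; first exact: cb.
  apply: climM; first by apply: cdiff_cont; apply: cdiff_ckernel; exact: nz' vb.
  by apply: cdiff_cont; apply: cdiffX; apply: cdiff_ckernel; exact: nz' vb.
have cbm k F : csq w r F -> csq w r (fun v => k * F v).
  by move=> cF v vb; apply: climZ; exact: cF.
have eg : sqint w r (fun v => h v * (v - z)^-1) - sqint w r (fun v => h v * (v - w)^-1)
    - sqint w r (fun v => h v * (v - w)^-1 ^+ 2) * (z - w) = sqint w r g.
  have -> : sqint w r g = sqint w r (fun v => h v * (v - z)^-1 +
      (-1 * (h v * (v - w)^-1) + - (z - w) * (h v * (v - w)^-1 ^+ 2))).
    apply: eq_bint => // v vb; rewrite /g.
    have v1 : v - z != 0 by rewrite subr_eq0; exact: nz' vb.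
    have v2 : v - w != 0 by rewrite subr_eq0; exact: nz' vb.
    by field; rewrite v1 v2.
  rewrite /sqint bintD//; last 2 first.
  - exact: cbz.
  - by move=> v vb; apply: climD; apply: cbm => //; exact: cbz.
  rewrite bintD//; last 2 first.
  - by apply: cbm; exact: cbz.
  - exact: cbm.
  rewrite !bintZ//; last exact: cbz.
  by ring.
rewrite eg /sqint /g bintZ// normcM normcX.
have hb v : onsq w r v -> normc (h v * ((v - z)^-1 * (v - w)^-1 ^+ 2))
    <= B * ((2 / r) * (1 / r) ^+ 2).
  move=> vb; rewrite normcM normcM normcX !normcV.
  have vw := onsq_ge (ltW r0) vb; have vz := nz _ _ zr vb.
  have vw0 : 0 < normc (v - w) by exact: lt_le_trans vw.
  have vz0 : 0 < normc (v - z) by apply: lt_le_trans vz; rewrite divr_gt0.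
  rewrite ler_pM ?normc_ge0 ?mulr_ge0 ?exprn_ge0 ?invr_ge0 ?normc_ge0//; first exact: hB.
  rewrite ler_pM ?exprn_ge0 ?invr_ge0 ?normc_ge0//.
    by rewrite -[2 / r]invf_div lef_pV2 ?posrE// divr_gt0.
  by rewrite lerXn2r ?nnegrE ?invr_ge0 ?normc_ge0 ?divr_ge0 ?(ltW r0)// div1r lef_pV2 ?posrE.
have := bint_le ab cd cg0 hb.
set I := normc _ => hI.
have hI' : I <= K.
  apply: le_trans hI _; rewrite /K; set X := B * _.
  have -> : Re w + r - (Re w - r) + (Im w + r - (Im w - r)) = 4%:R * r by ring.
  by rewrite lerDl.
rewrite expr2 -mulrA mulrC mulrAC -mulrA [_ * I]mulrC mulrA ler_wpM2r ?normc_ge0//.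
by rewrite (le_trans (ler_wpM2l (normc_ge0 _) hI'))// -ler_pdivlMr// ltW.
Qed.

Lemma sqint_le h w r M : 0 <= r -> csq w r h ->
  (forall v, onsq w r v -> normc (h v) <= M) ->
  normc (sqint w r h) <= 16%:R * M * r.
Proof.
move=> r0 cb hM.
have ab : Re w - r <= Re w + r by lra.
have cd : Im w - r <= Im w + r by lra.
rewrite (le_trans (bint_le ab cd cb hM))// le_eqVlt; apply/orP; left; apply/eqP.
by ring.
Qed.

(** Weierstrass: locally uniform limits of holomorphic functions are
    holomorphic, since Cauchy's formula passes to the limit. *)
Lemma weierstrass (hn : nat -> R[i] -> R[i]) h w r (v : nat -> R) : 0 < r ->
  (forall n z, normc (z - w) < r -> cdiff (hn n) z) ->
  v @ \oo --> 0 ->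
  (forall n z, normc (z - w) < r -> normc (hn n z - h z) <= v n) ->
  cdiff h w.
Proof.
move=> r0 hd v0 hv.
have hc z : normc (z - w) < r -> cnear h z.
  move=> zr e e0; have e30 : 0 < e / 3%:R by rewrite divr_gt0.
  move/cvgrPdist_lt: v0 => /(_ _ e30)[n _ /(_ n (leqnn n))].
  rewrite sub0r normrN => /(le_lt_trans (ler_norm _)) vn.
  have /nbhscP[d d0 hd'] := cdiff_cont (hd n z zr) e30.
  apply/nbhscP; exists (Num.min d (r - normc (z - w))).
    by rewrite lt_min d0 subr_gt0.
  move=> u; rewrite lt_min => /andP[/hd' h1 h2].
  have ur : normc (u - w) < r.
    by rewrite (le_lt_trans (le_normc_distD z _ _))// -ltrBrDr.
  have := hv n u ur; have := hv n z zr; move: h1.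
  have := le_normc_distD (hn n u) (h u) (h z).
  have := le_normc_distD (hn n z) (hn n u) (h z).
  rewrite [normc (h u - hn n u)]normc_distC; move: vn; clear.
  set A := normc _; set B := normc _; set C := normc _; set D := normc _; set E := normc _.
  by lra.
pose t := r / 4%:R; have t0 : 0 < t by rewrite divr_gt0.
have insq_r z : insq w t z -> normc (z - w) < r.
  by move=> /insq_le/le_lt_trans; apply; rewrite /t; lra.
have onsq_r z : onsq w t z -> normc (z - w) < r.
  by move=> /andP[/insq_r].
have wt : normc (w - w) < t by rewrite subrr normc0.
have cb : csq w t h by move=> z /onsq_r; exact: hc.
have cb1 : csq w t (fun=> 1 : R[i]) by move=> z _; exact: clim_cst.
(* Cauchy's formula for h, as the limit of the one for hn n *)
have kE z : normc (z - w) < t ->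
    h z * sqint w t (fun u => 1 * (u - z)^-1) = sqint w t (fun u => h u * (u - z)^-1).
  move=> zt; have iz := disc_interior zt.
  pose m := t - normc (z - w); have m0 : 0 < m by rewrite subr_gt0.
  have cbd1 F : csq w t F -> csq w t (fun u => F u * (u - z)^-1).
    move=> cF u ub; apply: climM; first exact: cF.
    by apply: cdiff_cont; apply: cdiff_ckernel; exact: on_bd_neq ub.
  have ab : Re w - t <= Re w + t by lra.
  have cd : Im w - t <= Im w + t by lra.
  apply: (@clim_unique _ _ \oo _ (fun n => sqint w t (fun u => hn n u * (u - z)^-1))).
    apply: (@eq_clim _ _ _ _ (fun n => hn n z * sqint w t (fun u => 1 * (u - z)^-1))).
      move=> n; rewrite /sqint cauchy_formula//; last first.
        by move=> u ui; apply: hd; exact: insq_r.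
      by congr (_ * _); apply: eq_bint => // u _; rewrite mul1r.
    apply: climM; last exact: clim_cst.
    move=> e e0; move/cvgrPdist_lt: v0 => /(_ _ e0) ve.
    near=> n; rewrite (le_lt_trans (hv _ _ _))//; first by rewrite (lt_trans zt)// /t; lra.
    have : `|0 - v n| < e by near: n.
    by rewrite sub0r normrN; apply: le_lt_trans; exact: ler_norm.
  move=> e e0; pose K := 16%:R * (1 / m) * t.
  have K0 : 0 < K by rewrite !mulr_gt0// invr_gt0.
  have eK : 0 < e / K by rewrite divr_gt0.
  move/cvgrPdist_lt: v0 => /(_ _ eK) ve.
  near=> n.
  have vn : v n < e / K.
    have : `|0 - v n| < e / K by near: n.
    by rewrite sub0r normrN; apply: le_lt_trans; exact: ler_norm.
  have cbn : csq w t (hn n) by move=> u /onsq_r ur; apply: cdiff_cont; exact: hd.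
  have cbh : csq w t (fun u => hn n u - h u).
    by move=> u ub; apply: climB; [exact: cbn|exact: cb].
  have -> : sqint w t (fun u => hn n u * (u - z)^-1) - sqint w t (fun u => h u * (u - z)^-1)
      = sqint w t (fun u => (hn n u - h u) * (u - z)^-1).
    rewrite /sqint -bintB//; [|exact: cbd1|exact: cbd1].
    by apply: eq_bint => // u _; rewrite mulrBl.
  have hb u : onsq w t u -> normc ((hn n u - h u) * (u - z)^-1) <= v n * (1 / m).
    move=> ub; rewrite normcM normcV div1r ler_pM ?normc_ge0 ?invr_ge0 ?normc_ge0//.
      by apply: hv; exact: onsq_r.
    have hm : m <= normc (u - z).
      have := onsq_ge (ltW t0) ub.
      by have := lerB_normc (u - w) (z - w); rewrite opprB addrA subrK /m; lra.
    by rewrite lef_pV2 ?posrE//; exact: lt_le_trans hm.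
  rewrite (le_lt_trans (sqint_le (ltW t0) (cbd1 _ cbh) hb))//.
  have -> : 16%:R * (v n * (1 / m)) * t = v n * K by rewrite /K; ring.
  by rewrite -ltr_pdivlMr.
have k0 z : normc (z - w) < t -> sqint w t (fun u => 1 * (u - z)^-1) != 0.
  move=> zt; have := ckernel_neq0 (disc_interior zt); congr (_ != 0).
  by apply: eq_bint => [||u _]; [lra|lra|rewrite mul1r].
have := cdiffM (cdiff_cauchy_integral t0 cb) (@cdiffV R (fun z => sqint w t
  (fun u => 1 * (u - z)^-1)) w (k0 _ wt) (cdiff_cauchy_integral t0 cb1)).
apply: near_cdiff; apply/nbhscP; exists t => // z zt.
by rewrite -kE// mulfK// k0.
Unshelve. all: by end_near. Qed.

Lemma cdiff_csum (u : nat -> R[i] -> R[i]) (v : nat -> R) w r : 0 < r ->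
  (forall n z, normc (z - w) < r -> cdiff (u n) z) ->
  cvgn (series v) ->
  (forall n z, normc (z - w) < r -> normc (u n z) <= v n) ->
  cdiff (fun z => csum (u ^~ z)) w.
Proof.
move=> r0 ud sv uv.
apply: (@weierstrass (fun n z => series (u ^~ z) n) _ w r
  (fun n => limn (series v) - series v n) r0).
- move=> n z zr; rewrite /series /=.
  have {}ud i : cdiff (u i) z by exact: ud.
  exact: cdiff_sum.
- rewrite -(subrr (limn (series v))); apply: cvgB => //; exact: cvg_cst.
- by move=> n z zr; rewrite normc_distC; apply: csum_tail => // k; exact: uv.
Qed.

(** Identity theorem on the plane punctured at 1. A point with nonzero
    imaginary part lies in a disc centred in Re > 1 whose circumscribed square
    avoids the real axis; the real points follow by continuity. *)
Lemma identity_punctured h : (forall z, z != 1 -> cdiff h z) ->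
  (forall z, 1 < Re z -> h z = 0) -> forall z, z != 1 -> h z = 0.
Proof.
move=> hd h0.
have up z : Im z != 0 -> h z = 0.
  case: z => x y /= y0.
  (* the disc of centre 2 + i T and radius |T - y/2| contains x + i y exactly
     when (x - 2)^2 < (T - y/2)^2 - (T - y)^2 = y (T - 3 y/4) *)
  pose T := y + ((x - 2) ^+ 2 + 1) / y.
  have y2 : 0 < y ^+ 2 by rewrite exprn_even_gt0.
  have x2 : 0 <= (x - 2) ^+ 2 by rewrite sqr_ge0.
  have Ty : T * y = y ^+ 2 + ((x - 2) ^+ 2 + 1) by rewrite /T; field.
  have r0 : 0 < `|T - y / 2|.
    rewrite normr_gt0 subr_eq0; apply/eqP => e.
    by move: Ty; rewrite e; nra.
  have rE : `|T - y / 2| = `|T| - `|y| / 2.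
    have [yp|yn] := ltP 0 y.
      have Tp : y <= T by rewrite /T lerDl divr_ge0 ?(ltW yp)// addr_ge0.
      by rewrite !ger0_norm//; lra.
    have {}yn : y < 0 by rewrite lt_neqAle y0.
    have Tn : T <= y by rewrite /T gerDl mulr_ge0_le0 ?invr_le0 ?(ltW yn)// addr_ge0.
    by rewrite !ler0_norm//; lra.
  apply: (@square_vanish _ (2 +i* T) _ 1 r0 _ ltr01).
  - move=> v /inrectP[/= _ _ v3 v4]; apply: hd; apply/eqP => v1.
    move: v3 v4; rewrite v1 rE /= => v3 v4.
    have := normr_gt0 y; rewrite y0 => ny.
    have [|] := lerP 0 T => Ts; [move: v3 v4; rewrite (ger0_norm Ts)|
      move: v3 v4; rewrite (ltr0_norm Ts)]; lra.
  - move=> v v1; apply: h0; have := le_lt_trans (normr_Re _) v1.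
    by rewrite ReB /= ltr_norml => /andP[]; lra.
  - apply: normc_lt_sqr; first exact: ltW.
    rewrite real_normK ?num_real// ReB ImB /=; nra.
move=> z z1; have [y0|] := eqVneq (Im z) 0; last exact: up.
apply/eqP; rewrite -normc_eq0 eq_le normc_ge0 andbT.
apply/ler_addgt0Pr => e e0; rewrite add0r.
have /nbhscP[d d0 hd'] := cdiff_cont (hd z z1) e0.
have zd : normc (z + 0 +i* (d / 2) - z) < d.
  rewrite addrC addKr (le_lt_trans (normc_le_ReIm _))//= normr0 add0r.
  by rewrite ger0_norm ?divr_ge0 ?(ltW d0)//; lra.
have := hd' _ zd; rewrite up; first by rewrite sub0r normcN => /ltW.
by rewrite ImD y0 add0r /= gt_eqF// divr_gt0.
Qed.

(** The points x + i y and c + i y, with c large, lie in a disc whose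
    circumscribed square stays in the half-plane. *)
Lemma identity_halfplane h (c0 c1 : R) : (forall z, c0 < Re z -> cdiff h z) ->
  (forall z, c1 < Re z -> h z = 0) -> forall z, c0 < Re z -> h z = 0.
Proof.
move=> hd h0 [x y] /= xc.
pose c := Num.max c1 x + 1.
have cx : x < c by rewrite ltr_pwDr// le_max lexx orbT.
have cc1 : c1 < c by rewrite ltr_pwDr// le_max lexx.
have r0 : 0 < c - (x + c0) / 2 by lra.
have d0 : 0 < c - c1 by lra.
apply: (@square_vanish _ (c +i* y) _ _ r0 _ d0).
- move=> v /inrectP[/= v1 _ _ _]; apply: hd; lra.
- move=> v /(le_lt_trans (normr_Re _)); rewrite ReB /= ltr_norml => /andP[? _].
  by apply: h0; lra.
- apply: normc_lt_sqr; first exact: ltW.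
  rewrite ReB ImB /= subrr expr0n addr0 -[(x - c) ^+ 2]sqrrN opprB.
  by rewrite ltr_pXn2r ?nnegrE//; lra.
Qed.

End Weierstrass.

(** * Complex powers and their finite differences *)
Section ComplexPowers.
Variable R : realType.
Implicit Types (a b x y t r : R) (z w s : R[i]) (n J : nat).

Lemma is_derive_eps (f : R -> R) x l : is_derive x 1 f l -> forall e, 0 < e ->
  exists2 d, 0 < d & forall y, `|y - x| < d ->
    `|f y - f x - l * (y - x)| <= e * `|y - x|.
Proof.
move=> fl e e0; have df : derivable f x 1 by exact: ex_derive.
have lE : 'D_1 f x = l by exact: derive_val.
have : (fun h : R => h^-1 *: ((f \o shift x) (h *: 1) - f x)) @ 0^' --> l.
  by rewrite -lE; exact: df.
move=> /cvgrPdist_lt/(_ _ e0)/nbhs_normP[d d0 hd]; exists d => // y yx.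
have [->|yNx] := eqVneq y x; first by rewrite !subrr mulr0 subrr normr0 mulr0.
have yx0 : y - x != 0 by rewrite subr_eq0.
have := hd (y - x); rewrite /ball_ /= sub0r normrN => /(_ yx yx0).
rewrite /= /shift /GRing.scale /= mulr1 subrK distrC => /ltW h.
have -> : f y - f x - l * (y - x) = ((y - x)^-1 * (f y - f x) - l) * (y - x).
  by field.
by rewrite normrM ler_wpM2r.
Qed.

Lemma cexp0 : cexp (0 : R[i]) = 1.
Proof. by rewrite /cexp /= expR0 cos0 sin0 mul1r. Qed.

Lemma cexpD z w : cexp (z + w) = cexp z * cexp w.
Proof.
case: z w => a b [c d]; rewrite /cexp /= expRD cosD sinD.
by apply: complex_ext => /=; ring.
Qed.

Lemma normc_cexp z : normc (cexp z) = expR (Re z).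
Proof.
case: z => a b; rewrite /cexp normcM normcR /= ger0_norm ?expR_ge0//.
by rewrite /normc cos2Dsin2 sqrtr1 mulr1.
Qed.

Lemma cexp_neq0 z : cexp z != 0.
Proof. by rewrite -normc_gt0 normc_cexp expR_gt0. Qed.

Lemma cexpN z : cexp (- z) = (cexp z)^-1.
Proof.
apply: (mulfI (cexp_neq0 z)); rewrite -cexpD subrr cexp0 divff//.
exact: cexp_neq0.
Qed.

Lemma cder_cexp0 : cder_at (@cexp R) 0 1.
Proof.
move=> e e0; have e60 : 0 < e / 6%:R by rewrite divr_gt0.
have [d1 p1 h1] := is_derive_eps (is_derive_expR 0) e60.
have [d2 p2 h2] := is_derive_eps (is_derive_cos 0) e60.
have [d3 p3 h3] := is_derive_eps (is_derive_sin 0) e60.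
exists (Num.min (Num.min d1 d2) (Num.min d3 (Num.min 1 (e / 6%:R)))).
  by rewrite !lt_min p1 p2 p3 ltr01.
case=> a b; rewrite subr0 !lt_min => /andP[/andP[k1 k2] /andP[k3 /andP[k4 k5]]].
set W := a +i* b; have aW : `|a| <= normc W := normr_Re W.
have bW : `|b| <= normc W := normr_Im W.
have := h1 a; rewrite subr0 expR0 mul1r => /(_ (le_lt_trans aW k1)) {}h1.
have := h2 b; rewrite subr0 cos0 sin0 oppr0 mul0r subr0 => /(_ (le_lt_trans bW k2)) {}h2.
have := h3 b; rewrite subr0 cos0 sin0 subr0 mul1r => /(_ (le_lt_trans bW k3)) {}h3.
(* e^W - 1 - W = (e^a - 1 - a) e^(ib) + (1 + a) (e^(ib) - 1 - ib) + i a b *)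
have -> : cexp W - cexp 0 - 1 * W = (expR a - 1 - a)%:C * (cos b +i* sin b)
    + (1 + a)%:C * ((cos b - 1) +i* (sin b - b)) + 0 +i* (a * b).
  by rewrite cexp0 /cexp /W; apply: complex_ext => /=; ring.
have n1 : normc ((expR a - 1 - a)%:C * (cos b +i* sin b)) <= e / 6%:R * normc W.
  rewrite normcM normcR /normc cos2Dsin2 sqrtr1 mulr1.
  by rewrite (le_trans h1)// ler_wpM2l// ltW.
have n2 : normc ((1 + a)%:C * ((cos b - 1) +i* (sin b - b))) <= 4%:R * (e / 6%:R) * normc W.
  rewrite normcM normcR.
  have a2 : `|1 + a| <= 2.
    by rewrite (le_trans (ler_normD _ _))// normr1; move: aW k4; lra.
  have c2 : normc ((cos b - 1) +i* (sin b - b)) <= 2 * (e / 6%:R * normc W).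
    rewrite (le_trans (normc_le_ReIm _))//= mulr2n mulrDl mul1r lerD//.
      by rewrite (le_trans h2)// ler_wpM2l// ltW.
    by rewrite (le_trans h3)// ler_wpM2l// ltW.
  have -> : 4%:R * (e / 6%:R) * normc W = 2 * (2 * (e / 6%:R * normc W)) by ring.
  by rewrite ler_pM// normc_ge0.
have n3 : normc (0 +i* (a * b)) <= e / 6%:R * normc W.
  rewrite (le_trans (normc_le_ReIm _))//= normr0 add0r normrM mulrC ler_pM//.
  by rewrite (le_trans bW)// ltW.
rewrite (le_trans (le_normcD _ _))// (le_trans (lerD (le_normcD _ _) n3))//.
rewrite (le_trans (lerD (lerD n1 n2) (lexx _)))// le_eqVlt; apply/orP; left.
by apply/eqP; field.
Qed.

Lemma cder_cexp z : cder_at (@cexp R) z (cexp z).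
Proof.
have c0 : cder_at (fun w : R[i] => w - z) z 1.
  by have := cderB (cder_id z) (cder_cst z z); rewrite subr0.
have c1 : cder_at (@cexp R) (z - z) 1 by rewrite subrr; exact: cder_cexp0.
have := cderZ (cexp z) (cder_comp c0 c1); rewrite !mulr1.
apply: near_cder; apply/nbhscP; exists 1 => // w _ /=.
by rewrite -cexpD addrC subrK.
Qed.

Lemma rpowcDr x s z : rpowc x (s + z) = rpowc x s * rpowc x z.
Proof. by rewrite /rpowc mulrDr cexpD. Qed.

Lemma rpowc0 x : rpowc x 0 = 1.
Proof. by rewrite /rpowc mulr0 cexp0. Qed.

Lemma rpowcN x s : rpowc x (- s) = (rpowc x s)^-1.
Proof. by rewrite /rpowc mulrN cexpN. Qed.

Lemma rpowc_neq0 x s : rpowc x s != 0.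
Proof. exact: cexp_neq0. Qed.

Lemma rpowcM x y s : 0 < x -> 0 < y -> rpowc (x * y) s = rpowc x s * rpowc y s.
Proof.
by move=> x0 y0; rewrite /rpowc lnM ?posrE// -cexpD -mulrDl (rmorphD (real_complex R)).
Qed.

Lemma rpowc1l s : rpowc 1 s = 1.
Proof. by rewrite /rpowc ln1 mul0r cexp0. Qed.

Lemma rpowc_real x r : rpowc x r%:C = (expR (r * ln x))%:C.
Proof.
by rewrite /rpowc /cexp; simpc => /=; rewrite cos0 sin0 mulr1 mulr0 mulrC.
Qed.

Lemma rpowc_nat x n : 0 < x -> rpowc x n%:R = (x ^+ n)%:C.
Proof.
by move=> x0; rewrite -(rmorph_nat (real_complex R)) rpowc_real expRM_natl lnK.
Qed.

Lemma rpowcr1 x : 0 < x -> rpowc x 1 = x%:C.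
Proof. by move=> x0; have := rpowc_nat 1 x0; rewrite expr1. Qed.

Lemma normc_rpowc x s : normc (rpowc x s) = expR (Re s * ln x).
Proof. by rewrite /rpowc normc_cexp ReRM mulrC. Qed.

Lemma cdiff_rpowc x s : cdiff (rpowc x) s.
Proof.
have := cder_comp (cderZ (ln x)%:C (cder_id s)) (@cder_cexp _).
by move=> h; eexists; exact: h.
Qed.

(** [phi s x = x^-s], as a function of the real variable x. *)
Definition phi s x : R[i] := rpowc x (- s).

Definition rder (p q : R -> R[i]) x :=
  is_derive x 1 (fun y => Re (p y)) (Re (q x)) /\
  is_derive x 1 (fun y => Im (p y)) (Im (q x)).

Lemma rder_phi s x : 0 < x -> rder (phi s) (fun y => - s * phi (s + 1) y) x.
Proof.
move=> x0; case: s => a b.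
have l1 : is_derive x 1 (fun y => - a * ln y) (- a * x^-1).
  by apply: is_deriveZ; exact: is_derive1_ln.
have l2 : is_derive x 1 (fun y => - b * ln y) (- b * x^-1).
  by apply: is_deriveZ; exact: is_derive1_ln.
have e1 := @is_derive1_comp R expR (fun y => - a * ln y) x _ _
  (is_derive_expR (- a * ln x)) l1.
have c1 := @is_derive1_comp R cos (fun y => - b * ln y) x _ _
  (is_derive_cos (- b * ln x)) l2.
have s1 := @is_derive1_comp R sin (fun y => - b * ln y) x _ _
  (is_derive_sin (- b * ln x)) l2.
have pE y : phi (a +i* b) y = (expR (- a * ln y) * cos (- b * ln y)) +i*
    (expR (- a * ln y) * sin (- b * ln y)).
  rewrite /phi /rpowc (_ : (ln y)%:C * _ = (- a * ln y) +i* (- b * ln y)).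
    by rewrite /cexp; apply: complex_ext => /=; ring.
  by apply: complex_ext => /=; ring.
have p1E : phi ((a +i* b) + 1) x = x^-1%:C * phi (a +i* b) x.
  rewrite /phi opprD rpowcDr rpowcN [rpowc x (-1)]rpowcN rpowcr1// mulrC.
  by rewrite (rmorphV (real_complex R))// unitfE gt_eqF.
split; rewrite p1E pE.
  rewrite (_ : (fun y => _) = (expR \o (fun y => - a * ln y)) *
    (cos \o (fun y => - b * ln y))); last first.
    by apply/funext => y; rewrite pE.
  apply: (is_derive_eq (is_deriveM e1 c1)).
  by rewrite /GRing.scale /=; ring.
rewrite (_ : (fun y => _) = (expR \o (fun y => - a * ln y)) *
  (sin \o (fun y => - b * ln y))); last first.
  by apply/funext => y; rewrite pE.
apply: (is_derive_eq (is_deriveM e1 s1)).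
by rewrite /GRing.scale /=; ring.
Qed.

Lemma rderB (p1 q1 p2 q2 : R -> R[i]) x : rder p1 q1 x -> rder p2 q2 x ->
  rder (fun y => p1 y - p2 y) (fun y => q1 y - q2 y) x.
Proof.
move=> [r1 i1] [r2 i2]; split.
  rewrite (_ : (fun y => _) = (fun y => Re (p1 y)) - (fun y => Re (p2 y))).
    by rewrite ReB; exact: is_deriveB.
  by apply/funext => y; rewrite ReB.
rewrite (_ : (fun y => _) = (fun y => Im (p1 y)) - (fun y => Im (p2 y))).
  by rewrite ImB; exact: is_deriveB.
by apply/funext => y; rewrite ImB.
Qed.

Lemma rder_shift (p q : R -> R[i]) x c : rder p q (x + c) ->
  rder (fun y => p (y + c)) (fun y => q (y + c)) x.
Proof.
have sh : is_derive x 1 (shift c) (1 : R) by exact: is_derive_shift.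
move=> [r1 i1]; split.
  by have := @is_derive1_comp R _ (shift c) x _ _ r1 sh; rewrite mulr1.
by have := @is_derive1_comp R _ (shift c) x _ _ i1 sh; rewrite mulr1.
Qed.

Lemma rder_linear w x : rder (fun y => y%:C * w) (fun=> w) x.
Proof.
split.
  rewrite (_ : (fun y => _) = (fun y => Re w *: y)).
    by apply: is_derive_eq; rewrite /GRing.scale /= mulr1.
  by apply/funext => y; rewrite ReRM mulrC.
rewrite (_ : (fun y => _) = (fun y => Im w *: y)).
  by apply: is_derive_eq; rewrite /GRing.scale /= mulr1.
by apply/funext => y; rewrite ImRM mulrC.
Qed.

(** The mean value inequality; applying it to both components costs the
    factor 2. *)
Lemma rder_mvt (p q : R -> R[i]) a b M : a <= b ->
  (forall x, a <= x <= b -> rder p q x) ->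
  (forall x, a <= x <= b -> normc (q x) <= M) ->
  normc (p b - p a) <= 2 * M * (b - a).
Proof.
move=> ab pq qM.
have key (f g : R -> R) : (forall x, a <= x <= b -> is_derive x 1 f (g x)) ->
    (forall x, a <= x <= b -> `|g x| <= M) -> `|f b - f a| <= M * (b - a).
  move=> fg gM.
  have hd x : x \in `]a, b[ -> is_derive x 1 f (g x).
    by rewrite in_itv /= => /andP[? ?]; apply: fg; rewrite !ltW.
  have hc : {within `[a, b], continuous f}.
    apply: continuous_in_subspaceT => x; rewrite inE /= in_itv /= => xab.
    apply: differentiable_continuous; apply/derivable1_diffP.
    exact: (@ex_derive _ _ _ _ _ _ _ (fg x xab)).
  have [x] := MVT_segment ab hd hc.
  rewrite in_itv /= => xab ->.
  by rewrite normrM [`|b - a|]ger0_norm ?subr_ge0// ler_wpM2r ?subr_ge0// gM.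
rewrite (le_trans (normc_le_ReIm _))// ReB ImB -mulrA mulr2n mulrDl mul1r lerD//.
  apply: (key (fun x => Re (p x)) (fun x => Re (q x))) => x xab.
    by have [] := pq x xab.
  by apply: le_trans (qM x xab); exact: normr_Re.
apply: (key (fun x => Im (p x)) (fun x => Im (q x))) => x xab.
    by have [] := pq x xab.
  by apply: le_trans (qM x xab); exact: normr_Im.
Qed.

(** The J-th forward difference. *)
Fixpoint dlt J (p : R -> R[i]) x : R[i] :=
  if J is J'.+1 then dlt J' p (x + 1) - dlt J' p x else p x.

Lemma rder_dlt J s x : 0 < x ->
  rder (dlt J (phi s)) (fun y => - s * dlt J (phi (s + 1)) y) x.
Proof.
elim: J x => [|J IH] x x0; first exact: rder_phi.
have x10 : 0 < x + 1 by rewrite ltr_wpDr.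
have := rderB (rder_shift (IH _ x10)) (IH _ x0).
rewrite (_ : (fun y => - s * dlt J (phi (s + 1)) (y + 1) - _) =
  (fun y => - s * dlt J.+1 (phi (s + 1)) y))//.
by apply/funext => y; rewrite /= mulrBr.
Qed.

Lemma normc_phi s x : normc (phi s x) = expR (- Re s * ln x).
Proof. by rewrite /phi normc_rpowc ReN. Qed.

Lemma expR_ln_decr r x y : 0 <= r -> 1 <= x -> x <= y ->
  expR (- r * ln y) <= expR (- r * ln x).
Proof.
move=> r0 x1 xy; have x0 : 0 < x by exact: lt_le_trans x1.
rewrite ler_expR !mulNr lerN2 ler_wpM2l// ler_ln// posrE//.
exact: lt_le_trans xy.
Qed.

(** Each difference gains a power of x by the mean value inequality, at the cost
    of a factor depending only polynomially on s. *)
Lemma dlt_phi_le J s x : 1 <= x -> 0 <= Re s + J%:R ->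
  normc (dlt J (phi s) x) <=
  2 ^+ J * \prod_(i < J) normc (s + i%:R) * expR (- (Re s + J%:R) * ln x).
Proof.
elim: J s x => [|J IH] s x x1 sJ.
  by rewrite big_ord0 expr0 !mul1r addr0 normc_phi.
set M := normc s * (2 ^+ J * \prod_(i < J) normc (s + 1 + i%:R) *
  expR (- (Re s + J.+1%:R) * ln x)).
have pos y : x <= y <= x + 1 -> 1 <= y.
  by move=> /andP[xy _]; exact: le_trans xy.
have ReS : Re (s + 1) + J%:R = Re s + J.+1%:R.
  by rewrite ReD /= -natr1 -addrA [1 + _]addrC.
have h : normc (dlt J (phi s) (x + 1) - dlt J (phi s) x) <= 2 * M * (x + 1 - x).
  apply: (@rder_mvt _ (fun y => - s * dlt J (phi (s + 1)) y)).
  - by rewrite lerDl.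
  - by move=> y /pos y1; apply: rder_dlt; exact: lt_le_trans y1.
  - move=> y yx; have y1 := pos _ yx.
    rewrite normcM normcN /M ler_wpM2l ?normc_ge0//.
    rewrite (le_trans (IH _ _ y1 _)) ?ReS//.
    rewrite ler_wpM2l ?mulr_ge0 ?exprn_ge0 ?prodr_ge0//.
      by move=> i _; exact: normc_ge0.
    by apply: expR_ln_decr => //; case/andP: yx.
rewrite /= (le_trans h)// addrAC subrr add0r mulr1 /M big_ord_recl exprS.
rewrite (_ : \prod_(i < J) normc (s + 1 + i%:R) =
  \prod_(i < J) normc (s + (lift ord0 i)%:R)); last first.
  by apply: eq_bigr => i _; rewrite lift0 -addrA -(natrD _ 1).
by rewrite addr0 le_eqVlt; apply/orP; left; apply/eqP; ring.
Qed.

End ComplexPowers.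

(** * Dirichlet series with bounded coefficients *)
Section DirichletSeries.
Variable R : realType.
Implicit Types (a b x y t r : R) (z w s : R[i]) (n J : nat) (g : nat -> R[i]).

(** (n + 1)^-r: series are indexed from 0, so the n-th term belongs to n + 1. *)
Definition npow r n : R := expR (- r * ln n.+1%:R).

Lemma npow_ge0 r n : 0 <= npow r n. Proof. exact: expR_ge0. Qed.

Lemma npow_le r1 r2 n : r1 <= r2 -> npow r2 n <= npow r1 n.
Proof.
move=> r12; rewrite /npow ler_expR !mulNr lerN2 ler_wpM2r//.
by rewrite ln_ge0// ler1n.
Qed.

Lemma normc_phin s n : normc (phi s n.+1%:R) = npow (Re s) n.
Proof. by rewrite normc_phi. Qed.

(** The mean value theorem for x^(1-r) on [n+1, n+2]; summing over n bounds
    sum n^-r. *)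
Lemma npow_telescope r n : 1 < r ->
  (r - 1) * npow r n.+1 <= npow (r - 1) n - npow (r - 1) n.+1.
Proof.
move=> r1; pose f x := expR (- (r - 1) * ln x).
have x0 x : x \in `[n.+1%:R, n.+2%:R] -> 0 < x.
  by rewrite in_itv /= => /andP[h _]; apply: lt_le_trans h; rewrite ltr0n.
have fd x : x \in `[n.+1%:R, n.+2%:R] -> is_derive x 1 f (- (r - 1) * expR (- r * ln x)).
  move=> /x0 xp.
  have l1 : is_derive x 1 (fun y => - (r - 1) * ln y) (- (r - 1) * x^-1).
    by apply: is_deriveZ; exact: is_derive1_ln.
  have := @is_derive1_comp R expR (fun y => - (r - 1) * ln y) x _ _ (is_derive_expR _) l1.
  move=> h; apply: (is_derive_eq h); rewrite mulrCA; congr (_ * _).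
  by rewrite -{2}[x]lnK ?posrE// -expRN -expRD; congr expR; ring.
have hab : n.+1%:R <= n.+2%:R :> R by rewrite ler_nat.
have hd x : x \in `]n.+1%:R, n.+2%:R[ ->
    is_derive x 1 f (- (r - 1) * expR (- r * ln x)).
  by move=> xab; apply: fd; move: xab; rewrite !in_itv /= => /andP[? ?]; rewrite !ltW.
have hc : {within `[n.+1%:R, n.+2%:R], continuous f}.
  apply: continuous_in_subspaceT => x; rewrite inE /= => xab.
  apply: differentiable_continuous; apply/derivable1_diffP.
  exact: (@ex_derive _ _ _ _ _ _ _ (fd x xab)).
have [c cab e] := MVT_segment hab hd hc.
have -> : npow (r - 1) n - npow (r - 1) n.+1 = (r - 1) * expR (- r * ln c).
  have -> : npow (r - 1) n - npow (r - 1) n.+1 = - (f n.+2%:R - f n.+1%:R).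
    by rewrite opprB.
  by rewrite e -[n.+2%:R]natr1 addrAC subrr add0r mulr1 mulNr opprK.
rewrite ler_wpM2l ?subr_ge0 ?(ltW r1)// /npow.
have c0 := x0 _ cab; move: cab; rewrite in_itv /= => /andP[c1 c2].
apply: expR_ln_decr => //; first by rewrite ltW// (lt_trans ltr01).
by apply: le_trans c1; rewrite ler1n.
Qed.

Lemma npow0 r : npow r 0 = 1. Proof. by rewrite /npow ln1 mulr0 expR0. Qed.

Lemma cvg_npow r : 1 < r -> cvgn (series (npow r)).
Proof.
move=> r1; have r10 : 0 < r - 1 by rewrite subr_gt0.
apply: nondecreasing_is_cvgn.
  by apply/nondecreasing_seqP => n; rewrite /series /= big_nat_recr//= lerDl npow_ge0.
have key n : (r - 1) * \sum_(0 <= k < n) npow r k.+1 <= 1 - npow (r - 1) n.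
  elim: n => [|n IH]; first by rewrite big_geq// mulr0 npow0 subrr.
  rewrite big_nat_recr//= mulrDr (le_trans (lerD IH (npow_telescope _ r1)))//.
  by rewrite addrA subrK.
exists (1 + 1 / (r - 1)) => _ [n _ <-]; rewrite /series /=.
case: n => [|n]; first by rewrite big_geq// addr_ge0// divr_ge0// ltW.
rewrite big_nat_recl// npow0 lerD2l ler_pdivlMr// mulrC.
by rewrite (le_trans (key n))// gerBl npow_ge0.
Qed.

Lemma cvg_npowZ c r : 1 < r -> cvgn (series (fun n => c * npow r n)).
Proof.
move=> r1; rewrite (_ : (fun n => _) = c *: npow r); last by [].
exact: is_cvg_seriesZ (cvg_npow r1).
Qed.

Definition bounded_arith g := exists B : R, forall n, normc (g n) <= B.

Definition Dser g s := csum (fun n => g n.+1 * phi s n.+1%:R).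

Lemma csummable_Dser g s : bounded_arith g -> 1 < Re s ->
  csummable (fun n => g n.+1 * phi s n.+1%:R).
Proof.
move=> [B gB] s1; apply: (@csummable_le _ _ (fun n => B * npow (Re s) n));
    last exact: cvg_npowZ.
move=> n.
by rewrite normcM normc_phin ler_wpM2r ?npow_ge0.
Qed.

Lemma LseriesE (N : nat) (g : 'Z_N -> R[i]) s : (forall x : 'Z_N, normc (g x) <= 1) ->
  1 < Re s -> Lseries g s = Dser (fun n => g n%:R) s.
Proof.
move=> gB s1.
have sm : csummable (fun n => g n.+1%:R * phi s n.+1%:R).
  by apply: (@csummable_Dser (fun n => g n%:R)) s1; exists 1.
have /climP := csummable_cvg sm.
rewrite /Lseries => h; apply: cvg_lim; first exact: norm_hausdorff.
apply/climP => e e0; move/climP: h => /(_ e e0)[n _ hn].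
exists n.+1 => // -[//|k] /= nk; have := hn k nk.
rewrite /series /= (_ : \sum_(1 <= i < k.+1) _ =
  \sum_(0 <= i < k) g i.+1%:R * phi s i.+1%:R)//.
by rewrite big_add1.
Qed.

(** Stretching the coefficients by a factor M multiplies the series by M^-s. *)
Definition stretch M g n := if (M %| n)%N then g (n %/ M)%N else 0.

Lemma stretch_sum M g s K : (0 < M)%N ->
  \sum_(0 <= n < K * M) stretch M g n.+1 * phi s n.+1%:R =
  \sum_(0 <= n < K) g n.+1 * (phi s M%:R * phi s n.+1%:R).
Proof.
move=> M0; elim: K => [|K IH]; first by rewrite mul0n !big_geq.
rewrite mulSn addnC (@big_cat_nat _ _ _ (K * M))//= ?leq_addr// IH big_nat_recr//=.
congr (_ + _).
rewrite -[X in \big[_/_]_(X <= _ < _) _]add0n big_addn addKn.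
case: M M0 {IH} => // M _.
rewrite big_nat_recr//= big1_seq ?add0r; last first.
  move=> i; rewrite mem_index_iota => /andP[_ /andP[_ iM]].
  rewrite /stretch -addSn dvdn_addl ?dvdn_mull// ifN ?mul0r//.
  by rewrite gtnNdvd.
rewrite /stretch -addSn -[X in (X + _)%N]mul1n -mulnDl add1n dvdn_mull// mulnK//.
congr (_ * _); rewrite mulnC natrM /phi rpowcM ?ltr0n//.
Qed.

Lemma bounded_stretch M g : bounded_arith g -> bounded_arith (stretch M g).
Proof.
move=> [B gB]; exists (Num.max B 0) => n; rewrite /stretch.
by case: ifP => _; rewrite ?normc0 le_max ?gB ?lexx ?orbT.
Qed.

Lemma Dser_stretch M g s : (0 < M)%N -> bounded_arith g -> 1 < Re s ->
  Dser (stretch M g) s = phi s M%:R * Dser g s.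
Proof.
move=> M0 gB s1; have sg := csummable_Dser gB s1.
have ss := csummable_Dser (bounded_stretch M gB) s1.
rewrite /Dser -csumZ//.
have sZ := @csummableZ _ (phi s M%:R) _ sg.
apply: (@clim_unique _ _ \oo _ (fun K => series (fun n =>
    phi s M%:R * (g n.+1 * phi s n.+1%:R)) K)); last exact: csummable_cvg.
apply: (@eq_clim _ _ _ _ (fun K => series (fun n => stretch M g n.+1 * phi s n.+1%:R) (K * M)%N)).
  move=> K; rewrite /series /= stretch_sum//; apply: eq_bigr => i _; ring.
move=> e /(csummable_cvg ss)[n _ hn]; exists n => // k /= nk.
by apply: hn => /=; rewrite (leq_trans nk)// leq_pmulr.
Qed.

Lemma dlt_phi_npow J s n : 0 <= Re s + J%:R ->
  normc (dlt J (phi s) n.+1%:R) <=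
  2 ^+ J * \prod_(i < J) normc (s + i%:R) * npow (Re s + J%:R) n.
Proof. by move=> sJ; rewrite dlt_phi_le// ler1n. Qed.

Lemma cdiff_phi x s : cdiff (fun z => phi z x) s.
Proof.
apply: (@cdiff_comp _ (rpowc x) (fun z => - z)); last exact: cdiff_rpowc.
have := cdiffZ (-1) (cdiff_id s); apply: near_cdiff.
by apply/nbhscP; exists 1 => // w _; rewrite mulN1r.
Qed.

Lemma cdiff_dlt_phi J x s : cdiff (fun z => dlt J (phi z) x) s.
Proof.
by elim: J x => [|J IH] x /=; [exact: cdiff_phi|apply: cdiffB; exact: IH].
Qed.

Lemma normc_locally s z r : normc (z - s) < r ->
  Re s - r < Re z /\ normc z <= normc s + r.
Proof.
move=> zs; split.
  have := le_lt_trans (normr_Re _) zs; rewrite ReB ltr_norml => /andP[]; lra.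
have := le_normcD (z - s) s; rewrite subrK; lra.
Qed.

End DirichletSeries.

(** * Continuation of sum_n w^n n^-s for |w| = 1, w <> 1 *)
Section PeriodicZeta.
Variable R : realType.
Variable om : R[i].
Hypotheses (om1 : normc om = 1) (omN1 : om != 1).
Implicit Types (s z : R[i]) (n J : nat).

(** Iterating Abel's summation by parts J times exhibits
    sum_n om^n n^-s as an expression that converges for Re s > 1 - J. *)
Definition abel_u : R[i] := om / (1 - om).

Definition abel_term J s n : R[i] := om ^+ n.+1 * dlt J (phi s) n.+1%:R.

Definition liJ J s : R[i] :=
  \sum_(j < J) abel_u ^+ j.+1 * dlt j (phi s) 1 + abel_u ^+ J * csum (abel_term J s).

Let om_neq0 : om != 0.
Proof. by rewrite -normc_gt0 om1. Qed.

Let om1_neq0 : 1 - om != 0.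
Proof. by rewrite subr_eq0 eq_sym. Qed.

Lemma normc_abel_term J s n : normc (abel_term J s n) = normc (dlt J (phi s) n.+1%:R).
Proof. by rewrite /abel_term normcM normcX om1 expr1n mul1r. Qed.

Lemma csummable_abel J s : 1 < Re s + J%:R -> csummable (abel_term J s).
Proof.
move=> sJ; apply: (@csummable_le _ _ (fun n =>
  2 ^+ J * \prod_(i < J) normc (s + i%:R) * npow (Re s + J%:R) n)).
  move=> n; rewrite normc_abel_term; apply: dlt_phi_npow.
  by rewrite ltW// (lt_trans ltr01).
exact: cvg_npowZ.
Qed.

(** One summation by parts: (1 - w) sum_n w^n a_n is a boundary term plus w times
    sum_n w^n (a_(n+1) - a_n). *)
Lemma liJ_step J s : 1 < Re s + J%:R -> liJ J s = liJ J.+1 s.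
Proof.
move=> sJ; have sm := csummable_abel sJ.
have smS := csummableS sm.
rewrite /liJ big_ord_recr /= -addrA; congr (_ + _).
have -> : csum (abel_term J.+1 s) =
    om^-1 * (csum (abel_term J s) - om * dlt J (phi s) 1) - csum (abel_term J s).
  rewrite [in X in _ * (X - _)](csumS sm).
  rewrite [X in X + csum _ - _](_ : _ = om * dlt J (phi s) 1); last first.
    by rewrite /abel_term expr1.
  rewrite [om * _ + _]addrC addrK -csumZ// -csumB//; last exact: csummableZ.
  apply: eq_csum => n; rewrite /abel_term /= natr1 [om ^+ n.+2]exprS mulrBr.
  by congr (_ - _); rewrite !mulrA mulVf// mul1r.
set T := csum _; set D := dlt _ _ _.
rewrite exprS /abel_u; field.
by rewrite om_neq0 om1_neq0.
Qed.

Lemma liJ_add J k s : 1 < Re s + J%:R -> liJ (J + k)%N s = liJ J s.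
Proof.
move=> sJ; elim: k => [|k <-]; first by rewrite addn0.
rewrite addnS -liJ_step// natrD addrA.
by rewrite (lt_le_trans sJ)// lerDl.
Qed.

Lemma liJ_eq J K s : 1 < Re s + J%:R -> 1 < Re s + K%:R ->
  liJ J s = liJ K s.
Proof.
move=> sJ sK; have [JK|KJ] := leqP J K.
  by rewrite -(subnKC JK) liJ_add.
by rewrite -(subnKC (ltnW KJ)) liJ_add.
Qed.

Lemma cdiff_liJ J s : 1 < Re s + J%:R -> cdiff (liJ J) s.
Proof.
move=> sJ; pose r := (Re s + J%:R - 1) / 2.
have r0 : 0 < r by rewrite divr_gt0// subr_gt0.
apply: cdiffD.
  by apply: cdiff_sum => j; apply: cdiffZ; exact: cdiff_dlt_phi.
apply: cdiffZ.
have rr : 1 < 1 + r by rewrite ltrDl.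
apply: (@cdiff_csum _ (fun n z => abel_term J z n) (fun n => 2 ^+ J *
  \prod_(i < J) (normc s + r + i%:R) * npow (1 + r) n) s r r0).
- by move=> n z _; apply: cdiffZ; exact: cdiff_dlt_phi.
- exact: cvg_npowZ.
- move=> n z /normc_locally[z1 z2]; rewrite normc_abel_term.
  have zJ : 1 + r <= Re z + J%:R by rewrite /r in z1 *; lra.
  rewrite (le_trans (dlt_phi_npow _ _))//; first by rewrite (le_trans _ zJ)// addr_ge0// ltW.
  rewrite ler_pM ?npow_ge0 ?npow_le// ?mulr_ge0 ?exprn_ge0 ?prodr_ge0//.
    by move=> i _; exact: normc_ge0.
  rewrite ler_wpM2l ?exprn_ge0// ler_prod// => i _; rewrite normc_ge0/=.
  by rewrite (le_trans (le_normcD _ _))// normc_nat lerD2r.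
Qed.

(** Any level J with Re s + J > 1 gives the same value; this one always
    qualifies, as -Re s <= |s|. *)
Definition li s : R[i] := liJ (Num.truncn (normc s)).+2 s.

Lemma li_levelP s : 1 < Re s + (Num.truncn (normc s)).+2%:R.
Proof.
have h1 : - Re s <= normc s.
  by rewrite (le_trans _ (normr_Re s))// -normrN ler_norm.
have := truncnS_gt (normc s); rewrite -[_.+2%:R]natr1; lra.
Qed.

Lemma liE J s : 1 < Re s + J%:R -> li s = liJ J s.
Proof. by move=> sJ; apply: liJ_eq => //; exact: li_levelP. Qed.

Lemma cdiff_li s : cdiff li s.
Proof.
have sJ := li_levelP s; set J := _.+2 in sJ.
apply: (near_cdiff _ (cdiff_liJ sJ)).
apply/nbhscP; exists (Re s + J%:R - 1); first by rewrite subr_gt0.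
by move=> z /normc_locally[h _]; rewrite (@liE J)//; lra.
Qed.

Lemma li_Dser s : 1 < Re s -> li s = Dser (fun n => om ^+ n) s.
Proof.
by move=> s1; rewrite (@liE 0) ?addr0// /liJ big_ord0 add0r expr0 mul1r.
Qed.

End PeriodicZeta.

(** * Continuation of the zeta function *)
Section RiemannZeta.
Variable R : realType.
Implicit Types (s z : R[i]) (n : nat) (g : nat -> R[i]).

Definition one_arith (n : nat) : R[i] := 1.

Lemma bounded_one : bounded_arith one_arith.
Proof. by exists 1 => n; rewrite normc1. Qed.

(** The terms of (s - 1) zeta(s) - 1, a first order Euler-Maclaurin correction. *)
Definition zterm s n : R[i] :=
  (s - 1) * phi s n.+1%:R + (phi (s - 1) n.+2%:R - phi (s - 1) n.+1%:R).

Definition zW s : R[i] := 1 + csum (zterm s).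

(** The term is the increment over [n+1, n+2] of x^(1-s) + (s-1) (n+1)^-s x, whose
    derivative (1-s) (x^-s - (n+1)^-s) is small by the mean value inequality. *)
Lemma zterm_le s n : 0 < Re s ->
  normc (zterm s n) <= 4%:R * normc (s - 1) * normc s * npow (Re s + 1) n.
Proof.
move=> s0; set x : R := n.+1%:R.
have x1 : 1 <= x by rewrite ler1n.
have xS : n.+2%:R = x + 1 :> R by rewrite natr1.
have x0 y : x <= y <= x + 1 -> 0 < y.
  by move=> /andP[xy _]; apply: lt_le_trans xy; exact: lt_le_trans x1.
set M := 2 * normc s * npow (Re s + 1) n.
have hM y : x <= y <= x + 1 -> normc (phi s y - phi s x) <= M.
  move=> /andP[xy yx].
  have M0 : 0 <= M by rewrite mulr_ge0 ?mulr_ge0 ?normc_ge0 ?npow_ge0.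
  apply: (@le_trans _ _ (M * (y - x))); last by rewrite ler_piMr//; lra.
  have -> : M * (y - x) = 2 * (normc s * npow (Re s + 1) n) * (y - x).
    by rewrite /M; ring.
  apply: (@rder_mvt _ _ (fun y => - s * phi (s + 1) y)) => // t /andP[xt ty].
    by apply: rder_phi; apply: x0; rewrite xt (le_trans ty).
  rewrite normcM normcN ler_wpM2l ?normc_ge0// normc_phi ReD /=.
  by apply: expR_ln_decr => //; rewrite addr_ge0// ltW.
pose p y : R[i] := phi (s - 1) y - (y%:C * (- (s - 1) * phi s x)).
have sE : s - 1 + 1 = s by rewrite subrK.
have hp : normc (p (x + 1) - p x) <= 2 * (normc (s - 1) * M) * (x + 1 - x).
  apply: (@rder_mvt _ _ (fun y => - (s - 1) * phi (s - 1 + 1) y - (- (s - 1) * phi s x))).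
  - by rewrite lerDl.
  - move=> y yx; apply: rderB; last exact: rder_linear.
    by apply: rder_phi; exact: x0.
  - move=> y yx; rewrite sE -mulrBr normcM normcN ler_wpM2l ?normc_ge0//.
    exact: hM.
have -> : zterm s n = p (x + 1) - p x.
  rewrite /zterm /p xS -/x (rmorphD (real_complex R)) /=; ring.
rewrite (le_trans hp)// /M le_eqVlt; apply/orP; left; apply/eqP; ring.
Qed.

Lemma cdiff_zW s : 0 < Re s -> cdiff zW s.
Proof.
move=> s0; apply: cdiffD; first exact: cdiff_cst.
pose r := Re s / 2; have r0 : 0 < r by rewrite divr_gt0.
have r1 : 1 < r + 1 by rewrite ltrDr.
apply: (@cdiff_csum _ (fun n z => zterm z n) (fun n => 4%:R * (normc s + r + 1) *
  (normc s + r) * npow (r + 1) n) s r r0).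
- move=> n z _; apply: cdiffD.
    by apply: cdiffM; [apply: cdiffB; [exact: cdiff_id|exact: cdiff_cst]|exact: cdiff_phi].
  have h x : cdiff (fun z => phi (z - 1) x) z.
    apply: (@cdiff_comp _ (fun z => phi z x) (fun z => z - 1)).
      by apply: cdiffB; [exact: cdiff_id|exact: cdiff_cst].
    exact: cdiff_phi.
  by apply: cdiffB.
- exact: cvg_npowZ.
- move=> n z /normc_locally[z1 z2].
  have zr : r <= Re z by rewrite /r in z1 *; lra.
  rewrite (le_trans (zterm_le _ _))//; first exact: lt_le_trans zr.
  rewrite ler_pM ?npow_ge0 ?mulr_ge0 ?normc_ge0//; last first.
    by rewrite npow_le// lerD2r.
  rewrite ler_pM ?mulr_ge0 ?normc_ge0// ler_wpM2l//.
  by rewrite (le_trans (le_normcB _ _))// normc1 lerD2r.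
Qed.

(** For Re s > 2 both parts of the terms are summable, and the second one
    telescopes to -1. *)
Lemma zW_Dser2 s : 2 < Re s -> zW s = (s - 1) * Dser one_arith s.
Proof.
move=> s2; have s1 : 1 < Re s by lra.
have ss := csummable_Dser bounded_one s1.
have s1' : 1 < Re (s - 1) by rewrite ReB /=; lra.
have st := csummable_Dser bounded_one s1'.
have e : csum (fun n => one_arith n.+1 * phi (s - 1) n.+1%:R) =
    1 + csum (fun n => one_arith n.+2 * phi (s - 1) n.+2%:R).
  by rewrite csumS// /phi rpowc1l mulr1.
rewrite /zW; have -> : csum (zterm s) = (s - 1) * Dser one_arith s +
    (csum (fun n => one_arith n.+2 * phi (s - 1) n.+2%:R) -
     csum (fun n => one_arith n.+1 * phi (s - 1) n.+1%:R)).
  rewrite /Dser -csumZ// -csumB//; last exact: csummableS st.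
  have sB : csummable (fun n => one_arith n.+2 * phi (s - 1) n.+2%:R -
      one_arith n.+1 * phi (s - 1) n.+1%:R).
    have := csummableD (csummableS st) (@csummableZ _ (-1) _ st).
    by congr csummable; apply/funext => n; rewrite mulN1r.
  rewrite -csumD//; last exact: csummableZ.
  by apply: eq_csum => n; rewrite /zterm /one_arith !mul1r.
by rewrite e; set X := csum _; set Y := Dser _ _; ring.
Qed.

Lemma zW1 : zW 1 = 1.
Proof.
rewrite /zW (_ : csum _ = 0) ?addr0//; apply: csumP.
apply: eq_clim (clim_cst 0) => n; rewrite /series /= big1// => k _.
by rewrite /zterm subrr mul0r add0r /phi oppr0 !rpowc0 subrr.
Qed.

(** The alternating zeta function A(s) = sum (-1)^(n+1) n^-s = D(s) zeta(s), with
    D(s) = 1 - 2^(1-s). *)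
Definition zA s : R[i] := - li (-1) s.
Definition zD s : R[i] := 1 - 2 * phi s 2.

Let N1_norm : normc (-1 : R[i]) = 1.
Proof. by rewrite normcN normc1. Qed.

Let N1_neq1 : -1 != 1 :> R[i].
Proof. by rewrite -subr_eq0 -opprD oppr_eq0 -(natrD _ 1 1) pnatr_eq0. Qed.

Lemma zA_Dser s : 1 < Re s -> zA s = zD s * Dser one_arith s.
Proof.
move=> s1; rewrite /zA li_Dser//.
have b2 := bounded_stretch 2 bounded_one.
have s2 := csummable_Dser b2 s1; have s0 := csummable_Dser bounded_one s1.
rewrite /zD mulrBl mul1r -mulrA -(@Dser_stretch _ 2 one_arith)//; last exact: bounded_one.
have bN : bounded_arith (fun n => (-1 : R[i]) ^+ n).
  by exists 1 => n; rewrite normcX N1_norm expr1n.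
rewrite -[LHS]mulN1r /Dser -csumZ; last exact: csummable_Dser.
rewrite -csumZ// -csumB//; last exact: csummableZ.
apply: eq_csum => n; rewrite /stretch /one_arith mulrA mulrA -mulrBl; congr (_ * _).
rewrite dvdn2 mulN1r -[in LHS]signr_odd; case: (odd n.+1) => /=.
  by rewrite expr1 opprK mulr0 subr0.
by rewrite expr0 mulr1; ring.
Qed.

(** |2^(1-s)| = 1 only for Re s = 1. *)
Lemma zD_neq0 s : Re s != 1 -> zD s != 0.
Proof.
move=> s1; rewrite subr_eq0; apply: contraNneq s1 => e.
have l2 : 0 < ln 2 :> R by rewrite ln_gt0// ltr1n.
have : expR 0 = expR (ln 2 + - Re s * ln 2) :> R.
  rewrite expR0 expRD lnK ?posrE// -normc_phi.
  by have := congr1 (@normc R) e; rewrite normc1 normcM normc_nat.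
move=> /expR_inj h.
have : (1 - Re s) * ln 2 = 0 by rewrite h; ring.
by move/eqP; rewrite mulf_eq0 (gt_eqF l2) orbF subr_eq0 eq_sym.
Qed.

Lemma cdiff_zA s : cdiff zA s.
Proof.
have := cdiffZ (-1) (cdiff_li N1_norm N1_neq1 s); apply: near_cdiff.
by apply/nbhscP; exists 1 => // w _; rewrite mulN1r.
Qed.

Lemma cdiff_zD s : cdiff zD s.
Proof. by apply: cdiffB; [exact: cdiff_cst|apply: cdiffZ; exact: cdiff_phi]. Qed.

Lemma zW_zD s : 0 < Re s -> zW s * zD s = (s - 1) * zA s.
Proof.
move=> s0; apply/eqP; rewrite -subr_eq0; apply/eqP; move: s s0.
apply: (@identity_halfplane _ (fun s => zW s * zD s - (s - 1) * zA s) 0 2).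
  move=> z z0; apply: cdiffB; first by apply: cdiffM; [exact: cdiff_zW|exact: cdiff_zD].
  apply: cdiffM; last exact: cdiff_zA.
  by apply: cdiffB; [exact: cdiff_id|exact: cdiff_cst].
move=> z z2; rewrite zW_Dser2// zA_Dser; last lra.
by ring.
Qed.

(** The continuation of zeta: W(s)/(s - 1) is holomorphic near Re s >= 1/2 except
    for the pole, and A(s)/D(s) away from the line Re s = 1 where D vanishes. *)
Definition zetaC s : R[i] :=
  if 2^-1 < Re s then zW s / (s - 1) else zA s / zD s.

Lemma zetaC_W s : 0 < Re s -> s != 1 -> zetaC s = zW s / (s - 1).
Proof.
move=> s0 s1; rewrite /zetaC; case: ltP => // s2.
have d0 : zD s != 0 by apply: zD_neq0; rewrite lt_eqF//; lra.
have s10 : s - 1 != 0 by rewrite subr_eq0.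
by apply/eqP; rewrite eqr_div// zW_zD// mulrC.
Qed.

Lemma zetaC_A s : Re s < 1 -> zetaC s = zA s / zD s.
Proof.
move=> s1; rewrite /zetaC; case: ltP => // s2.
have d0 : zD s != 0 by apply: zD_neq0; rewrite lt_eqF//; lra.
have s10 : s - 1 != 0.
  by rewrite subr_eq0; apply: contraTneq s1 => ->; rewrite ltxx.
apply/eqP; rewrite eqr_div// zW_zD; last lra.
by rewrite mulrC.
Qed.

Lemma cdiff_zetaC s : s != 1 -> cdiff zetaC s.
Proof.
move=> s1; have [sh|sh] := ltP (Re s) 2^-1.
  have : cdiff (fun z => zA z / zD z) s.
    apply: cdiffM; first exact: cdiff_zA.
    by apply: cdiffV; [apply: zD_neq0; rewrite lt_eqF//; lra|exact: cdiff_zD].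
  apply: near_cdiff; apply/nbhscP; exists 2^-1 => [|z zs]; first by rewrite invr_gt0.
  rewrite zetaC_A//; have := le_lt_trans (normr_Re _) zs.
  by rewrite ReB ltr_norml => /andP[]; lra.
have s10 : s - 1 != 0 by rewrite subr_eq0.
have : cdiff (fun z => zW z / (z - 1)) s.
  apply: cdiffM; first by apply: cdiff_zW; lra.
  apply: cdiffV => //.
  by apply: cdiffB; [exact: cdiff_id|exact: cdiff_cst].
apply: near_cdiff; apply/nbhscP.
exists (Num.min 2^-1 (normc (s - 1))).
  by rewrite lt_min invr_gt0 normc_gt0 s10 ltr0n.
move=> z; rewrite lt_min => /andP[zs z1]; rewrite zetaC_W//.
  have := le_lt_trans (normr_Re _) zs; rewrite ReB ltr_norml => /andP[]; lra.
by apply: contraTneq z1 => ->; rewrite normc_distC ltxx.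
Qed.

Lemma zetaC_Dser s : 1 < Re s -> zetaC s = Dser one_arith s.
Proof.
move=> s1; have d0 : zD s != 0 by apply: zD_neq0; rewrite gt_eqF.
have s11 : s != 1 by apply: contraTneq s1 => ->; rewrite ltxx.
have s10 : s - 1 != 0 by rewrite subr_eq0.
have sp : 0 < Re s by exact: lt_trans s1.
rewrite zetaC_W//; apply: (mulIf d0); rewrite mulrAC zW_zD// mulrAC divff// mul1r.
by rewrite zA_Dser// mulrC.
Qed.

End RiemannZeta.

(** * Roots of unity and the Fourier transform modulo N *)
Section RootsOfUnity.
Variable R : realType.
Implicit Types (t x y : R) (n N j : nat).

(** e(x) = exp (2 pi i x). *)
Definition ex x : R[i] := cexp (0 +i* (2 * pi * x)).

Lemma exD x y : ex (x + y) = ex x * ex y.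
Proof.
rewrite /ex -cexpD; congr cexp; apply: complex_ext => /=; last ring.
by rewrite addr0.
Qed.

Lemma ex0 : ex 0 = 1.
Proof. by rewrite /ex mulr0 cexp0. Qed.

Lemma exN x : ex (- x) = (ex x)^-1.
Proof.
rewrite /ex -cexpN; congr cexp; apply: complex_ext => /=; last ring.
by rewrite oppr0.
Qed.

Lemma ex_natM n x : ex (n%:R * x) = ex x ^+ n.
Proof.
elim: n => [|n IH]; first by rewrite mul0r ex0.
by rewrite -natr1 mulrDl mul1r exD IH exprSr.
Qed.

Lemma exE x : ex x = cos (2 * pi * x) +i* sin (2 * pi * x).
Proof. by rewrite /ex /cexp /= expR0 mul1r. Qed.

Lemma ex1 : ex 1 = 1.
Proof.
by rewrite exE mulr1 mulrC mulr_natr cos2pi sin2pi.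
Qed.

Lemma ex_nat n : ex n%:R = 1.
Proof. by have := ex_natM n 1; rewrite mulr1 ex1 expr1n. Qed.

Lemma normc_ex x : normc (ex x) = 1.
Proof. by rewrite normc_cexp /= expR0. Qed.

Lemma ex_neq0 x : ex x != 0.
Proof. exact: cexp_neq0. Qed.

Lemma conj_ex x : (ex x)^* = ex (- x).
Proof. by rewrite !exE /= mulrN cosN sinN. Qed.

(** sin t = 2 sin(t/2) cos(t/2) and sin(t/2) = (t/2) cos c with c <= t/2, where
    both cosines are at least sqrt(1/2) as t/2 <= pi/4. *)
Lemma sin_ge_half t : 0 <= t <= pi / 2 -> t / 2 <= sin t.
Proof.
move=> /andP[t0 tp].
have cos_half c : 0 <= c <= t / 2 -> 0 <= cos c /\ 1 <= 2 * cos c ^+ 2.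
  move=> /andP[c0 ct]; split.
    by apply: cos_ge0_pihalf; apply/andP; split; lra.
  have : 0 <= cos (c *+ 2).
    by apply: cos_ge0_pihalf; rewrite -mulr_natr; apply/andP; split; lra.
  by rewrite cos_mulr2n -mulr_natr; lra.
have [c ct e] : exists2 c, 0 <= c <= t / 2 & sin (t / 2) = cos c * (t / 2).
  have h0 : 0 <= t / 2 by rewrite divr_ge0.
  have hd x : x \in `]0, t / 2[ -> is_derive x 1 sin (cos x) by move=> _; exact: is_derive_sin.
  have hc : {within `[0, t / 2], continuous (@sin R)}.
    by apply: continuous_in_subspaceT => x _; exact: continuous_sin.
  have [c] := MVT_segment h0 hd hc.
  by rewrite in_itv /= sin0 !subr0 => cc ec; exists c.
have tE : t = (t / 2) *+ 2 by rewrite -mulr_natr; field.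
have [c1 c2] := cos_half c ct.
have [d1 d2] : 0 <= cos (t / 2) /\ 1 <= 2 * cos (t / 2) ^+ 2.
  by apply: cos_half; rewrite lexx andbT divr_ge0.
have cd : 1 <= 2 * (cos (t / 2) * cos c).
  have : 1 <= (2 * (cos (t / 2) * cos c)) ^+ 2.
    have -> : (2 * (cos (t / 2) * cos c)) ^+ 2 =
      (2 * cos (t / 2) ^+ 2) * (2 * cos c ^+ 2) by ring.
    by rewrite mulr_ege1.
  by rewrite expr_ge1// !mulr_ge0.
have sE : sin t = (2 * (cos (t / 2) * cos c)) * (t / 2).
  by rewrite {1}tE sin_mulr2n e; ring.
by rewrite sE ler_peMl// divr_ge0.
Qed.

(** |e(y) - 1| = 2 |sin (pi y)|. *)
Lemma ex_dist y : `|y| <= 2^-1 -> `|y| <= normc (ex y - 1).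
Proof.
move=> y2.
have nE : normc (ex y - 1) ^+ 2 = (2 * sin (pi * `|y|)) ^+ 2.
  have -> : (2 * sin (pi * `|y|)) ^+ 2 = (2 * sin (pi * y)) ^+ 2.
    have [y0|y0] := ger0P y; first by [].
    by rewrite mulrN sinN mulrN sqrrN.
  rewrite sqr_normcE ReB ImB exE /= subr0.
  have -> : 2 * pi * y = (pi * y) *+ 2 by rewrite -mulr_natr; ring.
  rewrite cos_mulr2n sin_mulr2n !mulr2n.
  have := cos2Dsin2 (pi * y); set c := cos _; set s := sin _ => cs.
  have -> : (c * s + c * s) ^+ 2 = 4%:R * c ^+ 2 * s ^+ 2 by ring.
  have -> : (2 * s) ^+ 2 = 4%:R * s ^+ 2 by ring.
  have -> : s ^+ 2 = 1 - c ^+ 2 by rewrite -cs addrAC subrr add0r.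
  ring.
have pi0 : 0 < pi :> R by exact: pi_gt0.
have ys : pi * `|y| / 2 <= sin (pi * `|y|).
  apply: sin_ge_half; rewrite mulr_ge0 ?(ltW pi0)//= ler_pM2l//.
have p2 := pi_ge2 R.
have y0 : 0 <= `|y| by [].
have sy : `|y| <= 2 * sin (pi * `|y|) by nra.
rewrite (le_trans sy)//.
by rewrite -(@ler_pXn2r _ 2)// ?nnegrE ?normc_ge0 ?nE// (le_trans y0).
Qed.

Lemma ex_neq1 x : 0 < x -> x < 1 -> ex x != 1.
Proof.
move=> x0 x1; rewrite -subr_eq0 -normc_gt0.
have [x2|x2] := lerP x 2^-1.
  apply: lt_le_trans (ex_dist _); first by rewrite normr_gt0 gt_eqF.
  by rewrite gtr0_norm.
have -> : ex x = ex (x - 1) by rewrite exD exN ex1 invr1 mulr1.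
apply: lt_le_trans (ex_dist _); first by rewrite normr_gt0 subr_eq0 lt_eqF.
by rewrite ltr0_norm ?subr_lt0//; lra.
Qed.

Definition om N j : R[i] := ex (- (j%:R / N%:R)).

Lemma normc_om N j : normc (om N j) = 1. Proof. exact: normc_ex. Qed.

Lemma om_neq1 N j : (0 < j < N)%N -> om N j != 1.
Proof.
move=> /andP[j0 jN]; have N0 : (0 < N)%N by exact: ltn_trans jN.
rewrite /om exN invr_eq1; apply: ex_neq1.
  by rewrite divr_gt0 ?ltr0n.
by rewrite ltr_pdivrMr ?ltr0n// mul1r ltr_nat.
Qed.

(** The additive Fourier transform sum_r g(r) e(jr/N). *)
Definition fhat N (g : nat -> R[i]) j : R[i] :=
  \sum_(r < N) g r * ex ((j * r)%:R / N%:R).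

Lemma sum_roots N (k l : nat) : (k < N)%N -> (l < N)%N ->
  \sum_(j < N) ex ((j * k)%:R / N%:R) * ex (- ((j * l)%:R / N%:R)) =
  if k == l then N%:R else 0 :> R[i].
Proof.
move=> kN lN; have N0 : (0 < N)%N by exact: leq_ltn_trans kN.
have Nn0 : N%:R != 0 :> R by rewrite pnatr_eq0 -lt0n.
pose q := ex ((k%:R - l%:R) / N%:R).
have qE (j : 'I_N) : ex ((j * k)%:R / N%:R) * ex (- ((j * l)%:R / N%:R)) = q ^+ j.
  rewrite -exD -ex_natM; congr ex; rewrite !natrM; ring.
rewrite (eq_bigr (fun j : 'I_N => q ^+ j)) => [|j _]; last exact: qE.
case: eqP => [kl|kl].
  rewrite /q kl subrr mul0r ex0 (eq_bigr (fun=> 1)) => [|i _]; last exact: expr1n.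
  by rewrite sumr_const card_ord.
have qN : q ^+ N = 1.
  rewrite -ex_natM mulrC divfK// exD exN !ex_nat invr1 mulr1//.
have q1 : q != 1.
  have [lk|kl'|/eqP] := ltngtP l k.
  - apply: ex_neq1; first by rewrite divr_gt0 ?ltr0n// subr_gt0 ltr_nat.
    rewrite ltr_pdivrMr ?ltr0n// mul1r ltrBlDr.
    by rewrite (@lt_le_trans _ _ N%:R) ?ltr_nat// lerDl.
  - rewrite -[q]invrK invr_eq1 -exN -mulNr opprB.
    apply: ex_neq1; first by rewrite divr_gt0 ?ltr0n// subr_gt0 ltr_nat.
    rewrite ltr_pdivrMr ?ltr0n// mul1r ltrBlDr.
    by rewrite (@lt_le_trans _ _ N%:R) ?ltr_nat// lerDl.
  - by move=> /eqP e; case: kl.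
have := subrX1 q N; rewrite qN subrr => /esym/eqP.
by rewrite mulf_eq0 subr_eq0 (negbTE q1) /= => /eqP.
Qed.

Lemma ex_period N (r n : nat) : (0 < N)%N ->
  ex (- ((r * (n %% N))%:R / N%:R)) = ex (- ((r * n)%:R / N%:R)).
Proof.
move=> N0; have Nn0 : N%:R != 0 :> R by rewrite pnatr_eq0 -lt0n.
rewrite [in RHS](divn_eq n N) mulnDr mulnA !natrD !natrM mulrDl opprD exD.
by rewrite mulfK// -[r%:R * (n %/ N)%:R]natrM (exN (_ * _)%:R) ex_nat invr1 mul1r.
Qed.

Lemma fourier_inversion N (g : nat -> R[i]) n : (0 < N)%N ->
  (forall n, g (n %% N)%N = g n) ->
  g n = N%:R^-1 * \sum_(j < N) fhat N g j * om N j ^+ n.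
Proof.
move=> N0 gN; have Nn0 : N%:R != 0 :> R[i] by rewrite pnatr_eq0 -lt0n.
have omE (j : 'I_N) : om N j ^+ n = ex (- ((j * (n %% N))%:R / N%:R)).
  rewrite ex_period// /om -ex_natM; congr ex; rewrite natrM; ring.
under eq_bigr => j _ do rewrite omE /fhat mulr_suml.
rewrite exchange_big /=.
have nN : (n %% N < N)%N by rewrite ltn_pmod.
under eq_bigr => r _.
  under eq_bigr => j _ do rewrite -mulrA.
  rewrite -mulr_sumr sum_roots//.
over.
rewrite (bigD1 (Ordinal nN))//= eqxx big1 ?addr0 => [|r rn].
  by rewrite gN mulrCA mulVf// mulr1.
by rewrite ifN ?mulr0.
Qed.

End RootsOfUnity.

(** * Continuation of L(s, g) for periodic g *)
Section PeriodicContinuation.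
Variable R : realType.
Implicit Types (s z : R[i]) (n N j : nat) (g : nat -> R[i]).

(** L(s, g) for N-periodic g, by Fourier inversion on the coefficients: the zero
    frequency contributes zeta, and the other ones the series that extend to the
    whole plane. *)
Definition perE N g s : R[i] := N%:R^-1 * (fhat N g 0 * zetaC s +
  \sum_(j < N.-1) fhat N g j.+1 * li (om R N j.+1) s).

Lemma om_ok N (j : 'I_N.-1) : om R N j.+1 != 1.
Proof. by apply: om_neq1; case: N j => [[]//|N] j; rewrite /= ltnS. Qed.

Lemma cdiff_perE N g s : s != 1 -> cdiff (perE N g) s.
Proof.
move=> s1; apply: cdiffZ; apply: cdiffD; first by apply: cdiffZ; exact: cdiff_zetaC.
by apply: cdiff_sum => j; apply: cdiffZ; apply: cdiff_li; [exact: normc_om|exact: om_ok].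
Qed.

Lemma bounded_pow (w : R[i]) : normc w = 1 -> bounded_arith (fun n => w ^+ n).
Proof. by move=> w1; exists 1 => n; rewrite normcX w1 expr1n. Qed.

Lemma perE_Dser N g s : (0 < N)%N -> (forall n, g (n %% N)%N = g n) ->
  1 < Re s -> perE N g s = Dser g s.
Proof.
move=> N0 gN s1; rewrite /perE zetaC_Dser//.
under eq_bigr => j _ do rewrite li_Dser ?normc_om ?om_ok//.
have so (j : nat) : csummable (fun n => om R N j ^+ n.+1 * phi s n.+1%:R).
  by apply: (@csummable_Dser _ (fun n => om R N j ^+ n)) s1; exact: bounded_pow (normc_om _ _ _).
have -> : Dser (@one_arith R) s = Dser (fun n => om R N 0 ^+ n) s.
  by apply: eq_csum => n; rewrite /om mul0r oppr0 ex0 expr1n.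
transitivity (N%:R^-1 * \sum_(j < N) fhat N g j * Dser (fun n => om R N j ^+ n) s).
  by case: N N0 {gN so} => // N _; rewrite big_ord_recl.
have sj (j : 'I_N) : csummable (fun n => fhat N g j * (om R N j ^+ n.+1 * phi s n.+1%:R)).
  exact: csummableZ.
under eq_bigr => j _ do rewrite /Dser -csumZ//.
rewrite -csum_sum// -csumZ; last exact: csummable_sum.
apply: eq_csum => n; rewrite (@fourier_inversion _ N g n.+1)// -mulrA mulr_suml.
by congr (_ * _); apply: eq_bigr => j _; rewrite mulrA.
Qed.

(** (s - 1) perE(s), which is holomorphic at 1 as well. *)
Definition perW N g s : R[i] := N%:R^-1 * (fhat N g 0 * zW s +
  (s - 1) * \sum_(j < N.-1) fhat N g j.+1 * li (om R N j.+1) s).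

Lemma perW_E N g s : 0 < Re s -> s != 1 -> perW N g s = (s - 1) * perE N g s.
Proof.
move=> s0 s1; have s10 : s - 1 != 0 by rewrite subr_eq0.
rewrite /perW /perE zetaC_W//; set X := \sum_(j < _) _; set W := zW s.
set F := fhat _ _ _; set M := _^-1; field; by rewrite s10.
Qed.

Lemma cdiff_perW N g s : 0 < Re s -> cdiff (perW N g) s.
Proof.
move=> s0; apply: cdiffZ; apply: cdiffD; first by apply: cdiffZ; exact: cdiff_zW.
apply: cdiffM; first by apply: cdiffB; [exact: cdiff_id|exact: cdiff_cst].
by apply: cdiff_sum => j; apply: cdiffZ; apply: cdiff_li; [exact: normc_om|exact: om_ok].
Qed.

Lemma holomorphic_atP (F : R[i] -> R[i]) z : holomorphic_at F z <->
  exists2 d : R, 0 < d & forall w, normc (w - z) < d -> cdiff F w.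
Proof.
split=> [/nbhscP[d d0 h]|[d d0 h]].
  by exists d => // w /h/derivable_cderP.
by apply/nbhscP; exists d => // w /h/derivable_cderP.
Qed.

Section Character.
Variables (N : nat) (g : 'Z_N -> R[i]).
Hypotheses (hN : (1 < N)%N) (gB : forall x : 'Z_N, normc (g x) <= 1).

Definition lift_arith n : R[i] := g n%:R.

Lemma lift_periodic n : lift_arith (n %% N)%N = lift_arith n.
Proof.
rewrite /lift_arith; congr g; apply/val_inj => /=.
by rewrite !val_Zp_nat// modn_mod.
Qed.

Lemma bounded_lift : bounded_arith lift_arith.
Proof. by exists 1 => n; exact: gB. Qed.

Lemma perE_continuation : is_Lcontinuation g (perE N lift_arith).
Proof.
have N0 : (0 < N)%N by exact: ltnW.
have hol z : z != 1 -> holomorphic_at (perE N lift_arith) z.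
  move=> z1; apply/holomorphic_atP; exists (normc (z - 1)).
    by rewrite normc_gt0 subr_eq0.
  move=> w wz; apply: cdiff_perE; apply: contraTneq wz => ->.
  by rewrite normc_distC ltxx.
split=> //.
  move=> z; have [->|z1] := eqVneq z 1.
    exists 1%N; exists (perW N lift_arith).
      apply/holomorphic_atP; exists 1 => // w w1; apply: cdiff_perW.
      have := le_lt_trans (normr_Re _) w1; rewrite ReB ltr_norml /= => /andP[]; lra.
    apply/dnbhscP; exists 1 => // w wN1 w1; rewrite expr1 perW_E//.
    have := le_lt_trans (normr_Re _) w1; rewrite ReB ltr_norml /= => /andP[]; lra.
  exists 0%N; exists (perE N lift_arith); first exact: hol.
  by apply/dnbhscP; exists 1 => // w _ _; rewrite expr0 mul1r.
move=> s s1; rewrite LseriesE// perE_Dser//; exact: lift_periodic.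
Qed.

Lemma dirichlet_LE z : z != 1 -> dirichlet_L g z = perE N lift_arith z.
Proof.
have [_ H1 H2] : is_Lcontinuation g (dirichlet_L g).
  have ex : exists F, is_Lcontinuation g F.
    by exists (perE N lift_arith); exact: perE_continuation.
  exact: (@xgetPex _ (fun=> 0) [set F | is_Lcontinuation g F] ex).
have [_ _ H4] := perE_continuation.
move=> z1; apply/eqP; rewrite -subr_eq0; apply/eqP.
apply: (@identity_punctured _ (fun z => dirichlet_L g z - perE N lift_arith z)) z1.
  move=> w w1; apply: cdiffB; last exact: cdiff_perE.
  have /holomorphic_atP[d d0] := H1 w w1; apply; by rewrite subrr normc0.
by move=> w w1; rewrite H2// H4// subrr.
Qed.

Lemma dirichlet_L_Dser s : 1 < Re s -> dirichlet_L g s = Dser lift_arith s.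
Proof.
move=> s1; rewrite dirichlet_LE ?perE_Dser//.
- exact: ltnW.
- exact: lift_periodic.
- by apply: contraTneq s1 => ->; rewrite ltxx.
Qed.

(** The residue of L(s, g) at 1 is the mean value of g: (s - 1) L(s, g) tends to
    perW at 1 on the one hand, and to 0 on the other hand. *)
Lemma holomorphic_mean0 : mero_holomorphic_at (dirichlet_L g) 1 ->
  fhat N lift_arith 0 = 0.
Proof.
move=> [G /holomorphic_atP[d d0 Gd] /dnbhscP[d' d'0 FG]].
have G1 : cdiff G 1 by apply: Gd; rewrite subrr normc0.
have e : perW N lift_arith 1 = N%:R^-1 * fhat N lift_arith 0.
  by rewrite /perW zW1 subrr mul0r addr0 mulr1.
have N0 : N%:R^-1 != 0 :> R[i].
  by rewrite invr_eq0 pnatr_eq0 -lt0n ltnW.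
suff : perW N lift_arith 1 = 0.
  by rewrite e => /eqP; rewrite mulf_eq0 (negbTE N0) /= => /eqP.
have c1 : cnear (perW N lift_arith) 1 by apply: cdiff_cont; exact: cdiff_perW.
have c2 : cnear (fun s => (s - 1) * G s) 1.
  apply: cdiff_cont; apply: cdiffM => //.
  by apply: cdiffB; [exact: cdiff_id|exact: cdiff_cst].
have : cnear (fun s => perW N lift_arith s - (s - 1) * G s) 1 by apply: climB.
move=> c3; have -> : perW N lift_arith 1 = perW N lift_arith 1 - (1 - 1) * G 1.
  by rewrite subrr mul0r subr0.
apply/eqP; rewrite -normc_eq0 eq_le normc_ge0 andbT.
apply/ler_addgt0Pr => e' e'0; rewrite add0r.
have /nbhscP[r r0 hr] := c3 e' e'0.
(* a point 1 + t close to 1 where both descriptions of L(s, g) apply *)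
pose t := Num.min (Num.min r d') 1 / 2.
have m0 : 0 < Num.min (Num.min r d') 1 by rewrite !lt_min r0 d'0 ltr01.
have t0 : 0 < t by rewrite divr_gt0.
have t1 : t < Num.min (Num.min r d') 1 by rewrite /t; lra.
move: t1; rewrite !lt_min => /andP[/andP[tr td'] t1].
have w1 : normc (1 + t%:C - 1) = t by rewrite addrAC subrr add0r normcR gtr0_norm.
have wN1 : 1 + t%:C != 1.
  by rewrite -subr_eq0 -normc_eq0 w1 gt_eqF.
have := hr (1 + t%:C); rewrite w1 => /(_ tr).
have -> : perW N lift_arith (1 + t%:C) - (1 + t%:C - 1) * G (1 + t%:C) = 0.
  rewrite perW_E//; last by rewrite ReD /= addr_gt0.
  by rewrite -dirichlet_LE// FG ?w1// subrr.
by rewrite sub0r normcN => /ltW.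
Qed.

End Character.
End PeriodicContinuation.

(** * Values of L(s, g) at the negative integers *)
Section NegativeIntegers.
Variable R : realType.
Implicit Types (s z : R[i]) (x y t : R) (n N M K J j : nat) (g : nat -> R[i]).

Definition pw K x : R[i] := (x ^+ K)%:C.

Lemma dlt_ext J (p q : R -> R[i]) x : 0 < x -> (forall y, 0 < y -> p y = q y) ->
  dlt J p x = dlt J q x.
Proof.
move=> x0 pq; elim: J x x0 => [|J IH] x x0 /=; first exact: pq.
by rewrite !IH// ltr_wpDr.
Qed.

Lemma dlt_mulX J (f : R -> R[i]) x :
  dlt J (fun y => y%:C * f y) x = x%:C * dlt J f x + J%:R * dlt J.-1 f (x + 1).
Proof.
elim: J x => [|J IH] x /=; first by rewrite mul0r addr0.
rewrite !IH (rmorphD (real_complex R)) /= -natr1.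
case: J {IH} => [|J] /=; last ring.
by rewrite !mul0r; ring.
Qed.

Lemma pwS K : pw K.+1 = fun y => y%:C * pw K y.
Proof. by apply/funext => y; rewrite /pw exprS (rmorphM (real_complex R)). Qed.

(** Differences of polynomials of degree K. *)
Lemma dlt_pw K : (forall J x, (K < J)%N -> dlt J (pw K) x = 0) /\
  (forall x, dlt K (pw K) x = (K`!)%:R).
Proof.
elim: K => [|K [IH1 IH2]].
  split=> [J x|x]; last by rewrite /pw /= expr0.
  elim: J x => // -[|J] IH x _; first by rewrite /pw /= !expr0 subrr.
  by rewrite /= -/(dlt J.+1 _ _) -/(dlt J.+1 (pw 0) x) !IH// subrr.
split=> [J x KJ|x]; rewrite pwS dlt_mulX.
  case: J KJ => // J KJ; rewrite IH1 ?(ltnW KJ)// mulr0 add0r /=.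
  by rewrite IH1// mulr0.
by rewrite IH1// mulr0 add0r /= IH2 -natrM factS.
Qed.

Lemma phi_negnat K x : 0 < x -> phi (- K%:R) x = pw K x.
Proof. by move=> x0; rewrite /phi opprK rpowc_nat. Qed.

Definition licoef K j : R[i] := dlt j (pw K) 1.

Definition lipoly K (u : R[i]) := \sum_(j < K.+1) licoef K j * u ^+ j.+1.

(** At s = -K the summation by parts terminates: sum_n w^n n^K is a polynomial of
    degree K + 1 in w / (1 - w), with leading coefficient K!. *)
Lemma li_negnat (w : R[i]) K : normc w = 1 -> w != 1 ->
  li w (- K%:R) = lipoly K (abel_u w).
Proof.
move=> w1 wN1.
have lev : 1 < Re (- K%:R : R[i]) + K.+2%:R.
  by rewrite ReN Re_nat -[K.+2%:R]natr1 -[K.+1%:R]natr1; lra.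
rewrite (liE w1 wN1 lev) /liJ [X in _ + _ * X](_ : _ = 0) ?mulr0 ?addr0; last first.
  apply: csumP; apply: eq_clim (clim_cst 0) => n; rewrite /series /= big1// => k _.
  rewrite /abel_term (@dlt_ext _ _ (pw K)) ?ltr0n//; last exact: phi_negnat.
  by rewrite (dlt_pw K).1 ?mulr0.
rewrite big_ord_recr /= -/(dlt K.+1 (phi (- K%:R)) 1).
rewrite (@dlt_ext K.+1 _ (pw K))//; last exact: phi_negnat.
rewrite (dlt_pw K).1// mulr0 addr0; apply: eq_bigr => j _.
by rewrite mulrC /licoef (@dlt_ext _ _ (pw K))//; exact: phi_negnat.
Qed.

Lemma abel_u_ex y : ex y != 1 -> abel_u (ex (- y)) = (ex y - 1)^-1.
Proof.
move=> y1; rewrite /abel_u exN.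
have h1 : ex y != 0 :> R[i] by exact: ex_neq0.
have h2 : ex y - 1 != 0 :> R[i] by rewrite subr_eq0.
by field; rewrite h1 h2.
Qed.

(** M^-(K+1) times the polynomial above at the root of unity e(-y/M) is
    written in terms of U = M^-1 / (e(y/M) - 1), which converges as M grows. *)
Definition Ufun M y : R[i] := M%:R^-1 * (ex (y / M%:R) - 1)^-1.

Definition Qfun K M y : R[i] :=
  \sum_(i < K.+1) licoef K i * (Ufun M y ^+ i.+1 * (M%:R^-1) ^+ (K - i)).

Lemma Qfun_lipoly K M y : (0 < M)%N ->
  Qfun K M y = (M%:R^-1) ^+ K.+1 * lipoly K (ex (y / M%:R) - 1)^-1.
Proof.
move=> M0; rewrite /Qfun /lipoly mulr_sumr; apply: eq_bigr => i _.
rewrite /Ufun exprMn.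
have -> : (M%:R^-1 : R[i]) ^+ K.+1 = M%:R^-1 ^+ i.+1 * M%:R^-1 ^+ (K - i).
  by rewrite -exprD addSn subnKC// -ltnS.
by ring.
Qed.

Lemma normc_natV M : normc (M%:R^-1 : R[i]) = M%:R^-1.
Proof. by rewrite normcV normc_nat. Qed.

Lemma Ufun_le M y : (0 < M)%N -> y != 0 -> `|y| <= M%:R / 2 -> normc (Ufun M y) <= `|y|^-1.
Proof.
move=> M0 y0 yM; have Mp : 0 < M%:R :> R by rewrite ltr0n.
have ny : 0 < `|y| by rewrite normr_gt0.
rewrite /Ufun normcM normc_natV normcV -invfM lef_pV2 ?posrE//; last first.
  rewrite mulr_gt0//; apply: lt_le_trans (ex_dist _).
    by rewrite normr_gt0 mulf_neq0// invr_neq0// pnatr_eq0 -lt0n.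
  by rewrite normrM normfV (gtr0_norm Mp) ler_pdivrMr// mulrC.
rewrite mulrC -ler_pdivrMr//.
have -> : `|y| / M%:R = `|y / M%:R| by rewrite normrM normfV (gtr0_norm Mp).
by apply: ex_dist; rewrite normrM normfV (gtr0_norm Mp) ler_pdivrMr// mulrC.
Qed.

Lemma Qfun_le K M y : (0 < M)%N -> y != 0 -> `|y| <= M%:R / 2 ->
  normc (Qfun K M y) <= (\sum_(i < K.+1) normc (licoef K i)) * `|y|^-1 ^+ K.+1.
Proof.
move=> M0 y0 yM; have ny : 0 < `|y| by rewrite normr_gt0.
have Mp : 0 < M%:R :> R by rewrite ltr0n.
have My : M%:R^-1 <= `|y|^-1 :> R by rewrite lef_pV2 ?posrE//; lra.
rewrite (le_trans (normc_sum _ _ _))// mulr_suml; apply: ler_sum => i _.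
rewrite normcM ler_wpM2l ?normc_ge0// normcM !normcX normc_natV.
have -> : `|y|^-1 ^+ K.+1 = `|y|^-1 ^+ i.+1 * `|y|^-1 ^+ (K - i).
  by rewrite -exprD addSn subnKC// -ltnS.
rewrite ler_pM ?exprn_ge0 ?normc_ge0 ?invr_ge0//.
  by rewrite lerXn2r ?nnegrE ?normc_ge0 ?invr_ge0//; exact: Ufun_le.
by rewrite lerXn2r ?nnegrE ?invr_ge0.
Qed.

Definition twopii : R[i] := 0 +i* (2 * pi).

Lemma twopii_neq0 : twopii != 0.
Proof.
by rewrite eq_complex /= negb_and mulf_neq0 ?orbT// gt_eqF// pi_gt0.
Qed.

Lemma clim_natV : clim \oo (fun M => M.+1%:R^-1 : R[i]) 0.
Proof.
move=> e e0; have /cvgrPdist_lt/(_ e e0) := @cvg_harmonic R.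
apply: filterS => n; rewrite sub0r normrN subr0 normc_natV /=.
by rewrite ger0_norm// invr_ge0.
Qed.

(** M (e(y/M) - 1) tends to 2 pi i y, the derivative of exp at 0. *)
Lemma clim_Ufun y : y != 0 ->
  clim \oo (fun M => Ufun M.+1 y) (twopii * y%:C)^-1.
Proof.
move=> y0; set w := twopii * y%:C.
have w0 : w != 0.
  by rewrite mulf_neq0 ?twopii_neq0//; apply: contraNneq y0 => -[->].
have nw : 0 < normc w by rewrite normc_gt0.
suff h : clim \oo (fun M => M.+1%:R * (ex (y / M.+1%:R) - 1)) w.
  by apply: eq_clim (climV w0 h) => M; rewrite invfM.
move=> e e0; have ew : 0 < e / (2 * normc w) by rewrite divr_gt0// mulr_gt0.
have [d d0 hd] := @cder_cexp0 R _ ew.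
have dw : 0 < d / normc w by rewrite divr_gt0.
have /cvgrPdist_lt/(_ _ dw) := @cvg_harmonic R.
apply: filterS => M; rewrite sub0r normrN /= ger0_norm ?invr_ge0// => hM.
have Mp : 0 < M.+1%:R :> R by rewrite ltr0n.
have M0 : M.+1%:R != 0 :> R[i] by rewrite pnatr_eq0.
have exw : ex (y / M.+1%:R) = cexp (w / M.+1%:R).
  rewrite /ex; congr cexp; rewrite /w -(rmorph_nat (real_complex R)).
  rewrite -(fmorphV (real_complex R)).
  by apply: complex_ext => /=; ring.
have := hd (w / M.+1%:R); rewrite subr0 normcM normc_natV cexp0 mul1r.
rewrite mulrC -ltr_pdivlMr// => /(_ hM).
have -> : M.+1%:R * (ex (y / M.+1%:R) - 1) - w =
    M.+1%:R * (cexp (w / M.+1%:R) - 1 - w / M.+1%:R).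
  by rewrite exw; field; rewrite addrC natr1.
move=> h; rewrite normcM normc_nat.
rewrite (le_lt_trans (ler_wpM2l (ltW Mp) h))//.
have -> : M.+1%:R * (e / (2 * normc w) * (M.+1%:R^-1 * normc w)) = e / 2.
  have := lt0r_neq0 Mp; have := lt0r_neq0 nw; clear.
  by move: (M.+1%:R) (normc w) => X Y Y0 X0; field; rewrite X0 Y0.
lra.
Qed.

Lemma clim_pow0 n : (0 < n)%N -> clim \oo (fun M => (M.+1%:R^-1 : R[i]) ^+ n) 0.
Proof.
case: n => // n _; elim: n => [|n IH].
  by apply: eq_clim clim_natV => M; rewrite expr1.
by rewrite -[0](mul0r (0 : R[i])); apply: eq_clim (climM clim_natV IH) => M; rewrite exprS.
Qed.

Lemma climX {T : Type} (F : set_system T) {FF : Filter F} (f : T -> R[i]) (a : R[i]) n :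
  clim F f a -> clim F (fun i => f i ^+ n) (a ^+ n).
Proof.
move=> fa; elim: n => [|n IH]; first exact: clim_cst.
by rewrite exprS; apply: eq_clim (climM fa IH) => i; rewrite exprS.
Qed.

(** Only the leading term is not killed by a positive power of M^-1. *)
Lemma clim_Qfun K y : y != 0 ->
  clim \oo (fun M => Qfun K M.+1 y) ((K`!)%:R * (twopii * y%:C)^-1 ^+ K.+1).
Proof.
move=> y0.
have -> : (K`!)%:R * (twopii * y%:C)^-1 ^+ K.+1 = \sum_(i < K.+1) licoef K i *
    ((twopii * y%:C)^-1 ^+ i.+1 * (if i == K :> nat then 1 else 0)).
  rewrite big_ord_recr /= eqxx mulr1 /licoef (dlt_pw K).2 big1 ?add0r// => i _.
  by rewrite ltn_eqF ?mulr0.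
apply: clim_sum => i; apply: climZ; apply: climM.
  by apply: climX; exact: clim_Ufun.
case: eqVneq => [->|iK].
  by apply: eq_clim (clim_cst 1) => M; rewrite subnn.
by apply: clim_pow0; rewrite subn_gt0 ltn_neqAle iK -ltnS /=.
Qed.

Lemma stretch_sum0 M g (h : nat -> R[i]) K : (0 < M)%N ->
  \sum_(0 <= n < K * M) stretch M g n * h n = \sum_(0 <= n < K) g n * h (n * M)%N.
Proof.
move=> M0; elim: K => [|K IH]; first by rewrite mul0n !big_geq.
rewrite mulSn addnC (@big_cat_nat _ _ _ (K * M))//= ?leq_addr// IH big_nat_recr//=.
congr (_ + _).
rewrite -[X in \big[_/_]_(X <= _ < _) _]add0n big_addn addKn.
case: M M0 {IH} => // M _.
rewrite big_nat_recl//= big1_seq ?addr0; last first.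
  move=> i; rewrite mem_index_iota => /andP[_ /andP[_ iM]].
  by rewrite /stretch dvdn_addl ?dvdn_mull// gtnNdvd ?mul0r.
by rewrite /stretch add0n dvdn_mull// mulnK.
Qed.

Lemma fhat_stretch N M g j : (0 < M)%N ->
  fhat (N * M) (stretch M g) j = fhat N g j.
Proof.
move=> M0; have Mn0 : M%:R != 0 :> R by rewrite pnatr_eq0 -lt0n.
rewrite /fhat -(big_mkord xpredT (fun r => stretch M g r * ex ((j * r)%:R / (N * M)%:R))).
rewrite (@stretch_sum0 M g (fun r => ex ((j * r)%:R / (N * M)%:R)))//.
rewrite big_mkord; apply: eq_bigr => r _; congr (_ * ex _).
by rewrite mulnA natrM (natrM _ N) -mulf_div divff// mulr1.
Qed.

Lemma stretch_periodic N M g n : (0 < M)%N -> (forall n, g (n %% N)%N = g n) ->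
  stretch M g (n %% (N * M))%N = stretch M g n.
Proof.
move=> M0 gN; rewrite /stretch.
have -> : (M %| n %% (N * M))%N = (M %| n)%N.
  by rewrite {2}(divn_eq n (N * M)) mulnA dvdn_addr ?dvdn_mull.
case: ifP => // Mn; rewrite -(gN (n %/ M)%N); congr g.
by rewrite -{1}(divnK Mn) -muln_modl mulnK.
Qed.

Lemma periodic_bounded N g : (0 < N)%N -> (forall n, g (n %% N)%N = g n) ->
  bounded_arith g.
Proof.
move=> N0 gN; exists (\sum_(r < N) normc (g r)) => n.
rewrite -gN (bigD1 (Ordinal (ltn_pmod n N0)))//= lerDl.
by apply: sumr_ge0 => i _; exact: normc_ge0.
Qed.

(** True where the series converge, hence everywhere by the identity theorem. *)
Lemma perE_stretch N M g s : (0 < N)%N -> (0 < M)%N ->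
  (forall n, g (n %% N)%N = g n) -> s != 1 ->
  perE (N * M) (stretch M g) s = phi s M%:R * perE N g s.
Proof.
move=> N0 M0 gN s1; apply/eqP; rewrite -subr_eq0; apply/eqP; move: s s1.
apply: identity_punctured.
  move=> z z1; apply: cdiffB; first exact: cdiff_perE.
  by apply: cdiffM; [exact: cdiff_phi|exact: cdiff_perE].
move=> z z1; rewrite !perE_Dser// ?muln_gt0 ?N0//.
  by rewrite Dser_stretch ?subrr//; exact: periodic_bounded gN.
by move=> n; exact: stretch_periodic.
Qed.

(** Stretching g by M multiplies its L-function by M^-s and leaves its Fourier
    transform unchanged, now as a function modulo N M. *)
Lemma perE_negnat_stretch N M g K : (0 < N)%N -> (0 < M)%N ->
  (forall n, g (n %% N)%N = g n) -> fhat N g 0 = 0 ->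
  perE N g (- K%:R) = N%:R^-1 * \sum_(j < (N * M).-1) fhat N g j.+1 *
    Qfun K M (j.+1%:R / N%:R).
Proof.
move=> N0 M0 gN g0.
have Mn0 : M%:R != 0 :> R[i] by rewrite pnatr_eq0 -lt0n.
have Nn0 : N%:R != 0 :> R[i] by rewrite pnatr_eq0 -lt0n.
have K1 : - K%:R != 1 :> R[i].
  by rewrite -subr_eq0 -opprD oppr_eq0 natr1 pnatr_eq0.
have := perE_stretch N0 M0 gN K1.
rewrite phi_negnat ?ltr0n// /pw (rmorphXn (real_complex R)) rmorph_nat => h.
have {h} -> : perE N g (- K%:R) = M%:R^-1 ^+ K * perE (N * M) (stretch M g) (- K%:R).
  by rewrite h mulrA -exprMn mulVf// expr1n mul1r.
rewrite /perE fhat_stretch// g0 mul0r add0r natrM invfM.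
set S := \sum_(j < _) _.
have -> : M%:R^-1 ^+ K * (N%:R^-1 / M%:R * S) = N%:R^-1 * (M%:R^-1 ^+ K.+1 * S).
  by rewrite exprSr; move: (M%:R^-1) (N%:R^-1) => x y; ring.
congr (_ * _); rewrite mulr_sumr; apply: eq_bigr => j _; rewrite fhat_stretch// mulrCA.
congr (_ * _).
have lE := li_negnat K (normc_om R (N * M) j.+1) (om_ok R j).
rewrite lE (Qfun_lipoly K _ M0); congr (_ * lipoly _ _).
rewrite /om abel_u_ex; last first.
  have := @om_ok R (N * M) j; rewrite /om exN invr_eq1//.
by congr (ex _ - 1)^-1; rewrite natrM invfM mulrA.
Qed.

Lemma sum_trunc h n (F : nat -> R[i]) : (h <= n)%N ->
  \sum_(0 <= i < n) (if (i < h)%N then F i else 0) = \sum_(0 <= i < h) F i.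
Proof.
move=> hn; rewrite (@big_cat_nat _ _ _ h)//= [X in _ + X]big1_seq ?addr0; last first.
  by move=> i; rewrite mem_index_iota => /andP[_ /andP[hi _]]; rewrite ltnNge hi.
by rewrite !big_nat; apply: eq_bigr => i ih; rewrite ifT.
Qed.

(** The indices 1, ..., L-1 read from both ends: j and L - j are opposite
    frequencies modulo L. *)
Lemma sum_fold (L : nat) (F : nat -> R[i]) :
  \sum_(0 <= i < L.-1) F i.+1 = \sum_(0 <= i < L./2) F i.+1 +
    \sum_(0 <= i < (L - L./2).-1) F (L - i.+1)%N.
Proof.
case: L => [|L] /=; first by rewrite !big_geq// addr0.
have hL : (uphalf L <= L.+1)%N by lia.
have [->|L0] := eqVneq L 0%N; first by rewrite !big_geq// addr0.
have hL' : (uphalf L <= L)%N by lia.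
rewrite (@big_cat_nat _ _ _ (uphalf L))//=; congr (_ + _).
rewrite big_nat_rev /= -[X in \big[_/_]_(X <= _ < _) _]add0n big_addn.
have -> : (L - uphalf L)%N = (L.+1 - uphalf L).-1 by lia.
rewrite !big_nat; apply: eq_bigr => i ih; congr F; lia.
Qed.

Lemma fhat_period N g j k : (0 < N)%N -> fhat N g (j + k * N) = fhat N g j.
Proof.
move=> N0; have Nn0 : N%:R != 0 :> R by rewrite pnatr_eq0 -lt0n.
apply: eq_bigr => r _; congr (_ * _).
have -> : ((j + k * N) * r)%:R / N%:R = (j * r)%:R / N%:R + (k * r)%:R :> R.
  by rewrite mulnDl natrD mulrDl; congr (_ + _); rewrite mulnAC natrM mulfK.
by rewrite exD ex_nat mulr1.
Qed.

Lemma Ufun_reflect M y : (0 < M)%N -> Ufun M (M%:R - y) = Ufun M (- y).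
Proof.
move=> M0; have Mn0 : M%:R != 0 :> R by rewrite pnatr_eq0 -lt0n.
by rewrite /Ufun mulrBl divff// exD ex1 mul1r mulNr.
Qed.

Lemma npowE K n : npow (K%:R : R) n = (n.+1%:R ^+ K)^-1.
Proof.
rewrite /npow mulNr expRN expRM_natl lnK// posrE ltr0n//.
Qed.

Lemma phi_nat K x : 0 < x -> phi K%:R x = ((x ^+ K)^-1)%:C.
Proof.
by move=> x0; rewrite /phi rpowcN rpowc_nat// (fmorphV (real_complex R)).
Qed.

(** The values of L(s, g) at the negative integers of the right parity are those
    of its Fourier transform h at the positive ones. The N M-th roots of unity
    e(j/(NM)) with j and NM - j small contribute to L(-K, g) terms that tend to
    multiples of h(j) j^-(K+1) and h(-j) (-j)^-(K+1), equal by parity; the bound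
    |e(y) - 1| >= |y| allows to pass to the limit in the sum. *)
Lemma perE_negnat N g K (sgn : R[i]) : (0 < N)%N -> (0 < K)%N ->
  (forall n, g (n %% N)%N = g n) -> fhat N g 0 = 0 ->
  (forall j k, (j <= k * N)%N -> fhat N g (k * N - j) = sgn * fhat N g j) ->
  normc sgn = 1 -> sgn * (-1) ^+ K.+1 = 1 ->
  perE N g (- K%:R) = N%:R^-1 * (2 * (K`!)%:R * (N%:R / twopii) ^+ K.+1 *
    Dser (fhat N g) K.+1%:R).
Proof.
move=> N0 K0 gN g0 par sgn1 sgnK.
have Nn0 : N%:R != 0 :> R by rewrite pnatr_eq0 -lt0n.
have Np : 0 < N%:R :> R by rewrite ltr0n.
set b := fhat N g.
have [B hB] : bounded_arith b.
  apply: (@periodic_bounded N) => // n.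
  by rewrite [in RHS](divn_eq n N) addnC /b fhat_period.
pose L M := (N * M.+1)%N.
pose F M j := b j * Qfun K M.+1 (j%:R / N%:R).
(* the sum over 0 < j < NM, folded and prolonged by 0 to a series *)
pose W M i := (if (i < (L M)./2)%N then F M i.+1 else 0) +
  (if (i < (L M - (L M)./2).-1)%N then F M (L M - i.+1)%N else 0).
have WE M : perE N g (- K%:R) = N%:R^-1 * csum (W M).
  rewrite (@perE_negnat_stretch N M.+1)//; congr (_ * _).
  rewrite -(big_mkord xpredT (fun j => F M j.+1)) sum_fold; apply/esym/csumP.
  apply: near_clim (clim_cst _); exists (L M) => // n /= Ln.
  by rewrite /series /= big_split/= !sum_trunc//; lia.
set C := \sum_(i < K.+1) normc (licoef K i).
have C0 : 0 <= C by apply: sumr_ge0 => i _; exact: normc_ge0.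
have B0 : 0 <= B by exact: le_trans (normc_ge0 _) (hB 0%N).
set v := fun i => 2 * (B * (C * N%:R ^+ K.+1)) * npow (K.+1%:R : R) i.
have sv : cvgn (series v) by apply: cvg_npowZ; rewrite ltr1n.
have yn0 (i : nat) : i.+1%:R / N%:R != 0 :> R by rewrite mulf_neq0 ?invr_neq0// pnatr_eq0.
have half M i : (i.+1 * 2 <= L M)%N -> `|i.+1%:R / N%:R| <= M.+1%:R / 2 :> R.
  move=> iL; rewrite ger0_norm ?divr_ge0// ler_pdivrMr// mulrAC ler_pdivlMr//.
  by rewrite -!natrM ler_nat mulnC [(M.+1 * N)%N]mulnC; move: iL; rewrite /L; lia.
have vbound M i y : `|y| = i.+1%:R / N%:R -> (i.+1 * 2 <= L M)%N ->
    normc (Qfun K M.+1 y) <= C * N%:R ^+ K.+1 * npow (K.+1%:R : R) i.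
  move=> yE iL; have y0 : y != 0 by rewrite -normr_gt0 yE divr_gt0 ?ltr0n.
  rewrite (le_trans (Qfun_le _ _ y0 _))//.
    by rewrite yE (le_trans _ (half _ _ iL))// ler_norm.
  by rewrite -mulrA ler_wpM2l// yE npowE invf_div expr_div_n.
have FE M i : (i < (L M - (L M)./2).-1)%N ->
    F M (L M - i.+1)%N = sgn * b i.+1 * Qfun K M.+1 (- (i.+1%:R / N%:R)).
  move=> iL; have iL' : (i.+1 <= L M)%N by lia.
  have lm : L M = (M.+1 * N)%N by exact: mulnC.
  rewrite /F; congr (_ * _); first by rewrite lm /b par// -lm.
  apply: eq_bigr => k _; congr (_ * (_ ^+ _ * _)).
  rewrite -Ufun_reflect//; congr Ufun; rewrite natrB// mulrBl; congr (_ - _).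
  by rewrite natrM mulrAC divff// mul1r.
have Wv M i : normc (W M i) <= v i.
  rewrite /v mulr2n mulrDl mul1r mulrDl (le_trans (le_normcD _ _))// lerD//.
    case: ifP => iL; last by rewrite normc0 !mulr_ge0 ?npow_ge0// exprn_ge0.
    rewrite normcM -mulrA ler_pM ?normc_ge0//; apply: vbound; last lia.
    by rewrite ger0_norm// divr_ge0.
  case: ifP => iL; last by rewrite normc0 !mulr_ge0 ?npow_ge0// exprn_ge0.
  rewrite FE// normcM normcM sgn1 mul1r -mulrA ler_pM ?normc_ge0//.
  apply: vbound; last lia.
  by rewrite normrN ger0_norm// divr_ge0.
pose w i := 2 * (K`!)%:R * (N%:R / twopii) ^+ K.+1 * (b i.+1 * phi K.+1%:R i.+1%:R).
have Ww i : clim \oo (W ^~ i) (w i).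
  set y := i.+1%:R / N%:R : R.
  have -> : w i = b i.+1 * ((K`!)%:R * (twopii * y%:C)^-1 ^+ K.+1) +
      sgn * b i.+1 * ((K`!)%:R * (twopii * (- y)%:C)^-1 ^+ K.+1).
    rewrite /w phi_nat ?ltr0n//.
    have yE : (twopii * y%:C)^-1 ^+ K.+1 =
        (N%:R / twopii) ^+ K.+1 * ((i.+1%:R ^+ K.+1)^-1)%:C.
      rewrite -exprVn (rmorphXn (real_complex R)) -exprMn; congr (_ ^+ _).
      rewrite /y (rmorphM (real_complex R)) !(fmorphV (real_complex R)) /=.
      rewrite !(rmorph_nat (real_complex R)) !invfM invrK.
      by move: (i.+1%:R^-1) (N%:R) (twopii^-1) => ? ? ?; ring.
    have -> : (twopii * (- y)%:C)^-1 ^+ K.+1 = (-1) ^+ K.+1 *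
        (twopii * y%:C)^-1 ^+ K.+1.
      by rewrite (rmorphN (real_complex R)) mulrN invrN; exact: exprNn.
    rewrite yE.
    set X := (N%:R / twopii) ^+ K.+1; set Y := (i.+1%:R ^- K.+1)%:C; set Z := b i.+1.
    have -> : sgn * Z * (K`!%:R * ((-1) ^+ K.+1 * (X * Y))) =
      (sgn * (-1) ^+ K.+1) * (Z * (K`!%:R * (X * Y))) by ring.
    by rewrite sgnK; ring.
  have big : \forall M \near \oo, (i < (L M)./2)%N /\ (i < (L M - (L M)./2).-1)%N.
    exists (i + i + 5)%N => // M /= iM.
    have : (M <= L M)%N by rewrite /L; nia.
    by lia.
  apply: (@near_clim _ _ _ _ _ (fun M => b i.+1 * Qfun K M.+1 y +
    sgn * b i.+1 * Qfun K M.+1 (- y))).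
    by apply: filterS big => M [h1 h2]; rewrite /W h1 h2 -FE.
  apply: climD; apply: climZ; apply: clim_Qfun; rewrite ?oppr_eq0; exact: yn0.
have lim : clim \oo (fun M => csum (W M)) (csum w).
  by apply: csum_dominated sv Ww; exists 0%N => // M _ i; exact: Wv.
have cW M : csum (W M) = csum (W 0%N).
  have Nv : N%:R^-1 != 0 :> R[i] by rewrite invr_eq0 pnatr_eq0 -lt0n.
  by apply: (mulfI Nv); exact: etrans (esym (WE M)) (WE 0%N).
have e : csum (W 0%N) = csum w.
  by apply: clim_unique lim; apply: eq_clim (clim_cst (csum (W 0%N))) => M; exact: cW.
apply: etrans (WE 0%N) _; rewrite e; congr (_ * _); rewrite /w /Dser -csumZ//.
by apply: csummable_Dser; [exists B|rewrite Re_nat ltr1n].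
Qed.

End NegativeIntegers.

(** * The recursion of the Gamma function *)
Section GammaRecursion.
Variable R : realType.
Implicit Types (a b x t : R) (n : nat).

Lemma rint_FTC a b (f F : R -> R) : a < b ->
  (forall t, t \in `[a, b] -> is_derive t 1 F (f t)) -> rcont a b f ->
  rint a b f = F b - F a.
Proof.
move=> ab dF cf.
have Fc t : t \in `[a, b] -> {for t, continuous F}.
  move=> tab; apply: differentiable_continuous; apply/derivable1_diffP.
  exact: (@ex_derive _ _ _ _ _ _ _ (dF t tab)).
have oc t : t \in `]a, b[ -> t \in `[a, b].
  by rewrite !in_itv /= => /andP[? ?]; rewrite !ltW.
rewrite /rint /Rintegral (@continuous_FTC2 _ f F a b ab)//.
- by apply: continuous_in_subspaceT => t; rewrite inE; exact: cf.
- split.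
  + by move=> t /oc tab; exact: (@ex_derive _ _ _ _ _ _ _ (dF t tab)).
  + by apply: cvg_at_right_filter; apply: Fc; rewrite in_itv /= lexx ltW.
  + by apply: cvg_at_left_filter; apply: Fc; rewrite in_itv /= lexx ltW.
- by move=> t /oc tab; rewrite derive1E; exact: (@derive_val _ _ _ _ _ _ _ (dF t tab)).
Qed.

Notation D := (`]0%R, +oo[%classic : set R).

(** The integrand t^(x-1) e^-t of the Gamma function at a real x. *)
Definition gint x t : R := expR ((x - 1) * ln t - t).

Lemma is_derive_gint x t : 0 < t ->
  is_derive t 1 (gint (x + 1)) (x * gint x t - gint (x + 1) t).
Proof.
move=> t0.
have l1 : is_derive t 1 (fun y => (x + 1 - 1) * ln y) ((x + 1 - 1) * t^-1).
  by apply: is_deriveZ; exact: is_derive1_ln.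
have l2 := is_deriveB l1 (is_derive_id t (1 : R)).
have := @is_derive1_comp R expR (fun y => (x + 1 - 1) * ln y - y) t _ _ (is_derive_expR _) l2.
move=> h; apply: (is_derive_eq h).
have gE : gint x t = gint (x + 1) t * t^-1.
  have -> : t^-1 = expR (- ln t) by rewrite expRN lnK// posrE.
  by rewrite /gint -expRD; congr expR; ring.
by rewrite gE /gint addrK; ring.
Qed.

Lemma continuous_gint x t : 0 < t -> {for t, continuous (gint x)}.
Proof.
move=> t0; apply: differentiable_continuous; apply/derivable1_diffP.
have h := is_derive_gint (x - 1) t0; rewrite subrK in h.
exact: (@ex_derive _ _ _ _ _ _ _ h).
Qed.

(** 1 + ln u <= u at u = t / (2 (x - 1)) gives
    (x - 1) ln t <= t/2 + (x - 1) (ln (2 (x - 1)) - 1). *)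
Lemma gint_le x t : 1 < x -> 0 < t ->
  gint x t <= expR ((x - 1) * (ln (2 * (x - 1)) - 1)) * expR (- (t / 2)).
Proof.
move=> x1 t0; have x10 : 0 < x - 1 by rewrite subr_gt0.
have c0 : 0 < 2 * (x - 1) by rewrite mulr_gt0.
rewrite /gint -expRD ler_expR.
have h : 1 + ln (t / (2 * (x - 1))) <= t / (2 * (x - 1)).
  by have := expR_ge1Dx (ln (t / (2 * (x - 1)))); rewrite lnK// posrE divr_gt0.
rewrite ln_div ?posrE// in h.
have : (x - 1) * ln t <= (x - 1) * (t / (2 * (x - 1)) - 1 + ln (2 * (x - 1))).
  by rewrite ler_pM2l//; lra.
have -> : (x - 1) * (t / (2 * (x - 1)) - 1 + ln (2 * (x - 1))) =
    t / 2 + (x - 1) * (ln (2 * (x - 1)) - 1) by field; rewrite gt_eqF.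
by lra.
Qed.

Lemma measurable_pos (f : R -> R) : (forall t, 0 < t -> {for t, continuous f}) ->
  measurable_fun D f.
Proof.
move=> cf; apply: measurable_realfun.open_continuous_measurable_fun.
  exact: interval_open.
by move=> t; rewrite inE /= in_itv /= andbT; exact: cf.
Qed.

(** Comparison with the exponential density of rate 1/2. *)
Lemma integrable_gint x : 1 < x -> lebesgue_measure.-integrable D (EFin \o gint x).
Proof.
move=> x1; set C := expR ((x - 1) * (ln (2 * (x - 1)) - 1)).
have h2 : 0 < 2^-1 :> R by rewrite invr_gt0.
have iE : lebesgue_measure.-integrable D (EFin \o exponential_pdf (2^-1 : R)).
  by apply: integrableS (integrable_exponential_pdf h2).
have := integrableZl _ (C * 2) iE => /(_ _) iE2.
apply: (le_integrable _ _ _ (iE2 _)) => //.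
- by apply/measurable_realfun.measurable_EFinP; apply: measurable_pos => t; exact: continuous_gint.
- move=> t /=; rewrite in_itv /= andbT => t0.
  rewrite lee_fin (exponential_pdfE _ (ltW t0)).
  rewrite ger0_norm ?expR_ge0// (le_trans (gint_le x1 t0))//.
  rewrite (le_trans _ (ler_norm _))// -/C -mulrA ler_wpM2l ?expR_ge0//.
  by rewrite mulrA divff// mul1r mulNr [2^-1 * t]mulrC.
Qed.

Lemma cvg_improper (f : R -> R) : (forall t, 0 < t -> {for t, continuous f}) ->
  lebesgue_measure.-integrable D (EFin \o f) ->
  rint n.+1%:R^-1 n.+2%:R f @[n --> \oo] -->
  \int[lebesgue_measure]_(t in D) f t.
Proof.
move=> cf fi.
pose A n : set R := `[n.+1%:R^-1, n.+2%:R]%classic.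
have AD n : A n `<=` D.
  move=> t; rewrite /A /= !in_itv /= andbT => /andP[h _].
  by apply: lt_le_trans h; rewrite invr_gt0.
pose fn n : R -> \bar R := (EFin \o f) \_ (A n).
have /integrableP[mf _] := fi.
have h1 : measurable (D : set R) by [].
have h4 : lebesgue_measure.-integrable D (abse \o (EFin \o f)) by exact: integrable_abse.
have dc := @dominated_convergence _ _ R lebesgue_measure D h1 fn (EFin \o f) (abse \o (EFin \o f)).
have [|||_ _ h] := dc _ mf _ h4 _.
- move=> n; have mA : measurable (A n : set R) by exact: measurable_itv.
  have [mr _] := measurable_restrict (EFin \o f) mA h1.
  apply: mr.
  by apply: measurable_funS mf => //; exact: subIsetl.
- apply: aeW => t Dt; apply: cvg_near_cst.
  have t0 : 0 < t by move: Dt; rewrite /= in_itv /= andbT.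
  have [n1 n1P] : exists n : nat, t^-1 <= n.+1%:R.
    exists (Num.truncn t^-1); exact/ltW/truncnS_gt.
  have [n2 n2P] : exists n : nat, t <= n.+1%:R.
    exists (Num.truncn t); exact/ltW/truncnS_gt.
  exists (n1 + n2)%N => // n /= nn; rewrite /fn patchE ifT// inE /A /= in_itv /=.
  apply/andP; split.
    rewrite -[t]invrK lef_pV2 ?posrE ?invr_gt0// (le_trans n1P)// ler_nat ltnS.
    by rewrite (leq_trans _ nn)// leq_addr.
  by rewrite (le_trans n2P)// ler_nat ltnS ltnW// ltnS (leq_trans _ nn)// leq_addl.
- apply: aeW => t n Dt; rewrite /fn patchE /=; case: ifP => // _.
  by rewrite (_ : (point : \bar R) = 0%E)// abse0 lee_fin.
have hE n : (\int[lebesgue_measure]_(t in D) fn n t = (rint n.+1%:R^-1 n.+2%:R f)%:E)%E.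
  rewrite /fn -integral_mkcondr (setIidr (@AD n)) /rint /Rintegral fineK//.
  apply: integrable_fin_num => //; apply: integrableS fi => //; exact: AD.
have h' : (rint n.+1%:R^-1 n.+2%:R f)%:E @[n --> \oo] --> (\int[lebesgue_measure]_(t in D) f t)%:E.
  rewrite /Rintegral fineK; last exact: integrable_fin_num.
  by apply: cvg_trans h; apply: near_eq_cvg; apply: nearW => n /=; rewrite hE.
by move/fine_cvgP: h' => [_].
Qed.

Definition rG x := \int[lebesgue_measure]_(t in D) gint x t.

Lemma gint_ge0 x t : 0 <= gint x t. Proof. exact: expR_ge0. Qed.

Lemma rG_gt0 x : 1 < x -> 0 < rG x.
Proof.
move=> x1; have h := cvg_improper (fun t => @continuous_gint x t) (integrable_gint x1).
have ab : 1 < 2 :> R by rewrite ltr1n.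
have cg a b : 0 < a -> rcont a b (gint x).
  by move=> a0 t /= /itvP tab; apply: continuous_gint; rewrite (lt_le_trans a0)// tab.
have p0 : 0 < rint 1 2 (gint x).
  apply: rint_gt0 => //; first exact: cg.
  by move=> t _; rewrite expR_gt0.
apply: lt_le_trans p0 _.
rewrite /rG -(cvg_lim _ h)//; apply: limr_ge; first by apply/cvg_ex; exists (rG x).
apply: nearW => n.
have e1 : n.+1%:R^-1 <= 1 :> R by rewrite invf_le1// ler1n.
have e2 : 2 <= n.+2%:R :> R by rewrite ler_nat.
have n0 : 0 < n.+1%:R^-1 :> R by rewrite invr_gt0.
rewrite (rint_split e1 (le_trans (ltW ab) e2)); last exact: cg.
rewrite (rint_split (ltW ab) e2); last exact: cg.
have r0 a b : 0 < a -> a <= b -> 0 <= rint a b (gint x).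
  move=> a0; rewrite le_eqVlt => /orP[/eqP<-|ab'].
    by rewrite /rint set_itv1 Rintegral_set1.
  apply/ltW/rint_gt0 => //; first exact: cg.
  by move=> t _; rewrite expR_gt0.
have := r0 _ _ n0 e1; have := r0 _ _ (lt_trans ltr01 ab) e2.
by move: (rint _ _ _) (rint _ _ _) (rint _ _ _) => u v w; lra.
Qed.

(** Integration by parts: x t^(x-1) e^-t - t^x e^-t is the derivative of t^x e^-t,
    which vanishes at both ends. *)
Lemma rG_rec x : 1 < x -> rG (x + 1) = x * rG x.
Proof.
move=> x1; have x11 : 1 < x + 1 by lra.
have i1 := integrable_gint x1; have i2 := integrable_gint x11.
pose f t := x * gint x t - gint (x + 1) t.
have cf t : 0 < t -> {for t, continuous f}.
  by move=> t0; apply: cvgB; [apply: cvgM; [exact: cvg_cst|]|]; exact: continuous_gint.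
have fi : lebesgue_measure.-integrable D (EFin \o f).
  have -> : EFin \o f = (fun t => x%:E * (EFin \o gint x) t - (EFin \o gint (x + 1)) t)%E.
    by apply/funext => t /=; rewrite -EFinM -EFinB.
  by apply: integrableB => //; exact: integrableZl.
have h := cvg_improper cf fi.
have fE : \int[lebesgue_measure]_(t in D) f t = x * rG x - rG (x + 1).
  rewrite /f RintegralB//; first by rewrite RintegralZl.
  by have := integrableZl _ x i1 => /(_ _) h'; exact: (h' _).
apply/esym/eqP; rewrite -subr_eq0 -fE; apply/eqP.
apply: (cvg_unique _ h) => //.
have E n : rint n.+1%:R^-1 n.+2%:R f = gint (x + 1) n.+2%:R - gint (x + 1) n.+1%:R^-1.
  apply: rint_FTC.
  - by apply: (@le_lt_trans _ _ 1); rewrite ?invf_le1 ?ler1n ?ltr1n ?ltr0n.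
  - by move=> t /itvP tab; apply: is_derive_gint; rewrite (lt_le_trans _ (_ : n.+1%:R^-1 <= t))// tab.
  - by move=> t /itvP tab; apply: cf; rewrite (lt_le_trans _ (_ : n.+1%:R^-1 <= t))// tab.
rewrite /=; under eq_fun do rewrite E.
apply/cvgrPdist_lt => e e0.
pose C := expR ((x + 1 - 1) * (ln (2 * (x + 1 - 1)) - 1)).
have C0 : 0 < C by exact: expR_gt0.
near=> n.
have h1 : gint (x + 1) n.+2%:R <= C * (2 / n.+2%:R).
  apply: le_trans (gint_le x11 _) _; first by rewrite ltr0n.
  rewrite -/C ler_pM2l// expRN -[leRHS]invrK lef_pV2 ?posrE ?expR_gt0 ?invr_gt0//.
    rewrite invf_div (le_trans _ (expR_ge1Dx _))// lerDr//.
have h2 : gint (x + 1) n.+1%:R^-1 <= n.+1%:R^-1.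
  have n0 : 0 < n.+1%:R^-1 :> R by rewrite invr_gt0.
  rewrite /gint addrK -[leRHS]lnK ?posrE// ler_expR.
  rewrite (@le_trans _ _ (x * ln n.+1%:R^-1))//; first by rewrite gerBl ltW.
  rewrite -[leRHS]mul1r; apply: ler_wnM2r; last exact: ltW.
  by apply: ln_le0; rewrite invf_le1 ?ler1n ?ltr0n.
rewrite sub0r normrN (le_lt_trans (ler_normB _ _))//.
rewrite !ger0_norm ?gint_ge0//.
rewrite (le_lt_trans (lerD h1 h2))//.
rewrite (@le_lt_trans _ _ ((C * 2 + 1) / n.+1%:R))//.
  rewrite [leRHS]mulrDl mul1r lerD2r -!mulrA ler_pM2l// ler_pM2l//.
  by rewrite lef_pV2 ?posrE// ler_nat.
rewrite ltr_pdivrMr ?ltr0n// -ltr_pdivrMl//.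
near: n; exists (Num.truncn (e^-1 * (C * 2 + 1))) => // n /= nn.
by rewrite (lt_le_trans (truncnS_gt _))// ler_nat ltnS.
Unshelve. all: by end_near. Qed.

Lemma Gamma_real x : 1 < x -> Gamma x%:C = (rG x)%:C.
Proof.
move=> x1; have x0 : 0 < x by rewrite (lt_trans ltr01).
rewrite /Gamma /= x0 big_ord0 divr1 addr0 /Gamma_int.
have E t : t \in D -> rpowc t (x%:C - 1) * (expR (- t))%:C = (gint x t)%:C.
  move=> _; rewrite -(rmorph1 (real_complex R)) -rmorphB rpowc_real -rmorphM.
  by rewrite /gint expRD.
congr (_ +i* _); first by apply: eq_Rintegral => t /E ->.
transitivity (\int[lebesgue_measure]_(t in D) (0 : R)).
  by apply: eq_Rintegral => t /E ->.
by rewrite /Rintegral integral0.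
Qed.

Lemma Gamma_real_rec x : 1 < x -> Gamma (x%:C + 1) = x%:C * Gamma x%:C.
Proof.
move=> x1; rewrite -(rmorph1 (real_complex R)) -rmorphD !Gamma_real//; last by lra.
by rewrite rG_rec// rmorphM.
Qed.

Lemma Gamma_real_neq0 x : 1 < x -> Gamma x%:C != 0.
Proof.
by move=> x1; rewrite Gamma_real// (fmorph_eq0 (real_complex R)) gt_eqF// rG_gt0.
Qed.

(** In Re z <= 0 the recursion holds by construction: the number of factors in
    the definition drops by one from z to z + 1. *)
Lemma Gamma_neg_rec (z : R[i]) : Re z <= 0 -> z != 0 ->
  Gamma (z + 1) = z * Gamma z.
Proof.
move=> z0 zn0; rewrite /Gamma; set n := Num.truncn (- Re z).
have -> : (0 < Re z) = false by rewrite ltNge z0.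
rewrite big_ord_recl /= addr0.
have e1 : (if 0 < Re (z + 1) then 0%N else (Num.truncn (- Re (z + 1))).+1) = n.
  rewrite ReD /=; case: ltP => h.
    by apply/esym/truncn_def; rewrite oppr_ge0 z0 /=; lra.
  have h0 : 0 <= - Re z - 1 by lra.
  have /andP[h1 h2] := truncn_itv h0.
  rewrite opprD; apply/esym/truncn_def.
  by move: h1 h2; rewrite -!natr1 => h1 h2; apply/andP; split; lra.
rewrite e1.
have -> : z + 1 + n%:R = z + n.+1%:R by rewrite -natr1; ring.
rewrite invfM [RHS]mulrCA (mulrA z) mulfV// mul1r.
congr (_ / _); apply: eq_bigr => k _; rewrite /bump /= add1n -natr1.
by ring.
Qed.

End GammaRecursion.

(** * Uniqueness of Dirichlet coefficients *)
Section LargeArguments.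
Variable R : realType.
Implicit Types (s z : R[i]) (n N j k : nat) (e g : nat -> R[i]).

Lemma clim_cnear {T : Type} (F : set_system T) (FF : Filter F)
    (h : R[i] -> R[i]) (f : T -> R[i]) z :
  cnear h z -> clim F f z -> clim F (fun t => h (f t)) (h z).
Proof.
move=> hz fz eps eps0; have /nbhscP[d d0 hd] := hz eps eps0.
by apply: filterS (fz d d0) => t; exact: hd.
Qed.

(** (n+1)^k sum_i e_i i^-k is dominated by its first nonzero term as k grows. *)
Lemma clim_Dser_lead e n : bounded_arith e -> (forall i, (i < n)%N -> e i.+1 = 0) ->
  clim \oo (fun k => n.+1%:R ^+ k * Dser e k%:R) (e n.+1).
Proof.
move=> [B eB] en.
have B0 : 0 <= B by apply: le_trans (eB 0%N); exact: normc_ge0.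
have n0 : 0 < n.+1%:R :> R by rewrite ltr0n.
have key i k : normc (n.+1%:R ^+ k * (e i.+1 * phi k%:R i.+1%:R)) =
    normc (e i.+1) * (n.+1%:R / i.+1%:R) ^+ k.
  rewrite normcM normcX normc_nat normcM normc_phin Re_nat npowE.
  by rewrite expr_div_n mulrCA.
pose u i : R[i] := if i == n then e n.+1 else 0.
have uE : csum u = e n.+1.
  apply: csumP => eps eps0; exists n.+1 => // k /= nk.
  rewrite /series /= (bigD1_seq n) ?iota_uniq ?mem_index_iota//= {1}/u eqxx.
  rewrite big1 ?addr0 ?subrr ?normc0// => i ni; rewrite /u (negbTE ni)//.
rewrite -uE.
apply: (@near_clim R nat \oo _ _ (fun k => csum (fun i => n.+1%:R ^+ k * (e i.+1 * phi k%:R i.+1%:R)))).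
  exists 2%N => // k /= k2; rewrite csumZ//; apply: csummable_Dser; first by exists B.
  by rewrite Re_nat ltr1n.
apply: (@csum_dominated _ _ _ _ _ _ (fun i => (B * n.+1%:R ^+ 2) * npow 2 i)).
- exists 2%N => // k /= k2 i; rewrite key npowE.
  have [ni|ni] := ltnP i n.
    by rewrite en// normc0 mul0r !mulr_ge0 ?exprn_ge0 ?invr_ge0 ?exprn_ge0.
  rewrite -mulrA -expr_div_n ler_pM ?normc_ge0 ?exprn_ge0 ?divr_ge0//.
  by rewrite ler_wiXn2l// ?divr_ge0// ler_pdivrMr ?ltr0n// mul1r ler_nat.
- by apply: cvg_npowZ; rewrite ltr1n.
- move=> i; rewrite /u; case: (ltngtP i n) => ni.
  + by apply: (@eq_clim _ _ _ _ (fun=> 0)); [move=> k|exact: clim_cst]; rewrite en// mul0r mulr0.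
  + move=> eps eps0; set q : R := n.+1%:R / i.+1%:R.
    have q1 : `|q| < 1.
      by rewrite ger0_norm ?divr_ge0// ltr_pdivrMr ?ltr0n// mul1r ltr_nat.
    have p0 : 0 < eps / (B + 1) by rewrite divr_gt0// ltr_wpDl.
    have /cvgrPdist_lt/(_ _ p0) := cvg_expr q1.
    apply: filterS => k; rewrite sub0r normrN subr0 key -/q => h.
    rewrite ger0_norm in h; last by rewrite exprn_ge0// divr_ge0.
    rewrite (@le_lt_trans _ _ ((B + 1) * q ^+ k))//.
      by rewrite ler_wpM2r ?exprn_ge0 ?divr_ge0// (le_trans (eB _))// lerDl.
    by rewrite mulrC -ltr_pdivlMr// ltr_wpDl.
  + rewrite ni; apply: (@eq_clim _ _ _ _ (fun=> e n.+1)); [move=> k|exact: clim_cst].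
    rewrite phi_nat ?ltr0n// mulrCA (fmorphV (real_complex R)).
    by rewrite rmorphXn rmorph_nat mulfV ?mulr1// expf_neq0// pnatr_eq0.
Qed.

(** The step 2 and the offset a reflect that the functional equation only gives
    information at the integers of one parity. *)
Lemma Dser_unique e a J : bounded_arith e ->
  (forall j, (J <= j)%N -> Dser e (2 * j + a)%:R = 0) -> forall n, e n.+1 = 0.
Proof.
move=> eB e0 n; elim/ltn_ind: n => n IH.
apply/eqP; apply: contraT; rewrite -normc_gt0 => en.
have := clim_Dser_lead eB IH; move=> /(_ _ en).
move=> [K _ /(_ (2 * (J + K) + a)%N)] /=.
rewrite e0 ?leq_addr// mulr0 sub0r normcN ltxx; apply.
by rewrite (leq_trans (leq_addl J K))// mul2n -addnn -addnA leq_addr.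
Qed.

End LargeArguments.

(** * The functional equation as a relation between L-values *)

(** The functional equation at s divided by the one at s + 2. A vanishing factor
    in the second one would force L(s) = 0. *)
Lemma feq_algebra (F : fieldType) (p G p' G' q u v eps L1 L2 L3 L4 : F) :
  p != 0 -> G != 0 -> L1 != 0 ->
  p * G * L1 = eps * (p' * q * (v * G') * L4) ->
  p * q * (u * G) * L3 = eps * (p' * G' * L2) ->
  L1 * L2 = q ^+ 2 * u * v * (L3 * L4).
Proof.
move=> p0 G0 L10 E1 E2.
have A0 : p * G * L1 != 0 by rewrite !mulf_neq0.
have B0 : eps * p' * G' != 0.
  apply: contra_neq A0 => B0.
  rewrite E1 (_ : eps * _ = eps * p' * G' * (q * v * L4)); last by ring.
  by rewrite B0 mul0r.
apply: (mulfI (mulf_neq0 (mulf_neq0 p0 G0) B0)).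
transitivity (p * G * L1 * (eps * (p' * G' * L2))); first by ring.
by rewrite E1 -E2; ring.
Qed.

Section FunctionalEquation.
Variables (R : realType) (N a : nat) (g : 'Z_N -> R[i]).
Implicit Types (s z : R[i]) (n j k : nat) (x : R).
Hypotheses (hN : (1 < N)%N) (gB : forall x : 'Z_N, normc (g x) <= 1).
Hypotheses (ha : (a <= 1)%N) (g_parity : has_parity g a) (g1 : g 1 = 1).
Hypothesis g_reg : mero_holomorphic_at (dirichlet_L g) 1.

Let gb (x : 'Z_N) : R[i] := (g x)^*.

Hypothesis g_feq : exists2 eps : R[i], eps != 0 &
  mero_eq (Lambda a g) (fun s => eps * Lambda a gb (1 - s)).

Let gbB (x : 'Z_N) : normc (gb x) <= 1.
Proof. by rewrite /gb /normc; case: (g x) (gB x) => u v /=; rewrite sqrrN. Qed.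

Let N0 : (0 < N)%N. Proof. exact: ltnW. Qed.
Let Nn0 : N%:R != 0 :> R. Proof. by rewrite pnatr_eq0 -lt0n. Qed.

Lemma fhat_Zp (h : 'Z_N -> R[i]) j :
  fhat N (lift_arith h) j = \sum_(x : 'Z_N) h x * ex ((j * x)%:R / N%:R).
Proof.
rewrite /fhat /lift_arith -(big_mkord xpredT (fun r => h r%:R * ex ((j * r)%:R / N%:R))).
have -> : index_iota 0 N = index_iota 0 (Zp_trunc N).+2 by rewrite Zp_cast.
rewrite big_mkord; apply: eq_bigr => x _.
by rewrite natr_Zp.
Qed.

Lemma ex_cong (A B p q : nat) : (A + p * N = B + q * N)%N ->
  ex (A%:R / N%:R) = ex (B%:R / N%:R : R).
Proof.
move=> /(congr1 (fun n => ex (n%:R / N%:R : R))).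
by rewrite !natrD !natrM !mulrDl !mulfK// !exD !ex_nat !mulr1.
Qed.

Lemma fhat_parity (h : 'Z_N -> R[i]) j k : has_parity h a -> (j <= k * N)%N ->
  fhat N (lift_arith h) (k * N - j) = (-1) ^+ a * fhat N (lift_arith h) j.
Proof.
move=> hp jk; rewrite !fhat_Zp (reindex_inj oppr_inj) mulr_sumr /=.
apply: eq_bigr => x _; rewrite hp -mulrA; congr (_ * (_ * _)).
have xN : (x <= N)%N by rewrite ltnW// -[X in (_ < X)%N](Zp_cast hN).
have h1 : exists q, ((- x)%R + x = q * N)%N.
  exists ((x : nat) != 0)%N => /=; move: (nat_of_ord x) xN => y yN; rewrite (Zp_cast hN).
  have [->|x0] := eqVneq y 0%N; first by rewrite subn0 modnn.
  by rewrite modn_small ?subnK ?mul1n// ltn_subrL lt0n x0.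
have [q hq] := h1.
set y := nat_of_ord (- x)%R in hq *.
apply: (@ex_cong _ _ (j * q) (k * y)).
have jy : (j * y <= k * N * y)%N by rewrite leq_mul2r jk orbT.
rewrite -mulnA -hq mulnBl mulnDr addnA subnK// addnC; congr (_ + _)%N.
by rewrite mulnAC.
Qed.

Lemma gb_parity : has_parity gb a.
Proof.
move=> x; rewrite /gb g_parity rmorphM; congr (_ * _).
by rewrite rmorphXn rmorphN rmorph1.
Qed.

Lemma fhat0_gb : fhat N (lift_arith gb) 0 = 0.
Proof.
transitivity ((fhat N (lift_arith g) 0)^*); last by rewrite holomorphic_mean0//= oppr0.
rewrite !fhat_Zp rmorph_sum; apply: eq_bigr => x _.
by rewrite mul0n mul0r ex0 !mulr1.
Qed.

(** At real s = x >= 3 the points (x + a)/2 > 1 and (a - 1 - x)/2 < 0 are in the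
    range of the two recursions of Gamma. *)
Lemma feq_shift x eps : 3 <= x -> eps != 0 ->
  Lambda a g x%:C = eps * Lambda a gb (1 - x%:C) ->
  Lambda a g (x%:C + 2) = eps * Lambda a gb (1 - (x%:C + 2)) ->
  perE N (lift_arith g) x%:C != 0 ->
  perE N (lift_arith g) x%:C * perE N (lift_arith gb) (- 1 - x%:C) =
  (N%:R / pi)%:C ^+ 2 * ((x%:C + a%:R) / 2) * ((a%:R - 1 - x%:C) / 2) *
  (perE N (lift_arith g) (x%:C + 2) * perE N (lift_arith gb) (1 - x%:C)).
Proof.
move=> x3 eps0 E1 E2 L0.
have two0 : 2 != 0 :> R[i] by rewrite pnatr_eq0.
set ur : R := (x + a%:R) / 2; set vr : R := (a%:R - 1 - x) / 2.
have a0 : 0 <= a%:R :> R by [].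
have a1 : a%:R <= 1 :> R by rewrite (ler_nat _ a 1).
set P := N%:R / pi; have P0 : 0 < P by rewrite divr_gt0 ?pi_gt0// ltr0n.
have uE : (x%:C + a%:R) / 2 = ur%:C.
  by rewrite /ur !(rmorphM (real_complex R)) (rmorphD (real_complex R)) (fmorphV (real_complex R)) !rmorph_nat.
have vE : (a%:R - 1 - x%:C) / 2 = vr%:C.
  by rewrite /vr !(rmorphM (real_complex R)) !(rmorphB (real_complex R)) (fmorphV (real_complex R)) rmorph1 !rmorph_nat.
have u1 : 1 < ur by rewrite /ur; lra.
have v0 : vr < 0 by rewrite /vr; lra.
have w1 : x%:C != 1 :> R[i] by apply/eqP => /(congr1 (@complex.Re R)) /= e; move: x3; rewrite e; lra.
have w2 : x%:C + 2 != 1 :> R[i].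
  by apply/eqP => /(congr1 (@complex.Re R)); rewrite ReD Re_nat /= => e; lra.
have w3 : 1 - x%:C != 1 :> R[i].
  by apply/eqP => /(congr1 (@complex.Re R)); rewrite ReB /= => e; lra.
have w4 : - 1 - x%:C != 1 :> R[i].
  by apply/eqP => /(congr1 (@complex.Re R)); rewrite ReB ReN /= => e; lra.
have e1 : (x%:C + 2 + a%:R) / 2 = ur%:C + 1 by rewrite -uE; field.
have e2 : (1 - x%:C + a%:R) / 2 = vr%:C + 1 by rewrite -vE; field.
have e3 : (1 - (x%:C + 2) + a%:R) / 2 = vr%:C by rewrite -vE; field.
have e4 : 1 - (x%:C + 2) = - 1 - x%:C :> R[i] by ring.
have vn0 : vr%:C != 0 :> R[i] by rewrite (fmorph_eq0 (real_complex R)) lt_eqF.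
have Gv : Gamma (vr%:C + 1) = vr%:C * Gamma vr%:C.
  by apply: Gamma_neg_rec => //=; exact: ltW.
move: E1 E2; rewrite /Lambda uE e1 e2 e3 e4 !(dirichlet_LE hN gB)// !(dirichlet_LE hN gbB)//.
rewrite !rpowcDr rpowcr1// Gv (Gamma_real_rec u1).
rewrite vE.
exact: feq_algebra (rpowc_neq0 P ur%:C) (Gamma_real_neq0 u1) L0.
Qed.

Let L s := perE N (lift_arith g) s.
Let Lb s := perE N (lift_arith gb) s.

(** Equality of meromorphic functions says nothing at s = k itself, hence the
    limit along s = k + 1/(n+1). *)
Lemma feq_nat k : (3 <= k)%N -> L k%:R != 0 ->
  L k%:R * Lb (- 1 - k%:R) =
  (N%:R / pi)%:C ^+ 2 * ((k%:R + a%:R) / 2) * ((a%:R - 1 - k%:R) / 2) *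
  (L (k%:R + 2) * Lb (1 - k%:R)).
Proof.
move=> k3 Lk0.
have kne n m : (n < m)%N -> m%:R != n%:R :> R[i] by move=> nm; rewrite eqr_nat gtn_eqF.
have k1 : k%:R != 1 :> R[i] by apply: (kne 1%N); exact: leq_trans k3.
have k2 : k%:R + 2 != 1 :> R[i] by rewrite -natrD (eqr_nat _ _ 1) addn2.
have k3' : 1 - k%:R != 1 :> R[i].
  by rewrite -subr_eq0 addrAC subrr sub0r oppr_eq0 pnatr_eq0 -lt0n (leq_trans _ k3).
have k4 : - 1 - k%:R != 1 :> R[i].
  apply/eqP => e; have /eqP : (k + 2)%:R = 0 :> R[i].
    rewrite natrD; transitivity (1 - (- 1 - k%:R) : R[i]); first by ring.
    by rewrite e subrr.
  by rewrite pnatr_eq0 addn2.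
have dL s : s != 1 -> cdiff L s by exact: cdiff_perE.
have dLb s : s != 1 -> cdiff Lb s by exact: cdiff_perE.
have d0 s c : cdiff (fun z => c - z) s by apply: cdiffB; [exact: cdiff_cst|exact: cdiff_id].
have d1 s c : cdiff (fun z => z + c) s by apply: cdiffD; [exact: cdiff_id|exact: cdiff_cst].
pose w n : R := k%:R + n.+1%:R^-1.
have wE n : (w n)%:C = k%:R + n.+1%:R^-1.
  by rewrite /w (rmorphD (real_complex R)) (fmorphV (real_complex R)) !rmorph_nat.
have wk : clim \oo (fun n => (w n)%:C) k%:R.
  apply: (eq_clim wE); rewrite -[X in clim _ _ X]addr0.
  by apply: climD; [exact: clim_cst|exact: clim_natV].
have [eps eps0 E] := g_feq.
have /dnbhscP[e1 e10 E1] := E k%:R; have /dnbhscP[e2 e20 E2] := E (k%:R + 2).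
have cl : clim \oo (fun n => L (w n)%:C) (L k%:R).
  by apply: clim_cnear wk; apply: cdiff_cont; exact: dL.
pose F1 z := L z * Lb (- 1 - z).
pose F2 z := (N%:R / pi)%:C ^+ 2 * ((z + a%:R) / 2) * ((a%:R - 1 - z) / 2) *
  (L (z + 2) * Lb (1 - z)).
have dF1 : cdiff F1 k%:R.
  by apply: cdiffM; [exact: dL|apply: (@cdiff_comp _ Lb (fun z => -1 - z)) => //; exact: dLb].
have dF2 : cdiff F2 k%:R.
  apply: cdiffM; last first.
    apply: cdiffM.
      by apply: (@cdiff_comp _ L (fun z => z + 2)) => //; exact: dL.
    by apply: (@cdiff_comp _ Lb (fun z => 1 - z)) => //; exact: dLb.
  apply: cdiffM; [apply: cdiffM; [exact: cdiff_cst|]|].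
    by apply: cdiffM; [exact: d1|exact: cdiff_cst].
  by apply: cdiffM; [exact: d0|exact: cdiff_cst].
have c1 : clim \oo (fun n => F1 (w n)%:C) (F1 k%:R).
  by apply: clim_cnear wk; exact: cdiff_cont.
have c2 : clim \oo (fun n => F2 (w n)%:C) (F2 k%:R).
  by apply: clim_cnear wk; exact: cdiff_cont.
apply: (clim_unique c1); apply: near_clim c2.
have nL : 0 < normc (L k%:R) by rewrite normc_gt0.
near=> n.
have wn : (w n)%:C != k%:R.
  by rewrite wE -subr_eq0 addrAC subrr add0r invr_eq0 pnatr_eq0.
have wn1 : normc ((w n)%:C - k%:R) < e1 by near: n; exact: wk.
have wn2 : normc ((w n)%:C - k%:R) < e2 by near: n; exact: wk.
apply/esym/(@feq_shift (w n) eps) => //.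
- by rewrite /w (le_trans (_ : 3 <= k%:R))// ?(ler_nat _ 3)// lerDl invr_ge0.
- exact: E1.
- apply: E2; first by apply: contra wn => /eqP/addIr/eqP.
  by rewrite opprD addrACA subrr addr0.
- have : normc (L (w n)%:C - L k%:R) < normc (L k%:R) by near: n; exact: cl.
  by rewrite -/(L _); apply: contraTneq => ->; rewrite sub0r normcN ltxx.
Unshelve. all: by end_near. Qed.

Let H := fhat N (lift_arith gb).

Lemma Lb_negnat K : (0 < K)%N -> ~~ odd (a + K.+1) ->
  Lb (- K%:R) = N%:R^-1 * (2 * (K`!)%:R * (N%:R / (twopii R)) ^+ K.+1 * Dser H K.+1%:R).
Proof.
move=> K0 aK; apply: (@perE_negnat _ _ _ _ ((-1) ^+ a)) => //.
- exact: lift_periodic.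
- exact: fhat0_gb.
- by move=> j k; apply: fhat_parity; exact: gb_parity.
- by rewrite normcX normcN normc1 expr1n.
- by rewrite -exprD -signr_odd (negbTE aK).
Qed.

(** The constants cancel, as (N/pi)^2 = -4 (N / (2 pi i))^2 and the product of the
    two Gamma quotients is -k (k+1)/4 for both parities. *)
Lemma Dser_ratio k : (3 <= k)%N -> ~~ odd (a + k) -> L k%:R != 0 ->
  L k%:R * Dser H k.+2%:R = L k.+2%:R * Dser H k%:R.
Proof.
move=> k3 ak Lk0; have := feq_nat k3 Lk0.
case: k k3 ak Lk0 => // k k3 ak Lk0.
have -> : 1 - k.+1%:R = - k%:R :> R[i] by rewrite -natr1; ring.
have -> : - 1 - k.+1%:R = - k.+2%:R :> R[i] by rewrite -!natr1; ring.
have -> : k.+1%:R + 2 = k.+3%:R :> R[i] by rewrite -!natr1; ring.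
have o1 : ~~ odd (a + k.+3) by rewrite 2!addnS /= negbK.
have k0 : (0 < k)%N by case: (k) k3.
rewrite !Lb_negnat//.
have two0 : 2 != 0 :> R[i] by rewrite pnatr_eq0.
have NC0 : N%:R != 0 :> R[i] by rewrite pnatr_eq0 -lt0n.
have pi0 : pi%:C != 0 :> R[i] by rewrite (fmorph_eq0 (real_complex R)) gt_eqF// pi_gt0.
set q := (N%:R / pi)%:C; have q0 : q != 0.
  by rewrite /q (fmorph_eq0 (real_complex R)) mulf_neq0 ?invr_eq0// gt_eqF// pi_gt0.
have cq : (N%:R / twopii R) ^+ 2 = - (q ^+ 2 / 4%:R).
  have -> : twopii R = 2 * 'i * pi%:C by apply: complex_ext => /=; ring.
  rewrite /q (rmorphM (real_complex R)) (fmorphV (real_complex R)) rmorph_nat.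
  have key (n p i : R[i]) : p != 0 -> i ^+ 2 = -1 ->
      (n / (2 * i * p)) ^+ 2 = - ((n / p) ^+ 2 / 4%:R).
    by move=> p0 i2; rewrite expr_div_n !exprMn i2; field; rewrite p0.
  by apply: key => //; exact: sqr_i.
have uv : ((k.+1%:R + a%:R) / 2) * ((a%:R - 1 - k.+1%:R) / 2) =
    - (k.+1%:R * k.+2%:R / 4%:R) :> R[i].
  by case: (a) ha => [|[|]]// _; rewrite -!natr1; field.
rewrite -[q ^+ 2 * _ * _]mulrA uv => E.
have c0 : N%:R / twopii R != 0 by rewrite mulf_neq0// invr_eq0 twopii_neq0.
have M0 : N%:R^-1 * (2 * (k`!)%:R * (N%:R / twopii R) ^+ k.+1) *
    (q ^+ 2 * (k.+1%:R * k.+2%:R / 4%:R)) != 0.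
  by rewrite !mulf_neq0 ?invr_eq0 ?pnatr_eq0 ?expf_neq0// -lt0n ?fact_gt0.
apply: (mulfI M0).
have fE : (k.+2`!)%:R = k.+2%:R * (k.+1%:R * (k`!)%:R) :> R[i] by rewrite !factS !natrM.
move: E; rewrite fE (exprD _ 2 k.+1) cq.
move: (L k.+1%:R) (L k.+3%:R) (Dser H k.+3%:R) (Dser H k.+1%:R) => l1 l3 h3 h1.
move: ((_ / twopii R) ^+ _) (k`!)%:R k.+1%:R k.+2%:R => C f k1 k2 E.
rewrite -[LHS]opprK -[RHS]opprK; congr (- _).
transitivity (l1 * (N%:R^-1 * (2 * (k2 * (k1 * f)) * (- (q ^+ 2 / 4%:R) * C) * h3))).
  by ring.
by rewrite E; ring.
Qed.

Lemma Lk_Dser k : (1 < k)%N -> L k%:R = Dser (lift_arith g) k%:R.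
Proof.
move=> k1; apply: perE_Dser => //; first exact: lift_periodic.
by rewrite Re_nat ltr1n.
Qed.

(** The ratio L(k, h) / L(k, g) does not depend on k >= J of the given parity,
    where h is the Fourier transform of conj g; so h and rho g have the same
    Dirichlet coefficients. By Fourier inversion rho <> 0. *)
Theorem fhat_conj_proportional : exists2 tau : R[i], tau != 0 &
  forall n, fhat N (lift_arith gb) n = tau * g n%:R.
Proof.
have bg : bounded_arith (lift_arith g) by exact: bounded_lift.
have bH : bounded_arith H.
  by apply: (@periodic_bounded _ N) => // n; rewrite {2}(divn_eq n N) addnC /H fhat_period.
have [J0 _ J0P] : \forall k \near \oo, L k%:R != 0.
  have h0 : forall i, (i < 0)%N -> lift_arith g i.+1 = 0 by [].
  have := clim_Dser_lead bg h0 => /(_ 1 ltr01) h1.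
  near=> k.
  have k2 : (1 < k)%N by near: k; exists 2%N.
  have : normc (1%:R ^+ k * Dser (lift_arith g) k%:R - lift_arith g 1) < 1 by near: k.
  rewrite expr1n mul1r -Lk_Dser//; apply: contraTneq => ->.
  by rewrite sub0r normcN /lift_arith g1 normc1 ltxx.
set J := (J0 + 3)%N.
pose kk j := (2 * j + a)%N.
have kkP j : ~~ odd (a + kk j) by rewrite /kk mul2n addnCA !oddD odd_double addbb.
have Jk j : (J <= j)%N -> (3 <= kk j)%N /\ L (kk j)%:R != 0.
  rewrite /J /kk => Jj; split; first by lia.
  by apply: J0P => /=; lia.
pose rho := Dser H (kk J)%:R / L (kk J)%:R.
have ratio j : (J <= j)%N -> Dser H (kk j)%:R = rho * L (kk j)%:R.
  move=> /subnK <-; elim: (j - J)%N => [|i IH]; first by rewrite add0n /rho divfK//; have [] := Jk J (leqnn J).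
  have [k3 Lk] := Jk (i + J)%N (leq_addl _ _).
  have := Dser_ratio k3 (kkP _) Lk.
  have -> : (kk (i + J)).+2 = kk (i.+1 + J)%N by rewrite /kk; lia.
  by rewrite IH => h; apply: (mulfI Lk); rewrite h; ring.
have He n : H n.+1 = rho * g n.+1%:R.
  pose e i := H i - rho * lift_arith g i.
  apply/eqP; rewrite -subr_eq0; apply/eqP.
  apply: (@Dser_unique _ e a J).
    have [B1 b1] := bH; have [B2 b2] := bg; exists (B1 + normc rho * B2) => i.
    by rewrite (le_trans (le_normcB _ _))// lerD// normcM ler_wpM2l// normc_ge0.
  move=> j Jj; rewrite -/(kk j); have [k3 _] := Jk j Jj.
  have k1 : 1 < Re ((kk j)%:R : R[i]) by rewrite Re_nat ltr1n; apply: leq_trans k3.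
  rewrite /Dser (@eq_csum _ _ (fun n => H n.+1 * phi (kk j)%:R n.+1%:R - rho * (lift_arith g n.+1 * phi (kk j)%:R n.+1%:R))); last first.
    by move=> i; rewrite /e mulrBl mulrA.
  rewrite csumB; [|exact: csummable_Dser|apply: csummableZ; exact: csummable_Dser].
  rewrite csumZ; last exact: csummable_Dser.
  rewrite -/(Dser H _) -/(Dser (lift_arith g) _) ratio// Lk_Dser ?subrr//.
  exact: leq_trans k3.
have He' n : H n = rho * g n%:R.
  have <- : H (n + 1 * N) = H n by exact: fhat_period.
  have -> : (n + 1 * N = (n + N.-1).+1)%N by rewrite mul1n -addnS prednK.
  rewrite He; congr (_ * g _); rewrite -addnS prednK// natrD.
  by rewrite pchar_Zp// addr0.
exists rho => //; apply/eqP => r0.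
have := fourier_inversion 1 N0 (lift_periodic gb hN).
rewrite big1 ?mulr0; last by move=> i _; rewrite -/H He' r0 !mul0r.
rewrite /lift_arith /gb g1 => /eqP.
by rewrite rmorph1 oner_eq0.
Unshelve. all: by end_near. Qed.

End FunctionalEquation.

(** * Conjugation of relations between roots of unity *)
Section CyclotomicConjugates.
Implicit Types (F : numFieldType) (n k : nat).

(** z is a root of X^n - 1, the product of the Phi_d with d | n, and a root of
    Phi_d is one of X^d - 1. *)
Lemma root_Cyclotomic F n (z : F) : n.-primitive_root z ->
  root (map_poly intr 'Phi_n) z.
Proof.
move=> zn; have n0 := prim_order_gt0 zn.
have h d : (0 < d)%N -> \prod_(e <- divisors d) map_poly (intr : int -> F) 'Phi_e = 'X^d - 1.
  by move=> d0; rewrite -rmorph_prod prod_Cyclotomic// rmorphB rmorph1 /= map_polyXn.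
have : root (\prod_(e <- divisors n) map_poly (intr : int -> F) 'Phi_e) z.
  by rewrite h// rootE !hornerE (prim_expr_order zn) subrr.
rewrite rootE horner_prod prodf_seq_eq0 => /hasP[d].
rewrite -dvdn_divisors// -rootE => dn dz; have d0 := dvdn_gt0 n0 dn.
suff -> : n = d by [].
apply/eqP; rewrite eqn_dvd dn andbT (prim_order_dvd zn).
have : root (\prod_(e <- divisors d) map_poly (intr : int -> F) 'Phi_e) z.
  rewrite rootE horner_prod prodf_seq_eq0; apply/hasP; exists d; last by rewrite -rootE.
  by rewrite -dvdn_divisors.
by rewrite h// rootE !hornerE subr_eq0.
Qed.

(** Irreducibility of Phi_n over the rationals, from its being the minimal
    polynomial of an algebraic root of unity. *)
Lemma Cyclotomic_dvdp_or_coprimep n (P : {poly rat}) : (0 < n)%N ->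
  (map_poly intr 'Phi_n %| P)%R || coprimep P (map_poly intr 'Phi_n).
Proof.
move=> n0; set p := map_poly _ _; have [z zn] := C_prim_root_exists n0.
have [q [qE qm qP]] := minCpolyP z.
have pq : p = q.
  apply: (map_poly_inj (ratr : {rmorphism rat -> algC})).
  rewrite -qE (minCpoly_cyclotomic zn) -(Cintr_Cyclotomic zn) /p -map_poly_comp.
  by apply: eq_map_poly => i /=; rewrite ratr_int.
rewrite pq; apply/orP; set G := gcdp P q.
have Gq : (G %| q)%R by exact: dvdp_gcdr.
have [zG|zG] := boolP (root (map_poly ratr G) z).
  by left; rewrite qP in zG; apply: dvdp_trans zG (dvdp_gcdl _ _).
right; have : root (map_poly ratr (q %/ G * G)) z by rewrite divpK// qP.
rewrite rmorphM rootM (negbTE zG) orbF qP => qd.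
have q0 : q != 0 by exact: monic_neq0.
have d0 : (q %/ G)%R != 0 by apply: contra q0 => /eqP e; rewrite -(divpK Gq) e mul0r.
have G0 : G != 0 by apply: contra q0 => /eqP e; rewrite -(divpK Gq) e mulr0.
have := dvdp_leq d0 qd; rewrite size_divp// /coprimep -/G.
have := dvdp_leq q0 Gq.
have : (0 < size G)%N by rewrite size_poly_gt0.
by move: (size q) (size G) => a b; lia.
Qed.

(** Galois conjugation without Galois groups: the primitive n-th roots of unity
    satisfy the same integer polynomial relations. *)
Lemma int_relation_conj F n k (z : F) (P : {poly int}) : n.-primitive_root z ->
  coprime k n -> root (map_poly intr P) z -> root (map_poly intr P) (z ^+ k).
Proof.
move=> zn kn Pz; have n0 := prim_order_gt0 zn.
have PE : map_poly (intr : int -> F) P = map_poly ratr (map_poly (intr : int -> rat) P).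
  by rewrite -map_poly_comp; apply: eq_map_poly => i /=; rewrite ratr_int.
have PhiE : map_poly (intr : int -> F) 'Phi_n = map_poly ratr (map_poly (intr : int -> rat) 'Phi_n).
  by rewrite -map_poly_comp; apply: eq_map_poly => i /=; rewrite ratr_int.
have zk : n.-primitive_root (z ^+ k) by rewrite prim_root_exp_coprime.
have /orP[/dvdpP[Q QE]|/Bezout_eq1_coprimepP[[u v] /= uv]] :=
  Cyclotomic_dvdp_or_coprimep (map_poly intr P) n0.
  by rewrite PE QE rmorphM /= -PhiE rootM root_Cyclotomic ?orbT.
have := congr1 (fun q => (map_poly (ratr : rat -> F) q).[z]) uv.
rewrite rmorphD !rmorphM rmorph1 /= -PE -PhiE !hornerE.
by rewrite (rootP Pz) (rootP (root_Cyclotomic zn)) !mulr0 addr0 => /esym/eqP; rewrite oner_eq0.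
Qed.

End CyclotomicConjugates.

(** * Complete multiplicativity of f *)
Section Multiplicativity.
Variables (R : realType) (N m : nat) (f : 'Z_N -> R[i]).
Hypotheses (hN : (1 < N)%N) (hm : (1 < m)%N).
Hypothesis f_mu : forall x : 'Z_N, m.-unity_root (f x) \/ f x = 0.
Hypothesis f0 : forall x : 'Z_N, f x = 0 <-> (1 < gcdn x N)%N.

Hypothesis f1 : f 1 = 1.
Implicit Types (x : 'Z_N) (c b n j k : nat).

Let powc (c : nat) (x : 'Z_N) : R[i] := if coprime x N then f x ^+ c else 0.
(** The conclusion drawn from the functional equation. *)
Let relation (g : 'Z_N -> R[i]) := exists2 tau : R[i], tau != 0 &
  forall n, fhat N (lift_arith (fun x => (g x)^*)) n = tau * g n%:R.

Let N0 : (0 < N)%N. Proof. exact: ltnW. Qed.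
Let m0 : (0 < m)%N. Proof. exact: ltnW. Qed.
Let mN0 : (0 < m * N)%N. Proof. by rewrite muln_gt0 m0 N0. Qed.

Let z : R[i] := ex ((m * N)%:R^-1).

Lemma prim_ex n : (0 < n)%N -> n.-primitive_root (ex n%:R^-1 : R[i]).
Proof.
move=> n0; have nn0 : n%:R != 0 :> R by rewrite pnatr_eq0 -lt0n.
apply/andP; split => //; apply/forallP => i.
rewrite unity_rootE -ex_natM.
have [->|ni] := eqVneq i.+1 n; first by rewrite mulfV// ex1 eqxx.
rewrite (negbTE (ex_neq1 _ _))//; first by rewrite divr_gt0// ltr0n.
by rewrite ltr_pdivrMr ?ltr0n// mul1r ltr_nat ltn_neqAle ni ltn_ord.
Qed.

Lemma z_prim : (m * N).-primitive_root z. Proof. exact: prim_ex. Qed.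

Lemma unit_mu x : coprime x N -> f x ^+ m = 1.
Proof.
move=> xN; have [/unity_rootP//|fx0] := f_mu x.
by move/f0: fx0; rewrite (eqP xN).
Qed.

Lemma fexp_ex : exists e : 'Z_N -> nat, forall x, coprime x N -> f x = z ^+ (N * e x).
Proof.
have zN : m.-primitive_root (z ^+ N) by have := dvdn_prim_root z_prim (dvdn_mulr N (dvdnn m)); rewrite mulKn.
have h x : exists e, coprime x N -> f x = z ^+ (N * e).
  have [xN|_] := boolP (coprime x N); last by exists 0%N.
  have [i ->] := prim_rootP zN (unit_mu xN).
  by exists i => _; rewrite exprM.
by have [e he] := choice h; exists e.
Qed.

Lemma conj_unit c x : coprime x N -> (powc c x)^* = f x ^+ (c * m.-1).
Proof.
move=> xN; rewrite /powc xN rmorphXn /= mulnC exprM; congr (_ ^+ _).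
have [e /(_ x xN) fE] := fexp_ex.
have zc : z^* = z^-1 by rewrite /z -exN; exact: conj_ex.
have fx : (f x)^* = (f x)^-1.
  rewrite fE; transitivity ((z^*) ^+ (N * e x)); first exact: rmorphXn.
  by rewrite -exprVn; congr (_ ^+ _); exact: zc.
have fn0 : f x != 0 by rewrite fE expf_neq0// ex_neq0.
by rewrite fx; apply: (mulIf fn0); rewrite mulVf// -exprSr prednK// unit_mu.
Qed.

Lemma expr_cong x j c : coprime x N -> j = c %[mod m] -> f x ^+ j = f x ^+ c.
Proof. by move=> xN jc; rewrite -(expr_mod _ (unit_mu xN)) jc expr_mod// unit_mu. Qed.

Lemma fhat_powc c j :
  fhat N (lift_arith (fun x => (powc c x)^*)) j =
  \sum_(x : 'Z_N | coprime x N) f x ^+ (c * m.-1) * ex ((j * x)%:R / N%:R).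
Proof.
rewrite fhat_Zp// [RHS]big_mkcond; apply: eq_bigr => x _.
case: ifP => xN; first by rewrite conj_unit.
by rewrite /powc xN rmorph0 mul0r.
Qed.

Lemma coprime_Zp n : coprime (n%:R : 'Z_N) N = coprime n N.
Proof. by rewrite val_Zp_nat// coprime_modl. Qed.

(** The Chinese remainder theorem for moduli that need not be coprime. *)
Lemma crt c b : b = c %[mod gcdn m N] -> exists k, k = c %[mod m] /\ k = b %[mod N].
Proof.
move=> bc; set d := gcdn m N in bc.
have [a _ ha] := Bezoutr m N0; rewrite -/d in ha.
(* b + c N replaces b, so that the difference to c is a natural number *)
have cb : (c <= b + c * N)%N by rewrite (leq_trans _ (leq_addl _ _))// leq_pmulr.
have /dvdnP[t ht] : (d %| b + c * N - c)%N.
  rewrite -eqn_mod_dvd//.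
  by rewrite -modnDmr -modnMmr (eqP (dvdn_gcdr m N)) muln0 mod0n addn0 bc.
exists (c + m * (a * N.-1 * t))%N; split; first by rewrite addnC mulnC modnMDl.
have /dvdnP[w hw] := ha.
have e1 : (m * a * N.-1 + w * N = d + m * a * N)%N.
  by rewrite -hw -{2}(prednK N0); lia.
have e2 : (c + m * (a * N.-1 * t) + w * t * N = b + (c + m * a * t) * N)%N.
  have := congr1 (muln^~ t) e1; rewrite !mulnDl => e3; lia.
rewrite -(modnMDl (w * t)) addnC e2 addnC modnMDl//.
Qed.

Lemma ex_modn A B : A = B %[mod N] -> ex (A%:R / N%:R) = ex (B%:R / N%:R : R).
Proof.
move=> AB; apply: (@ex_cong _ _ hN _ _ (B %/ N) (A %/ N)).
by rewrite {1}(divn_eq A N) {2}(divn_eq B N) AB; lia.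
Qed.

(** The relations for f, with tau_1 eliminated, are conjugated by an exponent k
    congruent to c modulo m and to b modulo N: this raises f to the power c and
    multiplies the frequency by b. *)
Lemma twist_shift c b n : coprime c m -> coprime b N ->
  b = c %[mod gcdn m N] -> relation (powc 1) -> relation (powc c) ->
  coprime n N -> powc c (b * n)%:R = powc c b%:R * powc c n%:R.
Proof.
move=> cm bN bc [tau1 _ rel1] [tau tau0 rel] nN.
have [e fE] := fexp_ex.
pose nn : 'Z_N := n%:R.
have nnN : coprime nn N by rewrite coprime_Zp.
(* conj (f x) e(q x / N) = z ^ E q x for the root of unity z of order m N *)
pose E q x := (N * (e x * m.-1) + m * (q * x))%N.
pose P : {poly int} := \sum_(x : 'Z_N | coprime x N) 'X^(E n x) -
  'X^(N * e nn) * \sum_(x : 'Z_N | coprime x N) 'X^(E 1 x).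
have zm : z ^+ m = ex N%:R^-1.
  by rewrite /z -ex_natM natrM invfM mulrA mulfV ?mul1r// pnatr_eq0 -lt0n.
have term q j c' b' x : coprime x N -> j = c' %[mod m] -> j = b' %[mod N] ->
    (z ^+ j) ^+ (E q x) = f x ^+ (c' * m.-1) * ex ((b' * q * x)%:R / N%:R).
  move=> xN jc jb; rewrite exprD; congr (_ * _).
    rewrite -exprM (_ : (j * _ = N * e x * (j * m.-1))%N); last by lia.
    by rewrite exprM -fE//; apply: expr_cong => //; rewrite -modnMml jc modnMml.
  rewrite -exprM (_ : (j * _ = m * (j * q * x))%N); last by lia.
  rewrite exprM zm -ex_natM; apply: ex_modn.
  by rewrite -!mulnA -modnMml jb modnMml.
have eval j c' b' : j = c' %[mod m] -> j = b' %[mod N] ->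
    (map_poly intr P).[z ^+ j] =
    fhat N (lift_arith (fun x => (powc c' x)^*)) (b' * n) -
    f nn ^+ c' * fhat N (lift_arith (fun x => (powc c' x)^*)) b'.
  move=> jc jb; rewrite rmorphB rmorphM !rmorph_sum /= map_polyXn !hornerE !horner_sum.
  congr (_ - _ * _).
  - rewrite fhat_powc; apply: eq_bigr => x xN.
    by rewrite map_polyXn hornerXn (term _ _ _ _ _ xN jc jb).
  - by rewrite -exprM mulnC exprM -fE//; exact: expr_cong.
  - rewrite fhat_powc; apply: eq_bigr => x xN.
    by rewrite map_polyXn hornerXn (term _ _ _ _ _ xN jc jb) muln1.
have Pz : root (map_poly intr P) z.
  rewrite rootE -[z]expr1 (eval 1%N 1%N 1%N)// !rel1 mul1n /powc -/nn nnN coprime_Zp coprime1n [f 1%:R]f1.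
  by rewrite !expr1 mulr1 mulrC subrr.
have [k [kc kb]] := crt bc.
have kmN : coprime k (m * N).
  by rewrite coprimeMr -coprime_modl kc coprime_modl cm -coprime_modl kb coprime_modl bN.
have := int_relation_conj z_prim kmN Pz.
rewrite rootE (eval k c b)// !rel subr_eq0 => /eqP h.
apply: (mulfI tau0); rewrite h /powc -/nn nnN; ring.
Qed.

Lemma expr_coprime_inj c (u v : R[i]) : coprime c m -> u ^+ m = 1 -> v ^+ m = 1 ->
  u ^+ c = v ^+ c -> u = v.
Proof.
move=> cm um vm uv.
have c0 : (0 < c)%N by rewrite lt0n; apply: contraTneq cm => ->; rewrite /coprime gcd0n gtn_eqF.
have [[p q] /= pq] := coprimeP _ c0 cm.
have e : (c * p = m * q + 1)%N by lia.
have h (w : R[i]) : w ^+ m = 1 -> w = (w ^+ c) ^+ p.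
  by move=> wm; rewrite -exprM e exprD exprM wm expr1n mul1r expr1.
by rewrite (h u um) (h v vm) uv.
Qed.

Lemma twistE (c : {unit 'Z_m}) : twist f c = powc (val c : 'Z_m).
Proof. by []. Qed.

Lemma unit_coprime (c : {unit 'Z_m}) : coprime (val c : 'Z_m) m.
Proof. by rewrite coprime_sym -unitZpE// natr_Zp (valP c). Qed.

Lemma multiplicative_of_relations (H : {group {unit 'Z_m}}) :
  reduction_surjective (gcdn m N) H ->
  (forall c : {unit 'Z_m}, c \in H -> relation (twist f c)) ->
  forall b n, f (b * n)%:R = f b%:R * f n%:R.
Proof.
move=> Hs Hr b n.
have f0' k : ~~ coprime k N -> f k%:R = 0.
  move=> kN; apply/f0; rewrite val_Zp_nat// gcdn_modl ltn_neqAle eq_sym kN.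
  by rewrite gcdn_gt0 N0 orbT.
have [bN|/[dup] bN /f0' ->] := boolP (coprime b N); last first.
  by rewrite mul0r f0'// coprimeMl negb_and bN.
have [nN|/[dup] nN /f0' ->] := boolP (coprime n N); last first.
  by rewrite mulr0 f0'// coprimeMl negb_and nN orbT.
have bd : coprime b (gcdn m N) by apply: coprime_dvdr bN; exact: dvdn_gcdr.
have [c cH cb] := Hs b bd.
have r1 : relation (powc 1) by have := Hr 1%g (group1 H); rewrite twistE.
have rc : relation (powc (val c : 'Z_m)) by rewrite -twistE; exact: Hr.
have um k : coprime k N -> f k%:R ^+ m = 1 by move=> kN; apply: unit_mu; rewrite coprime_Zp.
have := twist_shift (unit_coprime c) bN (esym cb) r1 rc nN.
have bnN : coprime (b * n) N by rewrite coprimeMl bN.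
rewrite /powc !coprime_Zp bN nN bnN -exprMn.
by apply: expr_coprime_inj; rewrite ?unit_coprime// ?exprMn ?um// mulr1.
Qed.

End Multiplicativity.

(** * The Euler product *)
Section Sieve.
Variables (R : realType) (F : nat -> R[i]) (s : R[i]).
Hypotheses (F1 : F 1%N = 1) (FM : forall b n, F (b * n)%N = F b * F n).
Hypotheses (FB : forall n, normc (F n) <= 1) (hs : 1 < Re s).
Implicit Types (k n p : nat).

Definition rough k n := all (leq k) (primes n).

Lemma rough_prime k n : prime k -> (0 < n)%N ->
  rough k.+1 n = rough k n && ~~ (k %| n)%N.
Proof.
move=> kp n0; apply/allP/andP => [h|[/allP h kn] p pn].
  split; first by apply/allP => p /h /ltnW.
  by apply/negP => kn; have := h k; rewrite mem_primes kp n0 kn ltnn => /(_ isT).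
rewrite ltn_neqAle h// andbT; apply: contraNneq kn => ->.
by move: pn; rewrite mem_primes => /and3P[].
Qed.

Lemma rough_nprime k n : ~~ prime k -> rough k.+1 n = rough k n.
Proof.
move=> kp; apply/allP/allP => h p pn; first exact/ltnW/h.
rewrite ltn_neqAle h// andbT; apply: contraNneq kp => ->.
by move: pn; rewrite mem_primes => /and3P[].
Qed.

Lemma roughM k n : prime k -> (0 < n)%N -> rough k (k * n) = rough k n.
Proof.
move=> kp n0; have k0 := prime_gt0 kp.
apply/allP/allP => h p pn; first by apply: h; rewrite primesM// pn orbT.
move: pn; rewrite primesM// => /orP[|/h//].
by rewrite primes_prime// inE => /eqP ->.
Qed.

Lemma rough_small k n : (1 < n)%N -> (n < k)%N -> rough k n = false.
Proof.
move=> n1 nk; apply/allP => /(_ (pdiv n)).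
rewrite mem_primes pdiv_prime// pdiv_dvd (ltnW n1) => /(_ isT) h.
by have := leq_trans nk h; rewrite ltnNge dvdn_leq ?pdiv_dvd// ltnW.
Qed.

Definition sieved k n := if rough k n then F n else 0.

Lemma bounded_sieved k : bounded_arith (sieved k).
Proof. by exists 1 => n; rewrite /sieved; case: ifP; rewrite ?normc0. Qed.

(** The terms removed are those of the integers k q with q still rough. *)
Lemma sieve_step k : prime k ->
  Dser (sieved k.+1) s = (1 - F k * phi s k%:R) * Dser (sieved k) s.
Proof.
move=> kp; have k0 := prime_gt0 kp.
have b1 := bounded_sieved k; have b2 := bounded_stretch k b1.
rewrite mulrBl mul1r -mulrA -Dser_stretch// -csumZ; last exact: csummable_Dser.
rewrite -csumB; [|exact: csummable_Dser|apply: csummableZ; exact: csummable_Dser].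
apply: eq_csum => n; rewrite mulrA -mulrBl; congr (_ * _).
rewrite /sieved rough_prime// /stretch.
have [/dvdnP[q nq]|kn] := boolP (k %| n.+1)%N; last by rewrite andbT mulr0 subr0.
have q0 : (0 < q)%N by case: q nq.
rewrite andbF nq mulnK// mulnC roughM//; case: ifP => _; last by rewrite mulr0 subrr.
by rewrite FM subrr.
Qed.

Lemma normc_term_lt1 p : prime p -> normc (F p * phi s p%:R) < 1.
Proof.
move=> pp; have p0 : 0 < p%:R :> R by rewrite ltr0n prime_gt0.
rewrite normcM normc_phi// (@le_lt_trans _ _ (1 * expR (- Re s * ln p%:R)))//.
  by rewrite ler_wpM2r// expR_ge0.
rewrite mul1r -[X in _ < X]expR0 ltr_expR mulNr oppr_lt0 mulr_gt0 ?ln_gt0 ?ltr1n ?prime_gt1//.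
exact: lt_trans hs.
Qed.

Lemma sieve_prod n :
  (\prod_(p < n | prime p) (1 - F p * phi s p%:R)) * Dser F s = Dser (sieved n) s.
Proof.
elim: n => [|n IH].
  rewrite big_ord0 mul1r; apply: eq_csum => i; rewrite /sieved ifT//.
  by apply/allP => p.
rewrite big_mkcond big_ord_recr /= -big_mkcond /=.
case: ifP => np; last by rewrite mulr1 IH /Dser; apply: eq_csum => i; rewrite /sieved rough_nprime ?np.
by rewrite mulrAC IH mulrC -sieve_step.
Qed.

(** Every n > 1 is sieved out eventually. *)
Lemma sieve_limit : clim \oo (fun n => Dser (sieved n) s) 1.
Proof.
pose u i : R[i] := if i == 0%N then 1 else 0.
have <- : csum u = 1.
  apply: csumP => eps eps0; exists 1%N => // k /= k1.
  rewrite /series /= (bigD1_seq 0%N) ?iota_uniq ?mem_index_iota//=.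
  rewrite big1 ?addr0 ?subrr ?normc0// => i ni; rewrite /u (negbTE ni)//.
apply: (@csum_dominated _ _ _ _ _ _ (npow (Re s))).
- apply: nearW => n k; rewrite normcM normc_phin ler_piMl ?npow_ge0//.
  by rewrite /sieved; case: ifP; rewrite ?normc0.
- exact: cvg_npow.
- move=> i; apply: near_clim; last exact: clim_cst.
  exists i.+2 => // n /= ni; rewrite /sieved /u.
  case: i ni => [|i] ni; last by rewrite rough_small ?mul0r.
  by rewrite /= F1 /phi mul1r rpowc1l.
Qed.

(** The first n Euler factors turn the series into the sum over the n-rough
    integers, which tends to its first term 1. *)
Theorem euler_product :
  clim \oo (fun n => \prod_(p < n | prime p) (1 - F p * phi s p%:R)^-1) (Dser F s).
Proof.
have h : clim \oo (fun n => Dser F s * (Dser (sieved n) s)^-1) (Dser F s).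
  rewrite -[X in clim _ _ X]mulr1 -[X in clim _ _ (_ * X)]invr1.
  by apply: climZ; apply: climV; [exact: oner_neq0|exact: sieve_limit].
apply: near_clim h; have := sieve_limit ltr01; apply: filterS => n Sn.
have S0 : Dser (sieved n) s != 0.
  by apply: contraTneq Sn => ->; rewrite sub0r normcN normc1 ltxx.
rewrite prodfV; apply: (mulIf S0); rewrite divfK// -sieve_prod mulrA mulVf ?mul1r//.
rewrite prodf_seq_neq0; apply/allP => p _; apply/implyP => pp.
rewrite subr_eq0; apply: contraTneq (normc_term_lt1 pp) => <-.
by rewrite normc1 ltxx.
Qed.

End Sieve.

Theorem corollary1p4 (R : realType) (N m : nat) (hN : (1 < N)%N)
    (hm : (1 < m)%N) (f : 'Z_N -> R[i]) (a : nat)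
    (f_mu : forall x : 'Z_N, m.-unity_root (f x) \/ f x = 0)
    (f_order : has_order f m)
    (ha : a = 0%N \/ a = 1%N)
    (f_parity : has_parity f a)
    (f1 : f 1 = 1)
    (f0 : forall x : 'Z_N, f x = 0 <-> (1 < gcdn x N)%N)
    (H : {group {unit 'Z_m}})
    (H_surj : reduction_surjective (gcdn m N) H)
    (H_reg : forall c : {unit 'Z_m}, c \in H ->
       mero_holomorphic_at (dirichlet_L (twist f c)) 1)
    (H_feq : forall c : {unit 'Z_m}, c \in H ->
       exists2 eps : R[i], eps != 0 &
         mero_eq (Lambda a (twist f c))
           (fun s => eps * Lambda a (fun x => (twist f c x)^*) (1 - s)))
    (s : R[i]) (hs : 1 < complex.Re s) :
  (\prod_(p < n | prime p) (1 - f p%:R / rpowc p%:R s)^-1)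
    @[n --> \oo] --> dirichlet_L f s.
Proof.
have m0 : (0 < m)%N by exact: ltnW.
have N0 : (0 < N)%N by exact: ltnW.
have fB x : normc (f x) <= 1.
  case: (f_mu x) => [/unity_rootP fm|->]; last by rewrite normc0.
  have := congr1 (@normc R) fm; rewrite normcX normc1 => /eqP.
  by rewrite pexpr_eq1 ?normc_ge0// => /eqP ->.
have a1 : (a <= 1)%N by case: ha => ->.
have cN (x : 'Z_N) : coprime (- x : 'Z_N)%R N = coprime x N.
  by rewrite ![coprime _ N]coprime_sym -!unitZpE// !natr_Zp unitrN.
have tB (c : {unit 'Z_m}) x : normc (twist f c x) <= 1.
  by rewrite /twist; case: ifP => _; rewrite ?normc0// normcX exprn_ile1// normc_ge0.
have t1 (c : {unit 'Z_m}) : twist f c 1 = 1.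
  by rewrite /twist f1 expr1n ifT// coprime_sym -unitZpE// natr_Zp unitr1.
have tP (c : {unit 'Z_m}) : has_parity (twist f c) a.
  move=> x; rewrite /twist cN; case: ifP => xN; last by rewrite mulr0.
  rewrite f_parity exprMn; congr (_ * _).
  case: ha => aE; rewrite aE ?expr0 ?expr1n// expr1.
  suff codd : odd (val c : 'Z_m) by rewrite -signr_odd codd expr1.
  (* if f is odd then f(-1) = -1 is an m-th root of unity, hence m is even and c,
     being prime to m, is odd: the parity of f^c is that of f *)
  have m2 : (2 %| m)%N.
    rewrite dvdn2; apply/negP => mo.
    have fm1 : f (-1) = -1 by rewrite f_parity f1 mulr1 aE expr1.
    have [/unity_rootP|] := f_mu (-1); rewrite fm1; last by move/eqP; rewrite oppr_eq0 oner_eq0.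
    rewrite -signr_odd mo expr1 => /eqP; rewrite -subr_eq0 -opprD oppr_eq0.
    by rewrite -[1 + 1]/(2%:R) pnatr_eq0.
  by rewrite -coprimen2; apply: coprime_dvdr m2 (unit_coprime hm c).
have fM := multiplicative_of_relations hN hm f_mu f0 f1 H_surj.
have {}fM : forall b n, f (b * n)%:R = f b%:R * f n%:R.
  apply: fM => c cH.
  exact: (fhat_conj_proportional hN (tB c) a1 (tP c) (t1 c) (H_reg c cH) (H_feq c cH)).
rewrite dirichlet_L_Dser//.
have f11 : lift_arith f 1 = 1 by exact: f1.
have := euler_product f11 fM (fun n => fB n%:R) hs => h.
apply/climP; apply: eq_clim h => n; apply: eq_bigr => p pp.
by rewrite /phi rpowcN /lift_arith.
Qed.
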